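(* Let $K$ be a field, $Q$ a finite quiver, $\succ$ a length admissible order on the set $\mathcal B$ of paths of $Q$, $\mathcal T$ a set of paths of length $2$ in $Q$, and $\Lambda\in\mathrm{GrAlg}(\mathcal T)$. Put $\Lambda^*=KQ/\langle\mathcal T\rangle$. Suppose that $v$ and $w$ are vertices of $Q$. Then for all $n\ge 0$, $$\dim_K\operatorname{Ext}^n_{\Lambda}(S_v(\Lambda),S_w(\Lambda))=\dim_K\operatorname{Ext}^n_{\Lambda^*}(S_v(\Lambda^* ),S_w(\Lambda^* )).$$ In particular, $$\operatorname{pd}_{\Lambda}(S_v(\Lambda))=\operatorname{pd}_{\Lambda^*}(S_v(\Lambda^* ))\quad\text{and}\quad \operatorname{id}_{\Lambda}(S_v(\Lambda))=\operatorname{id}_{\Lambda^*}(S_v(\Lambda^* )),$$ where $\operatorname{pd}$ and $\operatorname{id}$ denote projective and injective dimension.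
   Context: For an ideal $I$ contained in $J^2$, where $J$ is the ideal of $KQ$ generated by the arrows, and $\Lambda=KQ/I$, $S_v(\Lambda)$ denotes the one-dimensional simple $\Lambda$-module associated to the vertex $v$ (on which $v$ acts as the identity and all other vertices and all arrows act as $0$). Modules are taken on one fixed side throughout. (Algebras in $\mathrm{GrAlg}(\mathcal T)$ satisfy $I\subseteq J^2$.) $KQ$ is the path algebra, $\mathcal B$ the set of all finite directed paths in $Q$ (vertices are paths of length $0$), $\ell(p)$ the length of a path; paths are written left to right, so a path $p$ from $v$ to $w$ satisfies $vpw=p$. ''Ideal'' means two-sided ideal and $\langle X\rangle$ is the two-sided ideal generated by $X$. A length admissible order is a well-order $\succ$ on $\mathcal B$ such that for $p,q,r,s,t\in\mathcal B$: $p\succ q$ implies $pr\succ qr$ if both are nonzero; $p\succ q$ implies $sp\succ sq$ if both are nonzero; $p=rqt$ implies $p\succeq q$; and $\ell(p)>\ell(q)$ implies $p\succ q$. For nonzero $x=\sum_{p\in\mathcal B}\alpha_p p\in KQ$, $\mathrm{tip}(x)$ is the $\succ$-largest $p$ with $\alpha_p\neq 0$; for $X\subseteq KQ$, $\mathrm{tip}(X)=\{\mathrm{tip}(x): x\in X, x\ne 0\}$. A nonzero $x$ is uniform if $x=vxw$ for some vertices $v,w$; an element is quadratic if it is a $K$-linear combination of paths of length $2$. An ideal is graded if it is generated by length homogeneous elements. A Gröbner basis of a graded ideal $I$ is a set $\mathcal G\subseteq I$ of length homogeneous uniform elements with $\langle\mathrm{tip}(\mathcal G)\rangle=\langle \mathrm{tip}(I)\rangle$.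 $KQ/I$ is a strong Koszul algebra (with respect to $I$ and $\succ$) if $I$ has a Gröbner basis with respect to $\succ$ consisting of quadratic elements. Given $\mathcal T$: $\mathcal N=\mathcal B\setminus \mathrm{tip}(\langle\mathcal T\rangle)$ (the paths having no subpath in $\mathcal T$); $\mathcal N_2$ is the set of paths of length $2$ in $\mathcal N$; for $t\in\mathcal T$, $\mathcal N_2(t)$ is the set of $n\in\mathcal N_2$ with $t\succ n$ and $n$ having the same start vertex and the same end vertex as $t$. Put $D=\sum_{t\in\mathcal T}|\mathcal N_2(t)|$ and $\mathcal A=K^D$, with points written $X=(x_{t,n})_{t\in\mathcal T,\,n\in\mathcal N_2(t)}$. For $X\in\mathcal A$, $\mathcal G(X)=\{g_t : t\in\mathcal T\}$ with $g_t=t-\sum_{n\in\mathcal N_2(t)}x_{t,n}n$. Finally $\mathrm{GrAlg}(\mathcal T)=\{X\in\mathcal A : KQ/\langle \mathcal G(X)\rangle$ is a strong Koszul algebra with respect to $\langle\mathcal G(X)\rangle$ and $\succ\}$. One writes $KQ/I\in\mathrm{GrAlg}(\mathcal T)$ if $I=\langle\mathcal G(X)\rangle$ for some $X\in \mathrm{GrAlg}(\mathcal T)$. *)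

(* Defs.v *)
From HB Require Import structures.
From mathcomp Require Import all_boot all_order all_algebra.
From mathcomp Require Import generic_quotient ring_quotient.
From mathcomp Require Import finmap boolp monalg.

Set Implicit Arguments.
Unset Strict Implicit.
Unset Printing Implicit Defensive.
Set Warnings "-redundant-canonical-projection,-projection-no-head-constant".

Import GRing.Theory.
Local Open Scope ring_scope.
Local Open Scope quotient_scope.

Section LmodQuotient.
Variables (R : nzRingType) (V : lmodType R) (S : zmodClosed V).

(* The carrier does not depend on the proof, but its scaling does. *)
Definition lquot (_ : forall a, {in S, forall v, a *: v \in S}) : Type :=
  (Quotient.quot S).

Variable hS : forall a, {in S, forall v, a *: v \in S}.
Local Notation Q := (lquot hS).

HB.instance Definition _ := GRing.Zmodule.on Q.

Definition lpi (x : V) : Q := \pi_(Quotient.quot S) x.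

Lemma lpiK (q : Q) : lpi (repr (q : (Quotient.quot S))) = q.
Proof. exact: reprK. Qed.

Lemma lpi_eq x y : (lpi x = lpi y) <-> (x - y \in S).
Proof.
rewrite -/(Quotient.equiv S x y); split.
  by move=> /eqP; rewrite /lpi -Quotient.idealrBE.
by move=> h; apply/eqP; rewrite /lpi -Quotient.idealrBE.
Qed.

Lemma lpiD x y : lpi (x + y) = lpi x + lpi y.
Proof. exact: raddfD. Qed.

Definition lquot_scale (a : R) (q : Q) : Q := lpi (a *: repr (q : (Quotient.quot S))).

Lemma lquot_scaleE a x : lquot_scale a (lpi x) = lpi (a *: x).
Proof.
by apply/lpi_eq; rewrite -scalerBr; apply: hS; apply/lpi_eq; rewrite lpiK.
Qed.

Lemma lquot_scaleA a b q :
  lquot_scale a (lquot_scale b q) = lquot_scale (a * b) q.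
Proof. by rewrite -[q]lpiK !lquot_scaleE scalerA. Qed.

Lemma lquot_scale1 : left_id 1 lquot_scale.
Proof. by move=> q; rewrite -[q]lpiK !lquot_scaleE scale1r. Qed.

Lemma lquot_scaleDr : right_distributive lquot_scale +%R.
Proof.
move=> a p q; rewrite -[p]lpiK -[q]lpiK -lpiD !lquot_scaleE.
by rewrite scalerDr lpiD.
Qed.

Lemma lquot_scaleDl q : {morph lquot_scale^~ q : a b / a + b}.
Proof. by move=> a b; rewrite -[q]lpiK !lquot_scaleE scalerDl lpiD. Qed.

HB.instance Definition _ := GRing.Zmodule_isLmodule.Build R Q
  lquot_scaleA lquot_scale1 lquot_scaleDr lquot_scaleDl.

Lemma lpiZ a x : lpi (a *: x) = a *: lpi x.
Proof. by rewrite [RHS]lquot_scaleE. Qed.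

End LmodQuotient.

Section Dimension.
Variable K : fieldType.

Definition lincomb (V : lmodType K) (I : choiceType) (b : I -> V)
    (c : {malg K[I]}) : V :=
  \sum_(i <- msupp c) c@_i *: b i.

Definition is_basis (V : lmodType K) (I : choiceType) (b : I -> V) : Prop :=
  bijective (lincomb b).

(* Equality of dimensions as cardinal numbers: bases indexed by one set. *)
Definition same_dim (V W : lmodType K) : Prop :=
  exists (I : choiceType) (b : I -> V) (c : I -> W), is_basis b /\ is_basis c.

End Dimension.

(* Modules are left modules; K acts on them through the scalars k%:A of A. *)
Section Homological.
Variables (K : fieldType) (A : algType K).

Section Hom.
Variables M N : lmodType A.

Definition Hom : Type := {linear M -> N}.

HB.instance Definition _ := gen_eqMixin Hom.
HB.instance Definition _ := gen_choiceMixin Hom.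

Definition happ (f : Hom) : {linear M -> N} := f.

Lemma happ_inj (f g : Hom) : (forall x, happ f x = happ g x) -> f = g.
Proof.
case: f g => [f [[af] [sf]]] [g [[ag] [sg]]] /= /funext fg.
by case: _ / fg in ag sg *; congr (GRing.Linear.Pack (GRing.Linear.Class _ _));
   congr (_ _); exact: Prop_irrelevance.
Qed.

Definition hadd (f g : Hom) : Hom := [the {linear M -> N} of happ f \+ happ g].
Definition hopp (f : Hom) : Hom := [the {linear M -> N} of \- happ f].
Definition hzero : Hom := [the {linear M -> N} of \0].

Definition hscale_fun (k : K) (f : Hom) (x : M) : N := k%:A *: happ f x.

Lemma hscale_linear k f : linear (hscale_fun k f).
Proof.
move=> a x y; rewrite /hscale_fun linearP scalerDr !scalerA.
by rewrite mulr_algl mulr_algr.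
Qed.

HB.instance Definition _ k f :=
  GRing.isLinear.Build A M N *:%R (hscale_fun k f) (hscale_linear k f).

Definition hscale k f : Hom := [the {linear M -> N} of hscale_fun k f].

Lemma haddA : associative hadd.
Proof. by move=> f g h; apply: happ_inj => x /=; rewrite addrA. Qed.
Lemma haddC : commutative hadd.
Proof. by move=> f g; apply: happ_inj => x /=; rewrite addrC. Qed.
Lemma hadd0 : left_id hzero hadd.
Proof. by move=> f; apply: happ_inj => x /=; rewrite add0r. Qed.
Lemma haddN : left_inverse hzero hopp hadd.
Proof. by move=> f; apply: happ_inj => x /=; rewrite addNr. Qed.

HB.instance Definition _ := GRing.isZmodule.Build Hom haddA haddC hadd0 haddN.

Lemma hscaleA a b f : hscale a (hscale b f) = hscale (a * b) f.
Proof.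
apply: happ_inj => x /=; rewrite /hscale_fun /= /hscale_fun scalerA.
by rewrite mulr_algl scalerA.
Qed.
Lemma hscale1 : left_id 1 hscale.
Proof. by move=> f; apply: happ_inj => x /=; rewrite /hscale_fun !scale1r. Qed.
Lemma hscaleDr : right_distributive hscale +%R.
Proof.
by move=> a f g; apply: happ_inj => x /=; rewrite /hscale_fun /= scalerDr.
Qed.
Lemma hscaleDl f : {morph hscale^~ f : a b / a + b}.
Proof.
by move=> a b; apply: happ_inj => x /=; rewrite /hscale_fun /= !scalerDl.
Qed.

HB.instance Definition _ := GRing.Zmodule_isLmodule.Build K Hom
  hscaleA hscale1 hscaleDr hscaleDl.

Lemma happD f g x : happ (f + g) x = happ f x + happ g x. Proof. by []. Qed.
Lemma happN f x : happ (- f) x = - happ f x. Proof. by []. Qed.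
Lemma happ0 x : happ 0 x = 0. Proof. by []. Qed.
Lemma happZ k f x : happ (k *: f) x = k%:A *: happ f x. Proof. by []. Qed.

End Hom.

Definition projective (P : lmodType A) : Prop :=
  forall (M N : lmodType A) (p : {linear M -> N}) (f : {linear P -> N}),
    (forall y, exists x, p x = y) ->
    exists g : {linear P -> M}, forall x, p (g x) = f x.

Definition injective_module (E : lmodType A) : Prop :=
  forall (M N : lmodType A) (i : {linear M -> N}) (f : {linear M -> E}),
    injective i -> exists g : {linear N -> E}, forall x, g (i x) = f x.

Record proj_resolution (M : lmodType A) := ProjResolution {
  pr_mod : nat -> lmodType A;
  pr_d : forall n, {linear pr_mod n.+1 -> pr_mod n};
  pr_aug : {linear pr_mod 0 -> M};
  pr_projective : forall n, projective (pr_mod n);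
  pr_aug_surj : forall m, exists x, pr_aug x = m;
  pr_aug_exact : forall x, pr_aug x = 0 <-> exists y, pr_d 0 y = x;
  pr_exact : forall n x, pr_d n x = 0 <-> exists y, pr_d n.+1 y = x }.

Record inj_resolution (M : lmodType A) := InjResolution {
  ir_mod : nat -> lmodType A;
  ir_d : forall n, {linear ir_mod n -> ir_mod n.+1};
  ir_aug : {linear M -> ir_mod 0};
  ir_injective : forall n, injective_module (ir_mod n);
  ir_aug_inj : injective ir_aug;
  ir_aug_exact : forall x, ir_d 0 x = 0 <-> exists y, ir_aug y = x;
  ir_exact : forall n x, ir_d n.+1 x = 0 <-> exists y, ir_d n y = x }.

(* [None] stands for infinity. *)
Definition least (P : nat -> Prop) : option nat :=
  if pselect (exists n, `[< P n >]) is left h then Some (ex_minn h) else None.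

Definition proj_dim (M : lmodType A) : option nat :=
  least (fun n => exists P : proj_resolution M,
           forall i, (n < i)%N -> forall x : pr_mod P i, x = 0).

Definition inj_dim (M : lmodType A) : option nat :=
  least (fun n => exists E : inj_resolution M,
           forall i, (n < i)%N -> forall x : ir_mod E i, x = 0).

Section Cohomology.
Variables (M N : lmodType A) (P : proj_resolution M).

Definition cobd n (f : Hom (pr_mod P n) N) : Hom (pr_mod P n.+1) N :=
  [the {linear _ -> _} of happ f \o pr_d P n].

Definition is_cocycle n : {pred Hom (pr_mod P n) N} :=
  fun f => cobd f == 0.
Arguments is_cocycle : clear implicits.

Lemma is_cocycle_submod n : submod_closed (is_cocycle n).
Proof.
split; first by apply/eqP/happ_inj => x.
move=> a f g /eqP hf /eqP hg; apply/eqP/happ_inj => x.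
have hf' : happ f (pr_d P n x) = 0 := congr1 (fun h => happ h x) hf.
have hg' : happ g (pr_d P n x) = 0 := congr1 (fun h => happ h x) hg.
change (a%:A *: happ f (pr_d P n x) + happ g (pr_d P n x) = 0).
by rewrite hf' hg' scaler0 addr0.
Qed.

HB.instance Definition _ n :=
  GRing.isSubmodClosed.Build K (Hom (pr_mod P n) N) (is_cocycle n)
    (is_cocycle_submod n).

Record cocycle n := Cocycle {
  cocycle_val :> Hom (pr_mod P n) N;
  _ : cocycle_val \in is_cocycle n }.

HB.instance Definition _ n := [isSub for @cocycle_val n].
HB.instance Definition _ n := [Choice of cocycle n by <:].
HB.instance Definition _ n :=
  [SubChoice_isSubLmodule of cocycle n by <:].

Definition is_coboundary n : {pred cocycle n} :=
  match n with
  | 0 => fun f => cocycle_val f == 0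
  | m.+1 => fun f =>
      `[< exists g : Hom (pr_mod P m) N, cocycle_val f = cobd g >]
  end.
Arguments is_coboundary : clear implicits.

Lemma cobd_linear n : linear (@cobd n).
Proof. by move=> a f g; apply: happ_inj. Qed.

Lemma is_coboundary_submod n : submod_closed (is_coboundary n).
Proof.
case: n => [|n]; split=> /=.
- exact/eqP.
- by move=> a f g /eqP hf /eqP hg; apply/eqP; rewrite /= hf hg scaler0 addr0.
- by apply/asboolP; exists 0; apply: happ_inj.
- move=> a f g /asboolP[f' hf] /asboolP[g' hg]; apply/asboolP.
  by exists (a *: f' + g'); rewrite cobd_linear -hf -hg.
Qed.

HB.instance Definition _ n :=
  GRing.isSubmodClosed.Build K (cocycle n) (is_coboundary n)
    (is_coboundary_submod n).

Lemma is_coboundaryZ n a : {in is_coboundary n, forall f, a *: f \in is_coboundary n}.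
Proof. by move=> f hf; apply: rpredZ. Qed.

Definition cohomology n : lmodType K := lquot (@is_coboundaryZ n).

End Cohomology.

Section FreeResolution.
Variable M : lmodType A.

(* The free module on the underlying set of M. *)
Definition free_cover : lmodType A := {malg A[M]}.

Definition free_eval (c : free_cover) : M := \sum_(m <- msupp c) c@_m *: m.

Lemma free_eval_w (d : {fset M}) (c : free_cover) :
  (msupp c `<=` d)%fset -> free_eval c = \sum_(m <- d) c@_m *: m.
Proof.
move=> h; rewrite /free_eval (big_fset_incl _ h) // => m _ /mcoeff_outdom ->.
by rewrite scale0r.
Qed.

Lemma free_eval_linear : linear free_eval.
Proof.
move=> a x y.
pose d := (msupp x `|` msupp y `|` msupp (a *: x + y))%fset.
have dx : (msupp x `<=` d)%fset by rewrite /d -fsetUA fsubsetUl.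
have dy : (msupp y `<=` d)%fset.
  by rewrite /d (fsetUC (msupp x)) -fsetUA fsubsetUl.
have dxy : (msupp (a *: x + y) `<=` d)%fset by rewrite /d fsubsetUr.
rewrite (free_eval_w dx) (free_eval_w dy) (free_eval_w dxy) scaler_sumr.
rewrite -big_split /=.
by apply: eq_bigr => m _; rewrite mcoeffD mcoeffZ scalerDl scalerA.
Qed.

HB.instance Definition _ :=
  GRing.isLinear.Build A free_cover M *:%R free_eval free_eval_linear.

Lemma free_evalU m : free_eval << m >> = m.
Proof.
rewrite /free_eval msuppU oner_eq0 big_seq_fset1 mcoeffUU.
by rewrite scale1r.
Qed.

Definition is_syzygy : {pred free_cover} := fun c => free_eval c == 0.

Lemma is_syzygy_submod : submod_closed is_syzygy.
Proof.
split; first by apply/eqP; rewrite linear0.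
move=> a x y /eqP hx /eqP hy; apply/eqP.
by rewrite free_eval_linear hx hy scaler0 addr0.
Qed.

HB.instance Definition _ :=
  GRing.isSubmodClosed.Build A free_cover is_syzygy is_syzygy_submod.

Record syzygy := Syzygy { syzygy_val :> free_cover; _ : syzygy_val \in is_syzygy }.

HB.instance Definition _ := [isSub for syzygy_val].
HB.instance Definition _ := [Choice of syzygy by <:].
HB.instance Definition _ := [SubChoice_isSubLmodule of syzygy by <:].

Lemma free_cover_projective : projective free_cover.
Proof.
move=> X Y p f /choice[s hs].
pose h (m : M) : X := s (f << m >>).
pose g (c : free_cover) : X := \sum_(m <- msupp c) c@_m *: h m.
have gw (d : {fset M}) (c : free_cover) :
  (msupp c `<=` d)%fset -> g c = \sum_(m <- d) c@_m *: h m.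
  move=> hd; rewrite /g (big_fset_incl _ hd) // => m _ /mcoeff_outdom ->.
  by rewrite scale0r.
have g_lin : linear g.
  move=> a x y.
  pose d := (msupp x `|` msupp y `|` msupp (a *: x + y))%fset.
  have dx : (msupp x `<=` d)%fset by rewrite /d -fsetUA fsubsetUl.
  have dy : (msupp y `<=` d)%fset.
    by rewrite /d (fsetUC (msupp x)) -fsetUA fsubsetUl.
  have dxy : (msupp (a *: x + y) `<=` d)%fset by rewrite /d fsubsetUr.
  rewrite (gw _ _ dx) (gw _ _ dy) (gw _ _ dxy) scaler_sumr -big_split /=.
  by apply: eq_bigr => m _; rewrite mcoeffD mcoeffZ scalerDl scalerA.
pose gL := HB.pack_for {linear free_cover -> X} g
  (GRing.isLinear.Build A free_cover X *:%R g g_lin).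
exists gL => c; change (p (g c) = f c); rewrite {2}[c]monalgE !raddf_sum /=.
apply: eq_bigr => m _; rewrite linearZ /= /h hs -linearZ /=; congr (f _).
apply/malgP => k; rewrite mcoeffZ !mcoeffU.
by case: (m == k); rewrite ?mulr1 ?mulr0.
Qed.

End FreeResolution.

Section StandardResolution.
Variable M : lmodType A.

Fixpoint nth_syzygy (n : nat) : lmodType A :=
  if n is m.+1 then syzygy (nth_syzygy m) else M.

Definition free_mod (n : nat) : lmodType A := free_cover (nth_syzygy n).

Definition free_d_fun (n : nat) (x : free_mod n.+1) : free_mod n :=
  syzygy_val (free_eval x).

Lemma free_d_linear n : linear (@free_d_fun n).
Proof. by move=> a x y; rewrite /free_d_fun linearP. Qed.

HB.instance Definition _ n :=
  GRing.isLinear.Build A _ _ *:%R (@free_d_fun n) (@free_d_linear n).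

Definition free_d n : {linear free_mod n.+1 -> free_mod n} := @free_d_fun n.

Definition free_aug : {linear free_mod 0 -> M} := @free_eval M.

Lemma free_aug_surj m : exists x, free_aug x = m.
Proof. by exists << m >>; apply: free_evalU. Qed.

Lemma free_d_image n (x : free_mod n) :
  free_eval x = 0 <-> exists y, free_d n y = x.
Proof.
split=> [hx|[y <-]].
  have hx' : x \in @is_syzygy (nth_syzygy n) by apply/eqP.
  by exists << (Syzygy hx' : nth_syzygy n.+1) >>; rewrite /= /free_d_fun free_evalU.
by rewrite /= /free_d_fun; apply/eqP; case: (free_eval y).
Qed.

Lemma free_exact n (x : free_mod n.+1) :
  free_d n x = 0 <-> exists y, free_d n.+1 y = x.
Proof.
rewrite -free_d_image; split=> [h|]; last by rewrite /= /free_d_fun => ->.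
exact/val_inj.
Qed.

Definition free_resolution : proj_resolution M :=
  @ProjResolution M free_mod free_d free_aug
    (fun n => @free_cover_projective (nth_syzygy n))
    free_aug_surj (@free_d_image 0) free_exact.

End StandardResolution.

(* The resolution P_n is free on the underlying set of the n-th syzygy. *)
Definition Ext (n : nat) (M N : lmodType A) : lmodType K :=
  cohomology N (free_resolution M) n.

End Homological.

(* Nonemptiness of the vertex set makes the path algebra a nontrivial ring. *)
Record quiver := Quiver {
  vertex : finType;
  arrow : finType;
  src : arrow -> vertex;
  tgt : arrow -> vertex;
  quiver_nonempty : (0 < #|vertex|)%N }.

Section Paths.
Variable Q : quiver.

Fixpoint walk (v : vertex Q) (s : seq (arrow Q)) : bool :=
  if s is a :: s' then (src a == v) && walk (tgt a) s' else true.

Definition walk_end (v : vertex Q) (s : seq (arrow Q)) : vertex Q :=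
  last v (map (@tgt Q) s).

Lemma walk_cat v s s' : walk v (s ++ s') = walk v s && walk (walk_end v s) s'.
Proof.
by elim: s v => [|a s IHs] v //=; rewrite IHs andbA.
Qed.

Lemma walk_end_cat v s s' :
  walk_end v (s ++ s') = walk_end (walk_end v s) s'.
Proof. by rewrite /walk_end map_cat last_cat. Qed.

(* A path is its start vertex together with its arrows, from left to right. *)
Definition qpath : Type := {p : vertex Q * seq (arrow Q) | walk p.1 p.2}.

HB.instance Definition _ := SubChoice.on qpath.

Definition psrc (p : qpath) : vertex Q := (sval p).1.
Definition parrows (p : qpath) : seq (arrow Q) := (sval p).2.
Definition pend (p : qpath) : vertex Q := walk_end (psrc p) (parrows p).
Definition plen (p : qpath) : nat := size (parrows p).

Definition vpath (v : vertex Q) : qpath := exist _ (v, [::]) isT.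

Lemma apath_subproof (a : arrow Q) : walk (src a) [:: a].
Proof. by rewrite /= eqxx. Qed.

Definition apath (a : arrow Q) : qpath := exist _ (_, _) (apath_subproof a).

(* [None] stands for a vanishing product. *)
Definition pcomp (p q : qpath) : option qpath :=
  if pend p == psrc q then insub (psrc p, parrows p ++ parrows q) : option qpath
  else None.

Lemma qpathP (p q : qpath) :
  psrc p = psrc q -> parrows p = parrows q -> p = q.
Proof.
case: p q => [[v s] hs] [[w t] ht]; rewrite /psrc /parrows /= => e1 e2.
by apply/val_inj; rewrite /= e1 e2.
Qed.

Lemma walk_pcat (p q : qpath) :
  pend p = psrc q -> walk (psrc p) (parrows p ++ parrows q).
Proof.
rewrite walk_cat /pend => ->.
by rewrite (valP p : walk (psrc p) (parrows p)) (valP q).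
Qed.

Lemma pcompP (p q r : qpath) :
  pcomp p q = Some r <->
  [/\ pend p = psrc q, psrc r = psrc p & parrows r = parrows p ++ parrows q].
Proof.
rewrite /pcomp; case: eqP => [e|ne]; last by split=> // -[].
case: insubP => [r' hr er|]; last first.
  by rewrite /= walk_pcat.
have [er1 er2] : psrc r' = psrc p /\ parrows r' = parrows p ++ parrows q.
  by rewrite /psrc /parrows er.
split=> [[<-]|[_ e1 e2]]; first by split.
by congr Some; apply: qpathP; rewrite ?er1 ?er2.
Qed.

Lemma pcomp_ex (p q : qpath) : pend p = psrc q -> exists r, pcomp p q = Some r.
Proof.
move=> e; rewrite /pcomp e eqxx; case: insubP => [r _ _|]; first by exists r.
by rewrite /= walk_pcat.
Qed.

Lemma pcompNone (p q : qpath) : pend p != psrc q -> pcomp p q = None.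
Proof. by rewrite /pcomp => /negbTE ->. Qed.

Lemma pend_pcomp p q r : pcomp p q = Some r -> pend r = pend q.
Proof. by move/pcompP=> [e1 e2 e3]; rewrite /pend e2 e3 walk_end_cat -/(pend p) e1. Qed.

Lemma psrc_pcomp p q r : pcomp p q = Some r -> psrc r = psrc p.
Proof. by move/pcompP=> []. Qed.

Lemma pcompA p q r :
  obind (pcomp p) (pcomp q r) = obind (pcomp^~ r) (pcomp p q).
Proof.
have [epq|npq] := eqVneq (pend p) (psrc q); last first.
  rewrite (pcompNone npq); case eqr: (pcomp q r) => [s|] //=.
  by apply: pcompNone; rewrite (psrc_pcomp eqr).
have [eqr|nqr] := eqVneq (pend q) (psrc r); last first.
  rewrite (pcompNone nqr); case epq': (pcomp p q) => [s|] //=.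
  by rewrite pcompNone // (pend_pcomp epq').
have [s hs] := pcomp_ex epq; have [t ht] := pcomp_ex eqr.
rewrite hs ht /=.
have [u hu] : exists u, pcomp p t = Some u.
  by apply: pcomp_ex; rewrite (psrc_pcomp ht).
have [w hw] : exists w, pcomp s r = Some w.
  by apply: pcomp_ex; rewrite (pend_pcomp hs).
rewrite hu hw; congr Some; apply: qpathP.
  by rewrite (psrc_pcomp hu) (psrc_pcomp hw) (psrc_pcomp hs).
move/pcompP: hu => [_ _ ->]; move/pcompP: hw => [_ _ ->].
by move/pcompP: hs => [_ _ ->]; move/pcompP: ht => [_ _ ->]; rewrite catA.
Qed.

End Paths.

Definition pathalg (K : fieldType) (Q : quiver) : Type := {malg K[qpath Q]}.

HB.instance Definition _ K Q := GRing.Lmodule.on (pathalg K Q).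

HB.lock Definition path_elt (K : fieldType) (Q : quiver) (p : qpath Q) :
  pathalg K Q := << p >>.

Definition pmul (K : fieldType) (Q : quiver) (p q : qpath Q) : pathalg K Q :=
  if pcomp p q is Some r then path_elt K r else 0.

HB.lock Definition pa_mul (K : fieldType) (Q : quiver) (x y : pathalg K Q) :
  pathalg K Q :=
  \sum_(p <- msupp x) \sum_(q <- msupp y) (x@_p * y@_q) *: pmul K p q.

Section PathAlgebra.
Variables (K : fieldType) (Q : quiver).
Local Notation pathalg := (pathalg K Q).
Local Notation path_elt := (@path_elt K Q).
Local Notation pmul := (@pmul K Q).
Local Notation pa_mul := (@pa_mul K Q).

Lemma msupp_path_elt p : msupp (path_elt p) = [fset p]%fset.
Proof. by rewrite path_elt.unlock msuppU oner_eq0. Qed.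

Lemma mcoeff_path_elt p q : (path_elt p)@_q = (p == q)%:R.
Proof. by rewrite path_elt.unlock mcoeffU. Qed.

Definition pa_one : pathalg := \sum_(v : vertex Q) path_elt (vpath v).

Lemma pa_mulw (dx dy : {fset qpath Q}) (x y : pathalg) :
  (msupp x `<=` dx)%fset -> (msupp y `<=` dy)%fset ->
  pa_mul x y = \sum_(p <- dx) \sum_(q <- dy) (x@_p * y@_q) *: pmul p q.
Proof.
move=> hx hy; rewrite pa_mul.unlock (big_fset_incl _ hx); last first.
  move=> p _ /mcoeff_outdom ->.
  by rewrite big1 // => q _; rewrite mul0r scale0r.
apply: eq_bigr => p _; apply: (big_fset_incl _ hy) => q _ /mcoeff_outdom ->.
by rewrite mulr0 scale0r.
Qed.

Lemma pa_mul_linl y : linear (pa_mul^~ y).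
Proof.
move=> a x x'.
pose d := (msupp x `|` msupp x' `|` msupp (a *: x + x'))%fset.
have dx : (msupp x `<=` d)%fset by rewrite /d -fsetUA fsubsetUl.
have dy : (msupp x' `<=` d)%fset.
  by rewrite /d (fsetUC (msupp x)) -fsetUA fsubsetUl.
have dxy : (msupp (a *: x + x') `<=` d)%fset by rewrite /d fsubsetUr.
have dd := fsubset_refl (msupp y).
rewrite (pa_mulw dx dd) (pa_mulw dy dd) (pa_mulw dxy dd).
rewrite scaler_sumr -big_split /=; apply: eq_bigr => p _.
rewrite scaler_sumr -big_split /=; apply: eq_bigr => q _.
by rewrite mcoeffD mcoeffZ mulrDl scalerDl -mulrA scalerA.
Qed.

Lemma pa_mul_linr x : linear (pa_mul x).
Proof.
move=> a y y'.
pose d := (msupp y `|` msupp y' `|` msupp (a *: y + y'))%fset.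
have dx : (msupp y `<=` d)%fset by rewrite /d -fsetUA fsubsetUl.
have dy : (msupp y' `<=` d)%fset.
  by rewrite /d (fsetUC (msupp y)) -fsetUA fsubsetUl.
have dxy : (msupp (a *: y + y') `<=` d)%fset by rewrite /d fsubsetUr.
have dd := fsubset_refl (msupp x).
rewrite (pa_mulw dd dx) (pa_mulw dd dy) (pa_mulw dd dxy).
rewrite scaler_sumr -big_split /=; apply: eq_bigr => p _.
rewrite scaler_sumr -big_split /=; apply: eq_bigr => q _.
by rewrite mcoeffD mcoeffZ mulrDr scalerDl mulrCA scalerA.
Qed.

Definition pa_mulr y x := pa_mul x y.

HB.instance Definition _ y :=
  GRing.isLinear.Build K pathalg pathalg *:%R (pa_mulr y) (pa_mul_linl y).
HB.instance Definition _ x :=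
  GRing.isLinear.Build K pathalg pathalg *:%R (pa_mul x) (pa_mul_linr x).

Lemma pathalgE (x : pathalg) : x = \sum_(p <- msupp x) x@_p *: path_elt p.
Proof.
rewrite {1}[x]monalgE; apply: eq_bigr => p _; apply/malgP => k.
rewrite mcoeffU [RHS]mcoeffZ mcoeff_path_elt.
by case: (p == k) => /=; rewrite ?mulr1 ?mulr0.
Qed.

Lemma pa_mul_elt p q : pa_mul (path_elt p) (path_elt q) = pmul p q.
Proof.
rewrite pa_mul.unlock !msupp_path_elt (big_seq_fset1 _ p) (big_seq_fset1 _ q).
by rewrite !mcoeff_path_elt !eqxx mulr1 scale1r.
Qed.

Definition pL y : {linear pathalg -> pathalg} := pa_mulr y.
Definition pR x : {linear pathalg -> pathalg} := pa_mul x.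

Lemma linear_path_eq (f g : {linear pathalg -> pathalg}) :
  (forall p, f (path_elt p) = g (path_elt p)) -> forall x, f x = g x.
Proof.
move=> h x; rewrite [x]pathalgE !linear_sum; apply: eq_bigr => p _.
by rewrite !linearZ /= h.
Qed.

Lemma pa_mul0l y : pa_mul 0 y = 0. Proof. exact: (linear0 (pL y)). Qed.
Lemma pa_mul0r x : pa_mul x 0 = 0. Proof. exact: (linear0 (pR x)). Qed.

Lemma pa_mulA : associative pa_mul.
Proof.
move=> x y z.
apply: (@linear_path_eq (pL (pa_mul y z))
          [the {linear _ -> _} of pL z \o pL y] _ x) => p {x}.
change (pa_mul (path_elt p) (pa_mul y z) = pa_mul (pa_mul (path_elt p) y) z).
apply: (@linear_path_eq [the {linear _ -> _} of pR (path_elt p) \o pL z]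
          [the {linear _ -> _} of pL z \o pR (path_elt p)] _ y) => q {y}.
change (pa_mul (path_elt p) (pa_mul (path_elt q) z) =
        pa_mul (pa_mul (path_elt p) (path_elt q)) z).
apply: (@linear_path_eq
          [the {linear _ -> _} of pR (path_elt p) \o pR (path_elt q)]
          (pR (pa_mul (path_elt p) (path_elt q))) _ z) => r {z}.
change (pa_mul (path_elt p) (pa_mul (path_elt q) (path_elt r)) =
        pa_mul (pa_mul (path_elt p) (path_elt q)) (path_elt r)).
rewrite !pa_mul_elt /pmul; have := pcompA p q r.
case: (pcomp q r) (pcomp p q) => [s|] [t|] //= h.
- by rewrite !pa_mul_elt /pmul h.
- by rewrite pa_mul_elt /pmul h pa_mul0l.
- by rewrite pa_mul_elt /pmul -h pa_mul0r.
- by rewrite pa_mul0l pa_mul0r.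
Qed.

Lemma pmul_vl v p : pmul (vpath v) p = if v == psrc p then path_elt p else 0.
Proof.
rewrite /pmul; case: eqVneq => [e|ne]; last by rewrite pcompNone.
by have /pcompP -> : [/\ pend (vpath v) = psrc p, psrc p = psrc (vpath v)
  & parrows p = parrows (vpath v) ++ parrows p].
Qed.

Lemma pmul_vr v p : pmul p (vpath v) = if v == pend p then path_elt p else 0.
Proof.
rewrite /pmul; case: eqVneq => [e|ne]; last by rewrite pcompNone // eq_sym.
by have /pcompP -> : [/\ pend p = psrc (vpath v), psrc p = psrc p
  & parrows p = parrows p ++ parrows (vpath v)] by rewrite cats0.
Qed.

Lemma pa_mul1 : left_id pa_one pa_mul.
Proof.
move=> x; apply: (@linear_path_eq (pR pa_one) [the {linear _ -> _} of idfun]) => p.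
change (pL (path_elt p) pa_one = path_elt p).
rewrite linear_sum (bigD1 (psrc p)) //= /pa_mulr pa_mul_elt pmul_vl eqxx.
by rewrite big1 ?addr0 // => v /negbTE ne; rewrite pa_mul_elt pmul_vl ne.
Qed.

Lemma pa_mulr1 : right_id pa_one pa_mul.
Proof.
move=> x; apply: (@linear_path_eq (pL pa_one) [the {linear _ -> _} of idfun]) => p.
change (pR (path_elt p) pa_one = path_elt p).
rewrite linear_sum (bigD1 (pend p)) //= pa_mul_elt pmul_vr eqxx.
by rewrite big1 ?addr0 // => v /negbTE ne; rewrite pa_mul_elt pmul_vr ne.
Qed.

Lemma pa_mulDl : left_distributive pa_mul +%R.
Proof. by move=> x y z; exact: (linearD (pL z)). Qed.

Lemma pa_mulDr : right_distributive pa_mul +%R.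
Proof. by move=> x y z; exact: (linearD (pR x)). Qed.

Lemma mcoeff_pa_one v : pa_one@_(vpath v) = 1.
Proof.
rewrite /pa_one raddf_sum /= (bigD1 v) //= mcoeff_path_elt eqxx big1 ?addr0 // => w ne.
rewrite mcoeff_path_elt; case: eqP => // e; case/negP: ne.
by apply/eqP; exact: (congr1 (@psrc Q) e).
Qed.

Lemma pa_one_neq0 : pa_one != 0.
Proof.
have /card_gt0P[v _] := quiver_nonempty Q.
apply/eqP => h; have := mcoeff_pa_one v; rewrite h mcoeff0 => /esym/eqP.
by rewrite oner_eq0.
Qed.

HB.instance Definition _ := GRing.Zmodule_isNzRing.Build pathalg
  pa_mulA pa_mul1 pa_mulr1 pa_mulDl pa_mulDr pa_one_neq0.

Lemma path_eltM p q : path_elt p * path_elt q = pmul p q.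
Proof. exact: pa_mul_elt. Qed.

Lemma pathalg_scaleAl a (x y : pathalg) : a *: (x * y) = (a *: x) * y.
Proof. exact: esym (linearZZ (pL y) a x). Qed.

HB.instance Definition _ :=
  GRing.Lmodule_isLalgebra.Build K pathalg pathalg_scaleAl.

Lemma pathalg_scaleAr a (x y : pathalg) : a *: (x * y) = x * (a *: y).
Proof. exact: esym (linearZZ (pR x) a y). Qed.

HB.instance Definition _ :=
  GRing.Lalgebra_isAlgebra.Build K pathalg pathalg_scaleAr.

Definition is_ideal (I : pathalg -> Prop) : Prop :=
  [/\ I 0, forall x y, I x -> I y -> I (x + y),
      forall x y, I y -> I (x * y) & forall x y, I x -> I (x * y)].

Definition ideal_gen (X : pathalg -> Prop) (x : pathalg) : Prop :=
  forall I : pathalg -> Prop, is_ideal I -> (forall y, X y -> I y) -> I x.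

Definition arrow_ideal : pathalg -> Prop :=
  ideal_gen (fun x => exists a : arrow Q, x = path_elt (apath a)).

Definition arrow_ideal2 : pathalg -> Prop :=
  ideal_gen (fun z => exists x y, [/\ arrow_ideal x, arrow_ideal y & z = x * y]).

Lemma ideal_gen_ideal X : is_ideal (ideal_gen X).
Proof.
split.
- by move=> I [].
- by move=> x y hx hy I hI hX; case: (hI) => _ h _ _; apply: h; [apply: hx|apply: hy].
- by move=> x y hy I hI hX; case: (hI) => _ _ h _; apply: h; apply: hy.
- by move=> x y hx I hI hX; case: (hI) => _ _ _ h; apply: h; apply: hx.
Qed.

Lemma ideal_gen_incl (X : pathalg -> Prop) x : X x -> ideal_gen X x.
Proof. by move=> hx I _; apply. Qed.

Lemma ideal_gen_min (X I : pathalg -> Prop) :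
  is_ideal I -> (forall x, X x -> I x) -> forall x, ideal_gen X x -> I x.
Proof. by move=> hI hX x; apply. Qed.

Lemma mcoeff_vpathM (x y : pathalg) v :
  (x * y)@_(vpath v) = x@_(vpath v) * y@_(vpath v).
Proof.
pose d := (msupp x `|` [fset vpath v])%fset.
pose d' := (msupp y `|` [fset vpath v])%fset.
have vd : vpath v \in d by rewrite !inE eqxx orbT.
have vd' : vpath v \in d' by rewrite !inE eqxx orbT.
rewrite -[x * y]/(pa_mul x y) (@pa_mulw d d') ?fsubsetUl //.
have key p q : (pmul p q)@_(vpath v) = ((p == vpath v) && (q == vpath v))%:R.
  rewrite /pmul; case e: (pcomp p q) => [r|]; last first.
    rewrite mcoeff0; case: andP => // -[/eqP ep /eqP eq].
    have [r hr] : exists r, pcomp p q = Some r by apply: pcomp_ex; rewrite ep eq.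
    by rewrite hr in e.
  rewrite mcoeff_path_elt; move/pcompP: e => [e1 e2 e3]; congr (_ *+ (nat_of_bool _)).
  apply/eqP/andP=> [er|[/eqP ep /eqP eq]]; last first.
    by apply: qpathP; rewrite ?e2 ?e3 ep ?eq.
  have {er}[er1 er2] : psrc r = v /\ parrows r = [::] by rewrite er.
  move: e3; rewrite er2 => /esym/eqP; rewrite -size_eq0 size_cat addn_eq0.
  rewrite !size_eq0 => /andP[/eqP hp /eqP hq].
  have sp : psrc p = v by rewrite -e2.
  split; apply/eqP/qpathP => //.
  by move: e1; rewrite /pend hp /= sp => <-.
transitivity (\sum_(p <- d) \sum_(q <- d')
    x@_p * y@_q * ((p == vpath v) && (q == vpath v))%:R).
  rewrite raddf_sum; apply: eq_bigr => p _; rewrite raddf_sum.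
  by apply: eq_bigr => q _; rewrite [LHS]mcoeffZ key.
rewrite (big_fsetD1 _ vd) (big_fsetD1 _ vd') !eqxx mulr1 /=.
rewrite big1_seq ?addr0; last first.
  by move=> q /=; rewrite in_fsetD1 => /andP[/negbTE -> _]; rewrite mulr0.
rewrite big1_seq ?addr0 // => p /=; rewrite in_fsetD1 => /andP[/negbTE -> _].
by rewrite big1 // => q _; rewrite mulr0.
Qed.

Lemma arrow_ideal_vpath x v : arrow_ideal x -> x@_(vpath v) = 0.
Proof.
apply: (@ideal_gen_min _ (fun x => x@_(vpath v) = 0)).
  split=> [|y z hy hz|y z hz|y z hy]; rewrite ?mcoeff0 ?mcoeffD ?mcoeff_vpathM //.
  - by rewrite hy hz addr0.
  - by rewrite hz mulr0.
  - by rewrite hy mul0r.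
move=> _ [a ->]; rewrite mcoeff_path_elt; case: eqP => // -[].
Qed.

Lemma arrow_ideal2_vpath x v : arrow_ideal2 x -> x@_(vpath v) = 0.
Proof.
move=> hx; apply: arrow_ideal_vpath; move: hx; apply: ideal_gen_min.
  exact: ideal_gen_ideal.
have [_ _ h _] := ideal_gen_ideal (fun x => exists a : arrow Q, x = path_elt (apath a)).
by move=> _ [y [z [hy hz ->]]]; apply: h.
Qed.

End PathAlgebra.

Record relation_ideal (K : fieldType) (Q : quiver) := RelationIdeal {
  rel_ideal :> pathalg K Q -> Prop;
  rel_ideal_ideal : is_ideal rel_ideal;
  rel_ideal_arrow2 : forall x, rel_ideal x -> arrow_ideal2 x }.

(* The carrier of the simple module at v, tagged with the data that determine
   its module structure. *)
Definition simple (K : fieldType) (Q : quiver) (I : relation_ideal K Q)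
  (v : vertex Q) : Type := K.

Section QuotientAlgebra.
Variables (K : fieldType) (Q : quiver) (I : relation_ideal K Q).

Definition in_ideal : {pred pathalg K Q} := fun x => `[< I x >].

Lemma in_ideal_zmod : zmod_closed in_ideal.
Proof.
have [h0 hD hl _] := rel_ideal_ideal I; split; first exact/asboolP.
move=> x y /asboolP hx /asboolP hy; apply/asboolP/hD => //.
by rewrite -mulN1r; apply: hl.
Qed.

HB.instance Definition _ :=
  GRing.isZmodClosed.Build (pathalg K Q) in_ideal in_ideal_zmod.

Lemma in_idealZ (a : K) : {in in_ideal, forall x, a *: x \in in_ideal}.
Proof.
have [_ _ hl _] := rel_ideal_ideal I.
by move=> x /asboolP hx; apply/asboolP; rewrite -mulr_algl; apply: hl.
Qed.

Definition quotalg : Type := lquot in_idealZ.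

HB.instance Definition _ := GRing.Lmodule.on quotalg.

Definition qpi (x : pathalg K Q) : quotalg := lpi in_idealZ x.

Definition qrepr (q : quotalg) : pathalg K Q := repr (q : Quotient.quot in_ideal).

Lemma qreprK q : qpi (qrepr q) = q.
Proof. exact: lpiK. Qed.

Lemma qpi_eq x y : qpi x = qpi y <-> I (x - y).
Proof.
split=> h; first exact: asboolW (proj1 (lpi_eq in_idealZ x y) h).
have hxy : x - y \in in_ideal := asboolT h.
exact: (proj2 (lpi_eq in_idealZ x y) hxy).
Qed.

Definition quot_one : quotalg := qpi 1.
Definition quot_mul (p q : quotalg) : quotalg := qpi (qrepr p * qrepr q).

Lemma quot_mulE x y : quot_mul (qpi x) (qpi y) = qpi (x * y).
Proof.
have [_ hD hl hr] := rel_ideal_ideal I; apply/qpi_eq.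
have hx : I (qrepr (qpi x) - x) by apply/qpi_eq; rewrite qreprK.
have hy : I (qrepr (qpi y) - y) by apply/qpi_eq; rewrite qreprK.
rewrite -[_ - _](subrKA (x * qrepr (qpi y))) -mulrBl -mulrBr.
by apply: hD; [apply: hr|apply: hl].
Qed.

Lemma quot_mulA : associative quot_mul.
Proof.
by move=> x y z; rewrite -[x]qreprK -[y]qreprK -[z]qreprK !quot_mulE mulrA.
Qed.

Lemma quot_mul1 : left_id quot_one quot_mul.
Proof. by move=> x; rewrite -[x]qreprK quot_mulE mul1r. Qed.

Lemma quot_mulr1 : right_id quot_one quot_mul.
Proof. by move=> x; rewrite -[x]qreprK quot_mulE mulr1. Qed.

Lemma qpiD x y : qpi (x + y) = qpi x + qpi y.
Proof. exact: lpiD. Qed.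

Lemma qpiZ a x : qpi (a *: x) = a *: qpi x.
Proof. exact: lpiZ. Qed.

Lemma qpi0 : qpi 0 = 0.
Proof. by apply: (addrI (qpi 0)); rewrite -qpiD !addr0. Qed.

Lemma quot_mulDl : left_distributive quot_mul +%R.
Proof.
move=> x y z; rewrite -[x]qreprK -[y]qreprK -[z]qreprK -qpiD !quot_mulE.
by rewrite mulrDl qpiD.
Qed.

Lemma quot_mulDr : right_distributive quot_mul +%R.
Proof.
move=> x y z; rewrite -[x]qreprK -[y]qreprK -[z]qreprK -qpiD !quot_mulE.
by rewrite mulrDr qpiD.
Qed.

Lemma quot_one_neq0 : quot_one != 0.
Proof.
have /card_gt0P[v _] := quiver_nonempty Q.
apply/eqP => h; have h10 : qpi 1 = qpi 0 by rewrite qpi0.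
have := proj1 (qpi_eq 1 0) h10; rewrite subr0 => /rel_ideal_arrow2 h1.
have := arrow_ideal2_vpath v h1; rewrite mcoeff_pa_one => /eqP.
by rewrite oner_eq0.
Qed.

HB.instance Definition _ := GRing.Zmodule_isNzRing.Build quotalg
  quot_mulA quot_mul1 quot_mulr1 quot_mulDl quot_mulDr quot_one_neq0.

Lemma qpiM x y : qpi (x * y) = qpi x * qpi y.
Proof. by rewrite [RHS]quot_mulE. Qed.

Lemma quot_scaleAl a (x y : quotalg) : a *: (x * y) = (a *: x) * y.
Proof.
by rewrite -[x]qreprK -[y]qreprK -qpiM -!qpiZ -qpiM scalerAl.
Qed.

HB.instance Definition _ :=
  GRing.Lmodule_isLalgebra.Build K quotalg quot_scaleAl.

Lemma quot_scaleAr a (x y : quotalg) : a *: (x * y) = x * (a *: y).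
Proof.
by rewrite -[x]qreprK -[y]qreprK -qpiM -!qpiZ -qpiM scalerAr.
Qed.

HB.instance Definition _ :=
  GRing.Lalgebra_isAlgebra.Build K quotalg quot_scaleAr.

Section Simple.
Variable v : vertex Q.
Local Notation simple := (simple I v).

HB.instance Definition _ := GRing.Zmodule.on simple.

(* The class of x acts on K through the coefficient of x at the vertex v. *)
Definition simple_scale (q : quotalg) (c : simple) : simple :=
  (qrepr q)@_(vpath v) * (c : K).

Lemma simple_scaleE x c : simple_scale (qpi x) c = x@_(vpath v) * (c : K).
Proof.
have h : I (qrepr (qpi x) - x) by apply/qpi_eq; rewrite qreprK.
congr (_ * _); apply/eqP; rewrite -subr_eq0 -mcoeffB; apply/eqP.
exact: arrow_ideal2_vpath (rel_ideal_arrow2 h).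
Qed.

Lemma simple_scaleA a b c :
  simple_scale a (simple_scale b c) = simple_scale (a * b) c.
Proof.
rewrite -[a]qreprK -[b]qreprK -qpiM !simple_scaleE mcoeff_vpathM.
exact: mulrA.
Qed.

Lemma simple_scale1 : left_id 1 simple_scale.
Proof.
by move=> c; rewrite [LHS]simple_scaleE mcoeff_pa_one mul1r.
Qed.

Lemma simple_scaleDr : right_distributive simple_scale +%R.
Proof. by move=> a c d; exact: mulrDr. Qed.

Lemma simple_scaleDl c : {morph simple_scale^~ c : a b / a + b}.
Proof.
move=> a b; rewrite -[a]qreprK -[b]qreprK -qpiD !simple_scaleE mcoeffD.
exact: mulrDl.
Qed.

HB.instance Definition _ := GRing.Zmodule_isLmodule.Build quotalg simple
  simple_scaleA simple_scale1 simple_scaleDr simple_scaleDl.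

Lemma simple_vertex_id (c : simple) : qpi (path_elt K (vpath v)) *: c = c.
Proof. by rewrite [LHS]simple_scaleE mcoeff_path_elt eqxx mul1r. Qed.

Lemma simple_path0 p (c : simple) :
  p != vpath v -> qpi (path_elt K p) *: c = 0.
Proof.
by move=> /negbTE ne; rewrite [LHS]simple_scaleE mcoeff_path_elt ne mul0r.
Qed.

End Simple.

Definition S_ (v : vertex Q) : lmodType quotalg := simple I v.

End QuotientAlgebra.

Section Orders.
Variables (Q : quiver) (succ : rel (qpath Q)).

(* [succ p q] is the strict relation "p is larger than q"; the two side
   conditions of the form [pcomp _ _ = Some _] say that a product is nonzero. *)
Record length_admissible : Prop := LengthAdmissible {
  la_irr : irreflexive succ;
  la_trans : transitive succ;
  la_total : forall p q, p != q -> succ p q || succ q p;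
  la_least : forall S : qpath Q -> Prop, (exists p, S p) ->
    exists p, S p /\ forall q, S q -> q = p \/ succ q p;
  la_mulr : forall p q r pr qr, succ p q ->
    pcomp p r = Some pr -> pcomp q r = Some qr -> succ pr qr;
  la_mull : forall p q s sp sq, succ p q ->
    pcomp s p = Some sp -> pcomp s q = Some sq -> succ sp sq;
  la_factor : forall p q r t rq,
    pcomp r q = Some rq -> pcomp rq t = Some p -> p = q \/ succ p q;
  la_length : forall p q, (plen q < plen p)%N -> succ p q }.

Variable K : fieldType.
Local Notation pathalg := (pathalg K Q).

Definition is_tip (x : pathalg) (p : qpath Q) : Prop :=
  p \in msupp x /\ forall q, q \in msupp x -> q = p \/ succ p q.

Definition tips (X : pathalg -> Prop) (p : qpath Q) : Prop :=
  exists x, [/\ X x, x != 0 & is_tip x p].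

Definition path_elts (S : qpath Q -> Prop) (x : pathalg) : Prop :=
  exists p, S p /\ x = path_elt K p.

Definition homogeneous (x : pathalg) : Prop :=
  exists n, forall p, p \in msupp x -> plen p = n.

Definition quadratic (x : pathalg) : Prop :=
  forall p, p \in msupp x -> plen p = 2.

Definition uniform (x : pathalg) : Prop :=
  x != 0 /\ exists v w, x = path_elt K (vpath v) * x * path_elt K (vpath w).

Definition graded_ideal (I : pathalg -> Prop) : Prop :=
  is_ideal I /\ exists X : pathalg -> Prop,
    (forall x, X x -> homogeneous x) /\ forall x, I x <-> ideal_gen X x.

Definition groebner_basis (I G : pathalg -> Prop) : Prop :=
  [/\ graded_ideal I,
      forall x, G x -> I x,
      forall x, G x -> homogeneous x /\ uniform x &
      forall x, ideal_gen (path_elts (tips G)) x <->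
                ideal_gen (path_elts (tips I)) x].

Definition strong_Koszul (I : pathalg -> Prop) : Prop :=
  exists G, groebner_basis I G /\ forall x, G x -> quadratic x.

End Orders.

Section GrAlg.
Variables (K : fieldType) (Q : quiver) (succ : rel (qpath Q)).
Local Notation pathalg := (pathalg K Q).

(* Paths of length 2, as composable pairs of arrows. *)
Definition path2 : Type :=
  {ab : arrow Q * arrow Q | tgt ab.1 == src ab.2}.

HB.instance Definition _ := Finite.on path2.

Lemma path2_subproof (t : path2) :
  walk (src (sval t).1) [:: (sval t).1; (sval t).2].
Proof. by case: t => -[a b] /= h; rewrite eqxx eq_sym h. Qed.

Definition path_of2 (t : path2) : qpath Q := exist _ (_, _) (path2_subproof t).

Local Notation elt2 t := (path_elt K (path_of2 t)).

Variable T : {set path2}.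

Definition T_elts (x : pathalg) : Prop := exists2 t, t \in T & x = elt2 t.

Definition nontip (p : qpath Q) : Prop := ~ tips succ (ideal_gen T_elts) p.

Definition N2 : {set path2} := [set n | `[< nontip (path_of2 n) >]].

Definition N2_at (t : path2) : {set path2} :=
  [set n in N2 | [&& succ (path_of2 t) (path_of2 n),
                     psrc (path_of2 n) == psrc (path_of2 t) &
                     pend (path_of2 n) == pend (path_of2 t)]].

(* The index set of the coordinates x_(t, n); its cardinality is D. *)
Definition coord : Type :=
  {tn : path2 * path2 | (tn.1 \in T) && (tn.2 \in N2_at tn.1)}.

HB.instance Definition _ := Finite.on coord.

Definition affine_space : Type := {ffun coord -> K}.

Definition gen_at (X : affine_space) (t : path2) : pathalg :=
  elt2 t - \sum_(i : coord | (sval i).1 == t)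
             (X : {ffun coord -> K}) i *: elt2 (sval i).2.

Definition gens (X : affine_space) (x : pathalg) : Prop :=
  exists2 t, t \in T & x = gen_at X t.

Definition GrAlg (X : affine_space) : Prop :=
  strong_Koszul succ (ideal_gen (gens X)).

Lemma elt2_arrow2 t : arrow_ideal2 (elt2 t).
Proof.
apply: ideal_gen_incl.
exists (path_elt K (apath (sval t).1)), (path_elt K (apath (sval t).2)).
split; try by apply: ideal_gen_incl; eexists.
rewrite path_eltM /pmul.
suff /pcompP -> : [/\ pend (apath (sval t).1) = psrc (apath (sval t).2),
  psrc (path_of2 t) = psrc (apath (sval t).1) & parrows (path_of2 t) =
  parrows (apath (sval t).1) ++ parrows (apath (sval t).2)] by [].
by split=> //; apply/eqP/(valP t).
Qed.

Lemma T_elts_arrow2 x : ideal_gen T_elts x -> arrow_ideal2 x.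
Proof.
apply: ideal_gen_min; first exact: ideal_gen_ideal.
by move=> _ [t _ ->]; apply: elt2_arrow2.
Qed.

Lemma arrow2Z a (x : pathalg) : arrow_ideal2 x -> arrow_ideal2 (a *: x).
Proof.
move=> hx; rewrite -mulr_algl.
by have [_ _ h _] := @ideal_gen_ideal K Q
  (fun z => exists x y, [/\ arrow_ideal x, arrow_ideal y & z = x * y]); apply: h.
Qed.

Lemma gens_arrow2 X x : ideal_gen (gens X) x -> arrow_ideal2 x.
Proof.
apply: ideal_gen_min; first exact: ideal_gen_ideal.
have [h0 hD _ _] := @ideal_gen_ideal K Q
  (fun z => exists x y, [/\ arrow_ideal x, arrow_ideal y & z = x * y]).
move=> _ [t _ ->]; apply: (hD); first exact: elt2_arrow2.
rewrite -scaleN1r; apply: arrow2Z.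
by apply: (big_ind (@arrow_ideal2 K Q) h0 hD) => i _; apply: arrow2Z; apply: elt2_arrow2.
Qed.

Definition gens_ideal (X : affine_space) : relation_ideal K Q :=
  RelationIdeal (ideal_gen_ideal (gens X)) (@gens_arrow2 X).

Definition T_ideal : relation_ideal K Q :=
  RelationIdeal (ideal_gen_ideal T_elts) T_elts_arrow2.

End GrAlg.

(* Main.v *)
Require Import Defs.
From mathcomp Require Import all_boot all_order all_algebra.
From HB Require Import structures.
From mathcomp Require Import finmap boolp classical_sets monalg.

Set Implicit Arguments.
Unset Strict Implicit.
Unset Printing Implicit Defensive.

Import GRing.Theory.
Local Open Scope classical_set_scope.
Local Open Scope ring_scope.

(** Write Lambda = KQ/I for the strong Koszul algebra and Lambda* = KQ/<T>.  In
    both algebras the classes of the paths without a subpath in T form a basis,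
    and a path that has such a subpath is a combination of smaller paths with
    the same length and the same ends (for Lambda* the combination is empty).
    The record [pbw] isolates these facts, and they are all that is used of the
    two algebras.  For Lambda they say that every tip of I has a subpath in T:
    the tips of a quadratic Groebner basis lie in T because I lies in the ideal
    [reduces_to0] of elements whose terms of length at most 2 rewrite to 0.

    Given such data, the simple module S_v has a projective resolution P whose
    n-th term is the sum of Lambda e_(s(c)) over the chains c, that is, the
    paths a_1 ... a_n ending at v with every a_i a_(i+1) in T (Anick's
    resolution).  A basis of P_n is given by the pairs (p, c), p free of T and
    p c a path, and each pair is placed at the path p c.  For a chain
    c = a c', whether (p, c) is, up to smaller terms, sent to (p a, c') or is
    the image of a pair of P_(n+1), depends on whether p a is free of T.  So a
    leading term argument over the well-order ([exact_atmost]) proves exactness,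
    and the same argument, kept within paths of equal length and ends, produces
    the next differential ([next_differential]).

    The differential sends the generator of c to a combination of terms (b, c')
    with b an arrow, because lengths are preserved; arrows act as 0 on simple
    modules, so every homomorphism from P_n to a simple module kills boundaries
    ([anick_minimal]).  Hence Ext^n(S_v, S_w) is Hom(P_n, S_w), with one
    dimension for each chain of length n from w to v.  Such a homomorphism
    factors through the n-th term of any other projective resolution, so pd S_v
    is the supremum of the lengths of chains ending at v.

    Chains starting at v bound id S_v from below in the same way
    ([injective_bound]).  For the upper bound, note that the hypotheses of
    [pbw] are symmetric: they hold for the converse algebra and the opposite
    quiver, so the simple right module at v has a resolution of the length of
    the longest chain starting at v.  Its K-dual is an injective resolution of
    S_v, as S_v is one-dimensional ([dual_resolution]).

    Chains depend on T alone, so the invariants agree for Lambda and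
    Lambda*. *)

(** * Kernels, coimages and dependent choice *)

Section LinearMaps.
Variables (R : nzRingType).

Definition mklin (M N : lmodType R) (f : M -> N) (hf : linear f) :
    {linear M -> N} :=
  HB.pack_for {linear M -> N} f (GRing.isLinear.Build R M N *:%R f hf).

Section KernelAndCoimage.
Variables (X Y : lmodType R) (u : {linear X -> Y}).

Definition in_ker : {pred X} := fun x => u x == 0.

Lemma in_ker_submod : submod_closed in_ker.
Proof.
split; first by apply/eqP; rewrite linear0.
move=> a x y hx hy; apply/eqP.
by rewrite linearP (eqP hx) (eqP hy) scaler0 addr0.
Qed.

HB.instance Definition _ := GRing.isSubmodClosed.Build R X in_ker in_ker_submod.

Record kernel := Kernel { kernel_val :> X; _ : kernel_val \in in_ker }.

HB.instance Definition _ := [isSub for kernel_val].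
HB.instance Definition _ := [Choice of kernel by <:].
HB.instance Definition _ := [SubChoice_isSubLmodule of kernel by <:].

Lemma kernelP (x : kernel) : u (kernel_val x) = 0.
Proof. by case: x => x hx; apply/eqP. Qed.

Lemma corestrict (W : lmodType R) (f : {linear W -> X}) :
  (forall w, u (f w) = 0) ->
  exists g : {linear W -> kernel}, forall w, kernel_val (g w) = f w.
Proof.
move=> uf; have hf w : f w \in in_ker by apply/eqP.
have glin : linear (fun w => Kernel (hf w)).
  by move=> a x y; apply: val_inj; rewrite /= linearP.
by exists (mklin glin).
Qed.

Lemma in_kerZ a : {in in_ker, forall x, a *: x \in in_ker}.
Proof. by move=> x hx; apply: rpredZ. Qed.

Definition coimage : lmodType R := lquot in_kerZ.

Lemma coimage_lift (Z : lmodType R) (f : {linear X -> Z}) :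
  (forall x, u x = 0 -> f x = 0) ->
  exists g : {linear coimage -> Z}, forall x, g (lpi in_kerZ x) = f x.
Proof.
move=> hf; pose g (q : coimage) := f (repr (q : Quotient.quot in_ker)).
have gE x : g (lpi in_kerZ x) = f x.
  apply/eqP; rewrite -subr_eq0 -linearB; apply/eqP/hf/eqP.
  by apply: (proj1 (lpi_eq in_kerZ _ _)); rewrite lpiK.
have glin : linear g.
  by move=> a p q; rewrite -[p]lpiK -[q]lpiK -lpiZ -lpiD !gE linearP.
by exists (mklin glin).
Qed.

Lemma coimage_inj : exists i : {linear coimage -> Y},
  injective i /\ forall x, i (lpi in_kerZ x) = u x.
Proof.
have [i iE] := coimage_lift (f := u) (fun x h => h); exists i; split=> //.
move=> p q; rewrite -[p]lpiK -[q]lpiK !iE => e; apply/lpi_eq/eqP.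
by rewrite linearB e subrr.
Qed.

End KernelAndCoimage.

End LinearMaps.

Section DependentChoice.
Variables (S : nat -> Type) (C : forall n, S n -> Prop).
Variables (R : forall n, S n -> S n.+1 -> Prop).

Lemma dependent_choice (s0 : S 0) : C s0 ->
  (forall n (s : S n), C s -> exists s' : S n.+1, C s' /\ R s s') ->
  exists f : forall n, S n, f 0 = s0 /\ forall n, C (f n) /\ R (f n) (f n.+1).
Proof.
move=> h0 hS; pose nx n (s : {s : S n | C s}) := cid (hS n (sval s) (svalP s)).
pose F := nat_rect (fun n => {s : S n | C s}) (exist _ s0 h0)
  (fun n s => exist _ (sval (nx n s)) (proj1 (svalP (nx n s)))).
exists (fun n => sval (F n)); split=> // n; split; first exact: svalP (F n).
exact: (proj2 (svalP (nx n (F n)))).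
Qed.

End DependentChoice.

(** * Comparison of resolutions *)

Section Resolutions.
Variables (K : fieldType) (A : algType K).

Lemma projective_lift (P X Y Z : lmodType A) (u : {linear X -> Y})
    (v : {linear Y -> Z}) (f : {linear P -> Y}) :
  projective P -> (forall y, v y = 0 <-> exists x, u x = y) ->
  (forall p, v (f p) = 0) ->
  exists g : {linear P -> X}, forall p, u (g p) = f p.
Proof.
move=> hP hex hf; have [f' f'E] := corestrict hf.
have [u' u'E] : exists u' : {linear X -> kernel v}, forall x, kernel_val (u' x) = u x.
  by apply: corestrict => x; apply/hex; exists x.
have [|g gE] := hP _ _ u' f'; last by exists g => p; rewrite -u'E gE f'E.
by move=> y; have /hex[x hx] := kernelP y; exists x; apply: val_inj; rewrite /= u'E.
Qed.

Lemma injective_extend (E X Y : lmodType A) (u : {linear X -> Y})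
    (f : {linear X -> E}) :
  injective_module E -> (forall x, u x = 0 -> f x = 0) ->
  exists g : {linear Y -> E}, forall x, g (u x) = f x.
Proof.
move=> hE hf; have [f' f'E] := coimage_lift hf.
have [i [inj_i iE]] := coimage_inj u; have [g gE] := hE _ _ i f' inj_i.
by exists g => x; rewrite -iE gE f'E.
Qed.

Lemma pr_dd (M : lmodType A) (P : proj_resolution M) n x : pr_d P n (pr_d P n.+1 x) = 0.
Proof. by apply/pr_exact; exists x. Qed.

Definition chain_map (M : lmodType A) (P R : proj_resolution M)
    (f : forall n, {linear pr_mod P n -> pr_mod R n}) : Prop :=
  (forall x, pr_aug R (f 0 x) = pr_aug P x) /\
  (forall n x, pr_d R n (f n.+1 x) = f n (pr_d P n x)).

(** Lifts of the identity are built degree by degree; the invariant passed on is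
    that the lift sends boundaries to cycles. *)
Lemma chain_map_exists (M : lmodType A) (P R : proj_resolution M) :
  exists f, chain_map (P := P) (R := R) f.
Proof.
have [f0 f0E] := @pr_projective _ _ _ P 0 _ _ (pr_aug R) (pr_aug P)
  (@pr_aug_surj _ _ _ R).
pose C n (f : {linear pr_mod P n -> pr_mod R n}) : Prop :=
  match n return {linear pr_mod P n -> pr_mod R n} -> Prop with
  | 0 => fun f => forall x, pr_aug R (f (pr_d P 0 x)) = 0
  | m.+1 => fun f => forall x, pr_d R m (f (pr_d P m.+1 x)) = 0
  end f.
have [|n f hf|f [ff fC]] := @dependent_choice _ C
    (fun n f g => forall x, pr_d R n (g x) = f (pr_d P n x)) f0.
- by move=> x; rewrite f0E; apply/pr_aug_exact; exists x.
- have [g gE] : exists g : {linear pr_mod P n.+1 -> pr_mod R n.+1},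
      forall x, pr_d R n (g x) = (f \o pr_d P n) x.
    have hP := @pr_projective _ _ _ P n.+1.
    case: n f hf hP => [|n] f hf hP.
      exact: (@projective_lift _ _ _ _ _ _ (f \o pr_d P 0) hP (@pr_aug_exact _ _ _ R) hf).
    exact: (@projective_lift _ _ _ _ _ _ (f \o pr_d P n.+1) hP (@pr_exact _ _ _ R n) hf).
  exists g; split=> // x; rewrite gE /= pr_dd linear0 //.
exists f; split=> [x|n x]; first by rewrite ff f0E.
by have [_ ->] := fC n.
Qed.

Lemma homotopy_exists (M : lmodType A) (P R : proj_resolution M) f g :
  chain_map (P := P) (R := R) f -> chain_map (P := P) (R := R) g ->
  exists h : forall n, {linear pr_mod P n -> pr_mod R n.+1},
    (forall x, f 0 x - g 0 x = pr_d R 0 (h 0 x)) /\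
    forall n x, f n.+1 x - g n.+1 x = pr_d R n.+1 (h n.+1 x) + h n (pr_d P n x).
Proof.
move=> [fa fd] [ga gd].
have [|h0 h0E] := @projective_lift _ _ _ _ _ _ (f 0 \- g 0)
    (@pr_projective _ _ _ P 0) (@pr_aug_exact _ _ _ R).
  by move=> x; rewrite /= linearB fa ga subrr.
have [|n h hC|h [hh hC]] := @dependent_choice _
    (fun n (h : {linear pr_mod P n -> pr_mod R n.+1}) => forall x,
       pr_d R n (h (pr_d P n x)) = pr_d R n (f n.+1 x - g n.+1 x))
    (fun n h h' => forall x,
       f n.+1 x - g n.+1 x = pr_d R n.+1 (h' x) + h (pr_d P n x)) h0.
- by move=> x; rewrite h0E linearB fd gd.
- have [|h' h'E] := @projective_lift _ _ _ _ _ _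
      ((f n.+1 \- g n.+1) \- (h \o pr_d P n))
      (@pr_projective _ _ _ P n.+1) (@pr_exact _ _ _ R n).
    by move=> x; rewrite /= linearB hC subrr.
  exists h'; split=> x; rewrite h'E /=; last by rewrite subrK.
  by rewrite pr_dd linear0 subr0 linearB fd gd.
exists h; split=> [x|n x]; first by rewrite hh h0E.
by have [_ ->] := hC n.
Qed.

Lemma chain_map_id (M : lmodType A) (P : proj_resolution M) :
  chain_map (P := P) (R := P) (fun n => [the {linear _ -> _} of idfun]).
Proof. by []. Qed.

Lemma chain_map_comp (M : lmodType A) (P R S : proj_resolution M) f g :
  chain_map (P := P) (R := R) f -> chain_map (P := R) (R := S) g ->
  chain_map (P := P) (R := S) (fun n => [the {linear _ -> _} of g n \o f n]).
Proof.
move=> [fa fd] [ga gd]; split=> [x|n x] /=; first by rewrite ga fa.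
by rewrite gd fd.
Qed.

(** For simple N this is minimality of the resolution; it makes the complex
    Hom(P, N) have zero differential. *)
Definition minimal_for (M N : lmodType A) (P : proj_resolution M) : Prop :=
  forall n (f : {linear pr_mod P n -> N}) x, f (pr_d P n x) = 0.

(** An endomorphism k of a resolution that lifts the identity is homotopic to it,
    so it changes a cocycle by a coboundary only; in degree 0 there are none. *)
Lemma cocycle_endo (M N : lmodType A) (P : proj_resolution M) k n
    (f : {linear pr_mod P n -> N}) :
  chain_map (P := P) (R := P) k -> (forall x, f (pr_d P n x) = 0) ->
  match n return ({linear pr_mod P n -> pr_mod P n}) ->
                 {linear pr_mod P n -> N} -> Prop with
  | 0 => fun k f => forall x, f (k x) = f x
  | m.+1 => fun k f => exists g : {linear pr_mod P m -> N},
      forall x, f (k x) = f x + g (pr_d P m x)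
  end (k n) f.
Proof.
move=> hk hf; have [h [h0 hS]] := homotopy_exists hk (chain_map_id P).
case: n f hf => [|n] f hf => [x|].
  by apply/eqP; rewrite -subr_eq0 -linearB h0 hf.
exists [the {linear _ -> _} of f \o h n] => x.
apply/eqP; rewrite -subr_eq0 opprD addrA subr_eq0 -linearB hS linearD hf add0r.
exact: eqxx.
Qed.

Lemma minimal_endo (M N : lmodType A) (P : proj_resolution M) k n
    (f : {linear pr_mod P n -> N}) :
  chain_map (P := P) (R := P) k -> minimal_for N P -> forall x, f (k n x) = f x.
Proof.
move=> hk hmin x; have := cocycle_endo hk (hmin n f).
case: n f x => [|n] f x //=; by case=> g ->; rewrite hmin addr0.
Qed.

(** With f : P -> R and g : R -> P lifting the identity, pulling a cocycle on R
    back along f gives the isomorphism: [cocycle_endo] for f g on R gives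
    injectivity, and for g f on P, where coboundaries vanish, surjectivity. *)
Lemma minimal_Ext (M N : lmodType A) (P R : proj_resolution M) n :
  minimal_for N P ->
  exists phi : cohomology N R n -> Defs.Hom (pr_mod P n) N,
    linear phi /\ bijective phi.
Proof.
move=> hmin; have [f hf] := chain_map_exists P R.
have [g hg] := chain_map_exists R P.
pose pull m (z : cocycle N R m) : Defs.Hom (pr_mod P m) N :=
  [the {linear _ -> _} of happ (cocycle_val z) \o f m].
have zd m (z : cocycle N R m) x : happ (cocycle_val z) (pr_d R m x) = 0.
  case: z => z hz /=; have dz : cobd z = 0 by apply/eqP.
  exact (congr1 (fun h => happ h x) dz).
have pull_cobd m (z : cocycle N R m) :
    z \in @is_coboundary _ _ _ N R m <-> pull m z = 0.
  split.
    case: m z => [|m] z.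
      by move=> /eqP hz; apply: happ_inj => x; rewrite /= hz.
    move=> /asboolP[c hc]; apply: happ_inj => x /=; rewrite hc /=.
    by rewrite (proj2 hf); exact: (hmin m [the {linear _ -> _} of happ c \o f m]).
  move=> hz; have := cocycle_endo (chain_map_comp hg hf) (zd m z).
  have {}hz x : happ (cocycle_val z) (f m x) = 0 := congr1 (fun h => happ h x) hz.
  case: m z hz => [|m] z hz /=.
    move=> h; apply/eqP/happ_inj => x /=; rewrite -h /=; exact: hz.
  move=> [c hc]; apply/asboolP; exists (- (c : Defs.Hom _ _)); apply: happ_inj => x /=.
  by have := hc x; rewrite hz => /esym/eqP; rewrite addr_eq0 => /eqP.
have pullP m a (y z : cocycle N R m) : pull m (a *: y + z) = a *: pull m y + pull m z.
  by apply: happ_inj.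
pose rep (q : cohomology N R n) : cocycle N R n :=
  repr (q : Quotient.quot (@is_coboundary _ _ _ N R n)).
have phiE z : pull n (rep (lpi (@is_coboundaryZ _ _ _ N R n) z)) = pull n z.
  apply/eqP; rewrite -subr_eq0; apply/eqP.
  have -> : pull n (rep (lpi (@is_coboundaryZ _ _ _ N R n) z)) - pull n z =
    pull n (rep (lpi (@is_coboundaryZ _ _ _ N R n) z) - z) by apply: happ_inj.
  by apply/pull_cobd/(proj1 (lpi_eq (@is_coboundaryZ _ _ _ N R n) _ _)); rewrite lpiK.
have phi_lin : linear (fun q => pull n (rep q)).
  move=> a p q; rewrite -{1}[p]lpiK -{1}[q]lpiK -lpiZ -lpiD phiE.
  exact: pullP.
exists (fun q => pull n (rep q)); split=> //.
have phi_inj : injective (fun q => pull n (rep q)).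
  move=> p q e; rewrite -[p]lpiK -[q]lpiK; apply/lpi_eq/pull_cobd.
  have -> : pull n (rep p - rep q) = pull n (rep p) - pull n (rep q) by apply: happ_inj.
  by rewrite e subrr.
have phi_surj (y : Defs.Hom (pr_mod P n) N) : exists q, pull n (rep q) = y.
  have hz : ([the {linear _ -> _} of happ y \o g n] : Defs.Hom _ _)
      \in @is_cocycle K A M N R n.
    apply/eqP/happ_inj => x /=; rewrite -(proj2 hg); exact: (hmin n (happ y)).
  exists (lpi _ (Cocycle hz)); rewrite phiE; apply: happ_inj => x /=.
  exact: (minimal_endo (happ y) (chain_map_comp hf hg) hmin x).
have [psi psiE] := choice phi_surj.
by exists psi => // q; apply: phi_inj; rewrite psiE.
Qed.

(** The endomorphism of P that factors through R acts as the identity on the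
    homomorphisms to N. *)
Lemma projective_bound (M N : lmodType A) (P R : proj_resolution M) n :
  minimal_for N P -> (forall x : pr_mod R n, x = 0) ->
  forall (f : {linear pr_mod P n -> N}) x, f x = 0.
Proof.
move=> hmin hR f x; have [i hi] := chain_map_exists P R.
have [j hj] := chain_map_exists R P.
rewrite -(minimal_endo f (chain_map_comp hi hj) hmin) /=.
by rewrite (hR (i n x)) !linear0.
Qed.

Lemma ir_dd (M : lmodType A) (E : inj_resolution M) n x : ir_d E n.+1 (ir_d E n x) = 0.
Proof. by apply/ir_exact; exists x. Qed.

(** The staircase in the double complex Hom(P, E).  A double cocycle f extends to
    some g along the differential of P since E_k is injective; g need not be a
    cocycle for E, but its defect lies one step down the staircase, at
    (j - 1, k + 1), and by induction it can be corrected.  Beyond degree n the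
    complex E vanishes, which starts the induction. *)
Lemma injective_shift (M N : lmodType A) (P : proj_resolution M)
    (E : inj_resolution N) n :
  (forall i, (n < i)%N -> forall x : ir_mod E i, x = 0) ->
  forall j k (f : {linear pr_mod P j.+1 -> ir_mod E k}), (n < j.+1 + k)%N ->
    (forall x, f (pr_d P j.+1 x) = 0) -> (forall x, ir_d E k (f x) = 0) ->
    exists g : {linear pr_mod P j -> ir_mod E k},
      (forall x, f x = g (pr_d P j x)) /\ (forall x, ir_d E k (g x) = 0).
Proof.
move=> hE; elim=> [|j IHj] k f lt_n fd df.
  have [|g gE] := @injective_extend (ir_mod E k) _ _ (pr_d P 0) f (@ir_injective _ _ _ E k).
    by move=> x /(proj1 (pr_exact _))[y <-].
  by exists g; split=> x; [rewrite gE | apply: hE; rewrite -add1n].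
have [|g gE] := @injective_extend (ir_mod E k) _ _ (pr_d P j.+1) f (@ir_injective _ _ _ E k).
  by move=> x /(proj1 (pr_exact _))[y <-].
have [||x|c [cE dc]] := IHj k.+1 [the {linear _ -> _} of ir_d E k \o g].
- by rewrite addnS -addSn.
- by move=> x; rewrite /= gE df.
- by rewrite /= ir_dd.
have [c' c'E] := projective_lift (@pr_projective _ _ _ P j) (@ir_exact _ _ _ E k) dc.
(* The correction vanishes on boundaries, so the result still extends f. *)
exists [the {linear _ -> _} of g \- (c' \o pr_d P j)]; split=> x /=.
  by rewrite pr_dd linear0 subr0 gE.
by rewrite linearB c'E -cE subrr.
Qed.

(** The staircase applied to f followed by the augmentation of E factors f through
    the differential of P, and minimality makes f vanish. *)
Lemma injective_bound (M N : lmodType A) (P : proj_resolution M)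
    (E : inj_resolution N) n :
  minimal_for N P -> (forall i, (n < i)%N -> forall x : ir_mod E i, x = 0) ->
  forall i (f : {linear pr_mod P i -> N}), (n < i)%N -> forall x, f x = 0.
Proof.
move=> hmin hE [//|i] f lt_n x.
have [|y|y|g [gE dg]] := injective_shift hE (k := 0) (j := i) (P := P)
    (f := [the {linear _ -> _} of ir_aug E \o f]).
- by rewrite addn0.
- by rewrite /= hmin linear0.
- by apply/ir_aug_exact; exists (f y).
have [h hE'] := projective_lift (@pr_projective _ _ _ P i) (@ir_aug_exact _ _ _ E) dg.
by apply: (@ir_aug_inj _ _ _ E); rewrite [LHS]gE -hE' hmin linear0.
Qed.

End Resolutions.

(** * Duality between left and right modules *)

Section Functionals.
Variables (K : fieldType) (A : algType K).

Definition is_functional (M : lmodType A) (phi : M -> K) : Prop :=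
  (forall x y, phi (x + y) = phi x + phi y) /\
  (forall k x, phi (k%:A *: x) = k * phi x).

Section Extension.
Variables (X Y : lmodType A) (u : {linear X -> Y}) (phi : X -> K).
Hypothesis phi_fun : is_functional phi.
Hypothesis phi_ker : forall x, u x = 0 -> phi x = 0.

Definition linear_graph (G : set (Y * K)) : Prop :=
  [/\ forall x y c d, G (x, c) -> G (y, d) -> G (x + y, c + d),
      forall k x c, G (x, c) -> G (k%:A *: x, k * c) &
      forall c, G (0, c) -> c = 0].

Let G0 : set (Y * K) := fun p => exists x, p = (u x, phi x).

Let G0_linear : linear_graph G0.
Proof.
have [phiD phiZ] := phi_fun; split.
- move=> _ _ _ _ [x [-> ->]] [y [-> ->]]; exists (x + y).
  by rewrite linearD phiD.
- by move=> k _ _ [x [-> ->]]; exists (k%:A *: x); rewrite linearZ phiZ.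
- by move=> c [x [/esym ux ->]]; apply: phi_ker.
Qed.

(** Partially defined functionals are handled as graphs, so that a chain of them
    has its union as an upper bound.  Zorn's lemma is applied to the graphs that
    become linear when G0 is added to them: the empty chain then needs no
    separate treatment. *)
Lemma maximal_linear_graph : exists G : set (Y * K),
  [/\ linear_graph G, G0 `<=` G &
      forall H, linear_graph H -> G `<=` H -> H `<=` G].
Proof.
have [F FP totF|G [linG maxG]] := @Zorn_bigcup _ (fun G => linear_graph (G `|` G0)).
  set U := _ `|` G0.
  have key p q : U p -> U q -> exists G,
      [/\ linear_graph G, G p, G q & G `<=` U].
    have sub H : F H -> H `|` G0 `<=` U.
      by move=> FH r [Hr|]; [left; exists H | right].
    case=> [[H FH Hp]|G0p] [[H' FH' Hq]|G0q].
    - case: (totF _ _ FH FH') => [s|s].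
        by exists (H' `|` G0); split; [exact: FP | left; apply: s | left | exact: sub].
      by exists (H `|` G0); split; [exact: FP | left | left; apply: s | exact: sub].
    - by exists (H `|` G0); split; [exact: FP | left | right | exact: sub].
    - by exists (H' `|` G0); split; [exact: FP | right | left | exact: sub].
    - by exists G0; split=> // r; right.
  split.
  - move=> x y c d hx hy; have [G [[GD _ _] Gx Gy GU]] := key _ _ hx hy.
    exact/GU/GD.
  - move=> k x c hx; have [G [[_ GZ _] Gx _ GU]] := key _ _ hx hx.
    exact/GU/GZ.
  - by move=> c hc; have [G [[_ _ G00] Gc _ _]] := key _ _ hc hc; apply: G00.
exists (G `|` G0); split=> // H linH sH.
have HG0 : H `|` G0 = H.
  by apply/seteqP; split=> p; [case=> // hp; apply: sH; right | left].
move=> p Hp; left; apply: contrapT => nGp; apply: (maxG H); last by rewrite HG0.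
by split=> [q Gq|/(_ p Hp)//]; apply: sH; left.
Qed.

(** A maximal graph is total: if y lies outside its domain, the value 0 at y extends
    it to the sum of the domain and the line through y. *)
Lemma functional_extend :
  exists psi : Y -> K, is_functional psi /\ forall x, psi (u x) = phi x.
Proof.
have [G [[GD GZ G0_] subG maxG]] := maximal_linear_graph.
have G00 : G (0, 0) by apply: subG; exists 0; rewrite linear0 phi_ker ?linear0.
have Guniq x c d : G (x, c) -> G (x, d) -> c = d.
  move=> hc /(GZ (-1)) hd; have := GD _ _ _ _ hc hd.
  rewrite !scaleN1r subrr mulN1r => /G0_ /eqP; by rewrite subr_eq0 => /eqP.
have Gtot y : exists c, G (y, c).
  apply: contrapT => ny.
  pose H : set (Y * K) := fun p => exists k z, G (z, p.2) /\ p.1 = z + k%:A *: y.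
  have GH : G `<=` H by move=> [z c] Gz; exists 0, z; rewrite !scale0r addr0.
  apply: (ny); exists 0; apply: (maxG H) => //; last first.
    by exists 1, 0; rewrite !scale1r add0r.
  split.
  - move=> x x' c d [k [z [Gz /= ->]]] [l [t [Gt /= ->]]]; exists (k + l), (z + t).
    by split; [exact: GD | rewrite !scalerDl addrACA].
  - move=> k x c [l [z [Gz /= ->]]]; exists (k * l), (k%:A *: z).
    by split; [exact: GZ | rewrite /= scalerDr scalerA mulr_algl scalerA].
  - move=> c [k [z [Gz /= /eqP]]]; rewrite eq_sym addrC addr_eq0 => /eqP zE.
    have [k0|nk] := eqVneq k 0.
      apply: G0_; rewrite (_ : 0 = z) //; move/eqP: zE.
      by rewrite k0 !scale0r eq_sym oppr_eq0 => /eqP.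
    (* Now y is a multiple of z, which lies in the domain. *)
    exfalso; apply: ny; exists (- k^-1 * c).
    rewrite (_ : y = (- k^-1)%:A *: z); first exact: GZ.
    rewrite -[z]opprK -zE scaleNr scaleNr scalerN opprK scalerA.
    by rewrite mulr_algl scalerA mulVf // !scale1r.
have [psi psiE] := choice Gtot; exists psi; split; last first.
  by move=> x; apply: Guniq (psiE _) _; apply: subG; exists x.
split=> [x y|k x]; apply: Guniq (psiE _) _; [exact: GD | exact: GZ].
Qed.

End Extension.
End Functionals.

(** Right modules are left modules over the converse algebra.  Stating duality for
    an anti-homomorphism treats both directions of it at once. *)
Record antihom (K : fieldType) (A B : algType K) := Antihom {
  anti :> B -> A;
  antiD : forall x y, anti (x + y) = anti x + anti y;
  antiZ : forall k x, anti (k *: x) = k *: anti x;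
  antiM : forall x y, anti (x * y) = anti y * anti x;
  anti1 : anti 1 = 1 }.

Section Dual.
Variables (K : fieldType) (A B : algType K) (M : lmodType A).

Record functional := Functional {
  functional_val :> M -> K;
  functionalP : is_functional functional_val }.

Lemma functional_inj (f g : functional) : (forall x, f x = g x) -> f = g.
Proof.
case: f g => [f hf] [g hg] /= /funext e; case: _ / e in hg *.
by congr Functional; exact: Prop_irrelevance.
Qed.

Lemma functional0 (f : functional) : f 0 = 0.
Proof. by have [fD _] := functionalP f; apply: (addrI (f 0)); rewrite -fD !addr0. Qed.

(** The carrier does not depend on the anti-homomorphism; it is an argument because
    the module structure is found from the type. *)
Definition dual (s : antihom A B) : Type := functional.

Variable s : antihom A B.
Local Notation D := (dual s).

HB.instance Definition _ := gen_eqMixin D.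
HB.instance Definition _ := gen_choiceMixin D.

Lemma dual_add_subproof (f g : D) : is_functional (fun x => f x + g x).
Proof.
have [fD fZ] := functionalP f; have [gD gZ] := functionalP g.
by split=> [x y|k x]; rewrite ?fD ?gD ?fZ ?gZ ?mulrDr // addrACA.
Qed.
Lemma dual_opp_subproof (f : D) : is_functional (fun x => - f x).
Proof.
have [fD fZ] := functionalP f.
by split=> [x y|k x]; rewrite ?fD ?fZ ?mulrN ?opprD.
Qed.
Lemma dual_zero_subproof : is_functional (fun _ : M => 0 : K).
Proof. by split=> [x y|k x]; rewrite ?addr0 ?mulr0. Qed.
Lemma dual_scale_subproof (b : B) (f : D) : is_functional (fun x => f (s b *: x)).
Proof.
have [fD fZ] := functionalP f.
split=> [x y|k x]; first by rewrite scalerDr fD.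
by rewrite -fZ !scalerA mulr_algl mulr_algr.
Qed.

Let add (f g : D) : D := Functional (dual_add_subproof f g).
Let opp (f : D) : D := Functional (dual_opp_subproof f).
Let zero : D := Functional dual_zero_subproof.
Let scale b (f : D) : D := Functional (dual_scale_subproof b f).

Let addA : associative add.
Proof. by move=> f g h; apply: functional_inj => x /=; rewrite addrA. Qed.
Let addC : commutative add.
Proof. by move=> f g; apply: functional_inj => x /=; rewrite addrC. Qed.
Let add0 : left_id zero add.
Proof. by move=> f; apply: functional_inj => x /=; rewrite add0r. Qed.
Let addN : left_inverse zero opp add.
Proof. by move=> f; apply: functional_inj => x /=; rewrite addNr. Qed.
HB.instance Definition _ := GRing.isZmodule.Build D addA addC add0 addN.

Let scaleA a b f : scale a (scale b f) = scale (a * b) f.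
Proof. by apply: functional_inj => x /=; rewrite antiM scalerA. Qed.
Let scale1 : left_id 1 scale.
Proof. by move=> f; apply: functional_inj => x /=; rewrite anti1 scale1r. Qed.
Let scaleDr : right_distributive scale +%R.
Proof. by move=> a f g; apply: functional_inj. Qed.
Let scaleDl f : {morph scale^~ f : a b / a + b}.
Proof.
move=> a b; apply: functional_inj => x /=; have [fD _] := functionalP f.
by rewrite antiD scalerDl fD.
Qed.
HB.instance Definition _ := GRing.Zmodule_isLmodule.Build B D
  scaleA scale1 scaleDr scaleDl.

Lemma dualE a (f g : D) x : (a *: f + g : D) x = f (s a *: x) + g x.
Proof. by []. Qed.

End Dual.

Section DualMap.
Variables (K : fieldType) (A B : algType K) (s : antihom A B).
Variables (M N : lmodType A) (f : {linear M -> N}).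

Lemma dual_map_subproof (phi : dual N s) : is_functional (fun x => phi (f x)).
Proof.
have [pD pZ] := functionalP phi.
by split=> [x y|k x]; rewrite ?linearD ?linearZ ?pD ?pZ.
Qed.

Definition dual_map_fun (phi : dual N s) : dual M s :=
  Functional (dual_map_subproof phi).

Lemma dual_map_linear : linear dual_map_fun.
Proof.
move=> a phi psi; apply: functional_inj => x.
by rewrite [RHS]dualE /= linearZ.
Qed.

Definition dual_map : {linear dual N s -> dual M s} := mklin dual_map_linear.

(** Duality over a field is exact. *)
Lemma dual_map_exact (L : lmodType A) (g : {linear L -> M}) (phi : dual M s) :
  (forall x, f x = 0 -> exists y, g y = x) ->
  (forall y, phi (g y) = 0) -> exists psi, dual_map psi = phi.
Proof.
move=> hex hphi; have [psi [psi_fun psiE]] := functional_extend (u := f)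
  (functionalP phi) (fun x fx => let: ex_intro y e := hex x fx in
                                 etrans (congr1 phi (esym e)) (hphi y)).
by exists (Functional psi_fun); apply: functional_inj.
Qed.

End DualMap.

Section DualInjective.
Variables (K : fieldType) (A B : algType K) (s : antihom A B) (t : antihom B A).
Hypotheses (stK : forall a, s (t a) = a) (tsK : forall b, t (s b) = b).

(** Exchanging arguments identifies Hom(M, D P) with Hom(P, D M).  Since D turns the
    injection i into a surjection, the flipped map lifts along it when P is
    projective, and flipping the lift back extends the given map. *)
Lemma dual_injective (P : lmodType A) :
  projective P -> injective_module (dual P s).
Proof.
move=> hP M N i f inj_i.
have scal (L : lmodType B) (l : {linear L -> dual P s}) k m p :
    l (k%:A *: m) p = k * l m p.
  have [_ lZ] := functionalP (l m).
  by rewrite linearZ /= antiZ anti1 lZ.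
have flipf_fun p : is_functional (fun m => f m p).
  by split=> [x y|k m]; [rewrite linearD | rewrite scal].
pose flipf p : dual M t := Functional (flipf_fun p).
have flipf_linear : linear flipf.
  move=> a p q; apply: functional_inj => m; rewrite dualE /= linearZ /= stK.
  by have [fD _] := functionalP (f m); rewrite fD.
have [|g gE] := hP _ _ (dual_map t i) (mklin flipf_linear).
  move=> phi; apply: (dual_map_exact (f := i) (g := [the {linear M -> M} of \0])).
    by move=> x ix; exists 0; apply: inj_i; rewrite ix !linear0.
  by move=> y; exact: functional0.
have flipg_fun n : is_functional (fun p => g p n).
  split=> [x y|k p]; first by rewrite linearD.
  have [_ gZ] := functionalP (g p).
  by rewrite linearZ /= antiZ anti1 gZ.
pose flipg n : dual P s := Functional (flipg_fun n).
have flipg_linear : linear flipg.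
  move=> b m n; apply: functional_inj => p; rewrite dualE /= linearZ /= tsK.
  by have [gD _] := functionalP (g p); rewrite gD.
exists (mklin flipg_linear) => m; apply: functional_inj => p.
exact (congr1 (fun phi : dual M t => phi m) (gE p)).
Qed.

End DualInjective.

Record character (K : fieldType) (A : algType K) := Character {
  char_val :> A -> K;
  charD : forall x y, char_val (x + y) = char_val x + char_val y;
  charZ : forall k x, char_val (k *: x) = k * char_val x;
  charM : forall x y, char_val (x * y) = char_val x * char_val y;
  char1 : char_val 1 = 1 }.

(** A module affords a character if it is one-dimensional and the algebra acts
    through the character; the coordinate is a chosen identification with K. *)
Record affords (K : fieldType) (A : algType K) (e : character A)
    (S : lmodType A) := Affords {
  coordinate : S -> K;
  coordinateD : forall x y, coordinate (x + y) = coordinate x + coordinate y;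
  coordinateZ : forall a x, coordinate (a *: x) = e a * coordinate x;
  coordinate_inj : injective coordinate;
  coordinate_surj : forall k, exists x, coordinate x = k }.

Lemma coordinate0 (K : fieldType) (A : algType K) (e : character A) (S : lmodType A)
  (cS : affords e S) : coordinate cS 0 = 0.
Proof. by apply: (addrI (coordinate cS 0)); rewrite -coordinateD !addr0. Qed.

Section DualResolution.
Variables (K : fieldType) (A B : algType K) (s : antihom A B) (t : antihom B A).
Hypotheses (stK : forall a, s (t a) = a) (tsK : forall b, t (s b) = b).
Variables (e : character A) (e' : character B).
Hypothesis e'E : forall b, e' b = e (s b).
Variables (S : lmodType A) (S' : lmodType B).
Variables (cS : affords e S) (cS' : affords e' S').
Variable P : proj_resolution S.

Let scalarE k x : coordinate cS (k%:A *: x) = k * coordinate cS x.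
Proof. by rewrite coordinateZ charZ char1 mulr1. Qed.

Lemma pairing_subproof y : is_functional (fun x => coordinate cS' y * coordinate cS x).
Proof.
by split=> [u v|k u]; rewrite ?coordinateD ?mulrDr // scalarE mulrCA.
Qed.

Definition pairing y : dual S s := Functional (pairing_subproof y).

Lemma pairing_linear : linear pairing.
Proof.
move=> b y z; apply: functional_inj => x.
by rewrite dualE /= coordinateD !coordinateZ e'E mulrDl mulrA (mulrC (e _)).
Qed.

Lemma pairing_inj : injective pairing.
Proof.
have [x1 x1E] := coordinate_surj cS 1.
move=> y z /(congr1 (fun phi : dual S s => phi x1)) /=.
by rewrite x1E !mulr1 => /coordinate_inj.
Qed.

Lemma pairing_surj phi : exists y, pairing y = phi.
Proof.
have [x1 x1E] := coordinate_surj cS 1; have [y yE] := coordinate_surj cS' (phi x1).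
exists y; apply: functional_inj => x /=; have [_ pZ] := functionalP phi.
have -> : x = (coordinate cS x)%:A *: x1.
  by apply: (@coordinate_inj _ _ _ _ cS); rewrite scalarE x1E mulr1.
by rewrite scalarE pZ yE x1E mulr1 mulrC.
Qed.

Lemma dual_aug_linear : linear (fun y => dual_map s (pr_aug P) (pairing y)).
Proof. by move=> b y z; rewrite pairing_linear linearP. Qed.

Lemma dual_map_eq0 (L M : lmodType A) (f : {linear L -> M}) (phi : dual M s) :
  dual_map s f phi = 0 <-> forall x, phi (f x) = 0.
Proof.
split=> [h x|h]; last exact: functional_inj.
exact (congr1 (fun psi : dual L s => psi x) h).
Qed.

Lemma dual_aug_exact x : dual_map s (pr_d P 0) x = 0 <->
  exists y, mklin dual_aug_linear y = x.
Proof.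
rewrite dual_map_eq0; split=> [hx|[y <-] z].
  have [phi phiE] := dual_map_exact (fun x => proj1 (pr_aug_exact x)) hx.
  by have [y yE] := pairing_surj phi; exists y; rewrite /= yE.
have e0 : pr_aug P (pr_d P 0 z) = 0 by apply/pr_aug_exact; exists z.
change (pairing y (pr_aug P (pr_d P 0 z)) = 0); by rewrite e0 functional0.
Qed.

Lemma dual_aug_inj : injective (mklin dual_aug_linear).
Proof.
move=> y z h; apply: pairing_inj; apply: functional_inj => x.
have [p <-] := @pr_aug_surj _ _ _ P x.
exact (congr1 (fun phi : dual _ s => phi p) h).
Qed.

Lemma dual_exact n x : dual_map s (pr_d P n.+1) x = 0 <->
  exists y, dual_map s (pr_d P n) y = x.
Proof.
rewrite dual_map_eq0; split=> [hx|[y <-] z].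
  exact: dual_map_exact (fun x => proj1 (pr_exact x)) hx.
change (y (pr_d P n (pr_d P n.+1 z)) = 0); by rewrite pr_dd functional0.
Qed.

(** The dual of a one-dimensional module affords the same character, which provides
    the augmentation of the dual complex. *)
Definition dual_resolution : inj_resolution S' :=
  @InjResolution _ _ S' (fun n => dual (pr_mod P n) s)
    (fun n => dual_map s (pr_d P n)) (mklin dual_aug_linear)
    (fun n => dual_injective stK tsK (@pr_projective _ _ _ P n))
    dual_aug_inj dual_aug_exact dual_exact.

End DualResolution.

(** * Spans and exactness from leading terms *)

Section Span.
Variables (K : fieldType) (A : algType K).

Inductive Kspan (M : lmodType A) (S : M -> Prop) : M -> Prop :=
  | Kspan0 : Kspan S 0
  | KspanC k x y : S x -> Kspan S y -> Kspan S (k%:A *: x + y).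

Variable M : lmodType A.
Implicit Types (S : M -> Prop) (x y : M).

Lemma Kspan_incl S x : S x -> Kspan S x.
Proof. by move=> /(KspanC 1)/(_ (Kspan0 S)); rewrite addr0 !scale1r. Qed.

Lemma KspanD S x y : Kspan S x -> Kspan S y -> Kspan S (x + y).
Proof.
move=> hx hy; elim: hx => [|k x' y' Sx _ IH]; first by rewrite add0r.
by rewrite -addrA; apply: KspanC.
Qed.

Lemma KspanZ S k x : Kspan S x -> Kspan S (k%:A *: x).
Proof.
elim=> [|l x' y' Sx _ IH]; first by rewrite scaler0; apply: Kspan0.
by rewrite scalerDr scalerA mulr_algl scalerA; apply: KspanC.
Qed.

Lemma KspanN S x : Kspan S x -> Kspan S (- x).
Proof. by move=> /(KspanZ (-1)); rewrite !scaleN1r. Qed.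

Lemma KspanB S x y : Kspan S x -> Kspan S y -> Kspan S (x - y).
Proof. by move=> hx hy; apply: KspanD => //; apply: KspanN. Qed.

Lemma Kspan_sub S S' x : (forall y, S y -> Kspan S' y) -> Kspan S x -> Kspan S' x.
Proof.
move=> h; elim=> [|k y z Sy _ IH]; first exact: Kspan0.
by apply: KspanD => //; apply/KspanZ/h.
Qed.

Lemma Kspan_mono S S' x : (forall y, S y -> S' y) -> Kspan S x -> Kspan S' x.
Proof. by move=> h; apply: Kspan_sub => y /h; apply: Kspan_incl. Qed.

End Span.

Definition Klinear (K : fieldType) (A : algType K) (M N : lmodType A) (f : M -> N) :=
  forall k x y, f (k%:A *: x + y) = k%:A *: f x + f y.

Lemma Klinear0 (K : fieldType) (A : algType K) (M N : lmodType A) (f : M -> N) :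
  Klinear f -> f 0 = 0.
Proof.
by move=> /(_ 1 0 0); rewrite !scale1r addr0 -[LHS]addr0 => /addrI.
Qed.

Lemma Kspan_map (K : fieldType) (A : algType K) (M N : lmodType A) (f : M -> N)
    (S : M -> Prop) (S' : N -> Prop) x :
  Klinear f -> (forall y, S y -> Kspan S' (f y)) -> Kspan S x -> Kspan S' (f x).
Proof.
move=> hf h; elim=> [|k y z Sy _ IH]; first by rewrite (Klinear0 hf); apply: Kspan0.
by rewrite hf; apply: KspanD => //; apply/KspanZ/h.
Qed.

Lemma linear_Klinear (K : fieldType) (A : algType K) (M N : lmodType A)
  (f : {linear M -> N}) : Klinear f.
Proof. by move=> k x y; rewrite linearP. Qed.

Section Filtration.
Variables (K : fieldType) (A : algType K) (W : Type) (R : W -> W -> Prop).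

(** A family g places vectors of M at the points of an ordered set W; [below g u] is
    the span of the vectors placed strictly below u, and [atmost g u] that of
    those placed at u or below. *)
Definition below (M : lmodType A) (g : W -> M -> Prop) (u : W) : M -> Prop :=
  Kspan (fun x => exists2 u', R u u' & g u' x).

Definition atmost (M : lmodType A) (g : W -> M -> Prop) (u : W) : M -> Prop :=
  Kspan (fun x => exists2 u', u' = u \/ R u u' & g u' x).

Hypothesis R_wf : well_founded (fun u u' => R u' u).
Hypothesis R_trans : forall u v w, R u v -> R v w -> R u w.
(** Weaker than totality, as R is also taken to be the order restricted to parallel
    paths, where only points below a common one are comparable. *)
Hypothesis R_tri : forall u v w, R u v -> R u w -> [\/ v = w, R v w | R w v].

Section OneModule.
Variables (M : lmodType A) (g : W -> M -> Prop).

Lemma below_atmost u x : below g u x -> atmost g u x.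
Proof. by apply: Kspan_mono => y [u' Ru gy]; exists u' => //; right. Qed.

Lemma atmost_lt u u' x : R u u' -> atmost g u' x -> below g u x.
Proof.
move=> Ru; apply: Kspan_mono => y [u'' h gy]; exists u'' => //.
by case: h => [->|/(R_trans Ru)].
Qed.

Lemma below_bounded u x :
  below g u x -> x = 0 \/ exists2 u', R u u' & atmost g u' x.
Proof.
elim=> [|k y z [u1 R1 gy] _ IH]; first by left.
have gy1 : atmost g u1 (k%:A *: y).
  by apply/KspanZ/Kspan_incl; exists u1 => //; left.
right; case: IH => [->|[u2 R2 gz]]; first by exists u1; rewrite ?addr0.
case: (R_tri R1 R2) => [e|r|r].
- by exists u1 => //; apply: KspanD => //; rewrite e.
- by exists u1 => //; apply: KspanD => //; apply/below_atmost/atmost_lt/gz.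
- by exists u2 => //; apply: KspanD => //; apply/below_atmost/atmost_lt/gy1.
Qed.

Lemma atmost_split u x : (forall y z, g u y -> g u z -> y = z) ->
  atmost g u x -> below g u x \/
  exists k y z, [/\ g u y, below g u z & x = k%:A *: y + z].
Proof.
move=> gu; elim=> [|k y z [u' hu gy] _ IH]; first by left; apply: Kspan0.
case: hu => [e|Ru].
  rewrite e in gy; right; case: IH => [bz|[l [y' [z' [gy' bz' ->]]]]].
    by exists k, y, z.
  exists (k + l), y, z'; split=> //.
  by rewrite (gu _ _ gy' gy) !scalerDl addrA.
have by1 : below g u (k%:A *: y) by apply/KspanZ/Kspan_incl; exists u'.
case: IH => [bz|[l [y' [z' [gy' bz' ->]]]]]; first by left; apply: KspanD.
by right; exists l, y', (k%:A *: y + z'); split; [|exact: KspanD|rewrite addrCA].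
Qed.

End OneModule.

Section ThreeTerms.
Variables (X Y Z : lmodType A) (d : {linear X -> Y}) (d' : {linear Y -> Z}).
Variables (gX : W -> X -> Prop) (gY : W -> Y -> Prop) (gZ : W -> Z -> Prop).

Hypothesis dd : forall x, d' (d x) = 0.
Hypothesis gY_uniq : forall u y y', gY u y -> gY u y' -> y = y'.
Hypothesis d'_atmost : forall u y, gY u y -> atmost gZ u (d' y).
Hypothesis trichotomy : forall u y, gY u y ->
  [\/ below gY u y,
      exists2 x, gX u x & below gY u (d x - y) |
      exists z, [/\ gZ u z, below gZ u (d' y - z) & ~ below gZ u z]].

(** Exactness at Y, by well-founded induction on the bound u.  A vector at u is
    redundant, or the leading term of a boundary, or has an image with a leading
    term that cannot cancel.  The leading term of a cycle is not of the third
    kind, and for the second kind subtracting the boundary lowers the bound. *)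
Lemma exact_atmost u y :
  atmost gY u y -> d' y = 0 -> exists2 x, atmost gX u x & d x = y.
Proof.
elim/(well_founded_ind R_wf): u y => u IHu y ay dy.
have IHb z : below gY u z -> d' z = 0 -> exists2 x, below gX u x & d x = z.
  move=> /below_bounded[->|[u' Ru az]] dz.
    by exists 0; rewrite ?linear0 //; apply: Kspan0.
  by have [x ax dx] := IHu _ Ru _ az dz; exists x => //; apply: atmost_lt ax.
have IHa z : below gY u z -> d' z = 0 -> exists2 x, atmost gX u x & d x = z.
  by move=> bz /(IHb _ bz)[x bx dx]; exists x => //; apply: below_atmost.
have [/IHa/(_ dy)//|[k [y0 [y1 [g0 b1 yE]]]]] := atmost_split (gY_uniq (u := u)) ay.
case: (trichotomy g0) => [b0|[x0 gx0 b0]|[z [gz bz nz]]].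
- by apply: IHa => //; rewrite yE; apply: KspanD => //; apply: KspanZ.
- have [|| x ax dx] := IHa (y - k%:A *: d x0).
  + rewrite (_ : _ - _ = y1 - k%:A *: (d x0 - y0)).
      by apply: KspanB => //; apply: KspanZ.
    by rewrite yE scalerBr opprB addrCA addrA.
  + by rewrite linearB linearZZ dy dd scaler0 subrr.
  exists (x + k%:A *: x0); last by rewrite linearD linearZZ dx subrK.
  by apply: KspanD => //; apply/KspanZ/Kspan_incl; exists u => //; left.
- have [k0|nk] := eqVneq k 0.
    by apply: IHa => //; rewrite yE k0 !scale0r add0r.
  (* Otherwise d' y = 0 expresses z by vectors below u. *)
  case: nz; rewrite -[z](subKr (d' y0)); apply: KspanB => //.
  have -> : d' y0 = (- k^-1)%:A *: d' y1.
    move: dy; rewrite yE linearD linearZZ => /eqP; rewrite addrC addr_eq0 => /eqP ->.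
    by rewrite scaleNr scaleNr scalerN opprK scalerA mulr_algl scalerA mulVf // !scale1r.
  apply: KspanZ; apply: (Kspan_map _ _ b1); first exact: linear_Klinear.
  by move=> t [u' Ru gt]; apply: atmost_lt Ru _; apply: d'_atmost.
Qed.

End ThreeTerms.
End Filtration.

Lemma below_mono (K : fieldType) (A : algType K) (W : Type) (R R' : W -> W -> Prop)
    (M : lmodType A) (g : W -> M -> Prop) u x :
  (forall v, R u v -> R' u v) -> below R g u x -> below R' g u x.
Proof. by move=> h; apply: Kspan_mono => y [u' /h]; exists u'. Qed.

(** * Concatenation of paths *)

Section PathCalculus.
Variable Q : quiver.
Implicit Types p q r : qpath Q.

(** Total, unlike the given composition; the value at paths that do not meet is
    arbitrary. *)
Definition pcat p q : qpath Q := odflt p (Defs.pcomp p q).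

Lemma pcompE p q : pend p = psrc q -> Defs.pcomp p q = Some (pcat p q).
Proof. by rewrite /pcat => /pcomp_ex[r ->]. Qed.

Lemma psrc_pcat p q : pend p = psrc q -> psrc (pcat p q) = psrc p.
Proof. by move=> /pcompE/psrc_pcomp. Qed.

Lemma pend_pcat p q : pend p = psrc q -> pend (pcat p q) = pend q.
Proof. by move=> /pcompE/pend_pcomp. Qed.

Lemma parrows_pcat p q :
  pend p = psrc q -> parrows (pcat p q) = parrows p ++ parrows q.
Proof. by move=> /pcompE/pcompP[]. Qed.

Lemma plen_pcat p q : pend p = psrc q -> plen (pcat p q) = (plen p + plen q)%N.
Proof. by move=> h; rewrite /plen parrows_pcat // size_cat. Qed.

Lemma pcatA p q r : pend p = psrc q -> pend q = psrc r ->
  pcat p (pcat q r) = pcat (pcat p q) r.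
Proof.
move=> pq qr; have h1 : pend p = psrc (pcat q r) by rewrite psrc_pcat.
have h2 : pend (pcat p q) = psrc r by rewrite pend_pcat.
by apply: qpathP; rewrite ?psrc_pcat ?(parrows_pcat h1) ?(parrows_pcat h2) ?parrows_pcat ?catA.
Qed.

Lemma pcat_vl v p : psrc p = v -> pcat (vpath v) p = p.
Proof. by move=> e; apply: qpathP; rewrite ?psrc_pcat ?parrows_pcat. Qed.

Lemma pcat_vr v p : pend p = v -> pcat p (vpath v) = p.
Proof. by move=> e; apply: qpathP; rewrite ?psrc_pcat ?parrows_pcat ?cats0. Qed.

Lemma pcatI p p' q q' : pend p = psrc q -> pend p' = psrc q' -> plen q = plen q' ->
  pcat p q = pcat p' q' -> p = p' /\ q = q'.
Proof.
move=> h h' e E; have es := congr1 (@psrc Q) E; have ea := congr1 (@parrows Q) E.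
rewrite !psrc_pcat // in es; rewrite !parrows_pcat // in ea.
have /eqP : size (parrows p ++ parrows q) = size (parrows p' ++ parrows q') by rewrite ea.
rewrite !size_cat -/(plen q) e eqn_add2r => /eqP sz.
move/eqP: ea; rewrite eqseq_cat // => /andP[/eqP ea1 /eqP ea2].
have pp : p = p' by apply: qpathP.
by split=> //; apply: qpathP => //; rewrite -h -h' pp.
Qed.

Lemma path_nil p : parrows p = [::] -> p = vpath (psrc p).
Proof. by move=> e; apply: qpathP. Qed.

Lemma path_rcons p : parrows p = [::] \/
  exists p' a, pend p' = src a /\ p = pcat p' (apath a).
Proof.
have hw : walk (psrc p) (parrows p) := valP p.
case/lastP e: (parrows p) => [|s a]; first by left.
rewrite e -cats1 walk_cat /= andbT in hw; move/andP: hw => [ws /eqP wa].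
pose p' : qpath Q := exist _ (psrc p, s) ws.
have pe : pend p' = src a by rewrite wa.
right; exists p', a; split=> //; apply: qpathP; rewrite ?psrc_pcat ?parrows_pcat //.
by rewrite e -cats1.
Qed.

Lemma path_cat p s s' : parrows p = s ++ s' ->
  exists p1 p2, [/\ pend p1 = psrc p2, p = pcat p1 p2, parrows p1 = s &
                    parrows p2 = s'].
Proof.
move=> e; have hw : walk (psrc p) (parrows p) := valP p.
rewrite e walk_cat in hw; move/andP: hw => [w1 w2].
pose p1 : qpath Q := exist _ (psrc p, s) w1.
pose p2 : qpath Q := exist _ (walk_end (psrc p) s, s') w2.
have pe : pend p1 = psrc p2 by [].
by exists p1, p2; split=> //; apply: qpathP; rewrite ?psrc_pcat ?parrows_pcat.
Qed.

Definition parallel p q : Prop :=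
  [/\ psrc q = psrc p, pend q = pend p & plen q = plen p].

Lemma parallel_trans p q r : parallel p q -> parallel q r -> parallel p r.
Proof. by rewrite /parallel => -[-> -> ->] [-> -> ->]. Qed.

Lemma parallel_sym p q : parallel p q -> parallel q p.
Proof. by rewrite /parallel => -[-> -> ->]. Qed.

Lemma parallel_catl r p q :
  pend r = psrc p -> parallel p q -> parallel (pcat r p) (pcat r q).
Proof.
move=> h [es ee el]; have h' : pend r = psrc q by rewrite es.
by split; rewrite ?psrc_pcat ?pend_pcat ?plen_pcat ?el.
Qed.

Lemma parallel_catr r p q :
  pend p = psrc r -> parallel p q -> parallel (pcat p r) (pcat q r).
Proof.
move=> h [es ee el]; have h' : pend q = psrc r by rewrite ee.
by split; rewrite ?psrc_pcat ?pend_pcat ?plen_pcat ?el.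
Qed.

End PathCalculus.

(** * Projective modules given by idempotents *)

Section IdempotentProjective.
Variables (K : fieldType) (A : algType K) (C : finType) (e : C -> A).
Hypothesis e_idem : forall c, e c * e c = e c.

(** The sum of the left ideals A e_c, inside the free module on C. *)
Definition in_idem_mod : {pred {ffun C -> A^o}} :=
  fun x => [forall c, (x c : A) * e c == x c].

Lemma in_idem_modP (x : {ffun C -> A^o}) :
  reflect (forall c, (x c : A) * e c = x c) (x \in in_idem_mod).
Proof. exact: 'forall_eqP. Qed.

Lemma in_idem_mod_submod : submod_closed in_idem_mod.
Proof.
split; first by apply/in_idem_modP => c; rewrite !ffunE mul0r.
move=> a x y /in_idem_modP hx /in_idem_modP hy; apply/in_idem_modP => c.
by rewrite !ffunE mulrDl hy -[in RHS]hx /GRing.scale /= mulrA.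
Qed.

HB.instance Definition _ :=
  GRing.isSubmodClosed.Build A {ffun C -> A^o} in_idem_mod in_idem_mod_submod.

Record idem_mod := IdemMod {
  idem_val :> {ffun C -> A^o}; _ : idem_val \in in_idem_mod }.

HB.instance Definition _ := [isSub for idem_val].
HB.instance Definition _ := [Choice of idem_mod by <:].
HB.instance Definition _ := [SubChoice_isSubLmodule of idem_mod by <:].

Implicit Types (x : idem_mod) (a : A) (c : C).

Lemma idem_modP x c : (idem_val x c : A) * e c = idem_val x c.
Proof. by case: x => x /= /in_idem_modP. Qed.

Lemma single_subproof a c :
  [ffun c' => if c' == c then a * e c else 0 : A^o] \in in_idem_mod.
Proof.
apply/in_idem_modP => c'; rewrite !ffunE; case: eqP => [->|_].
  by rewrite -mulrA e_idem.
by rewrite mul0r.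
Qed.

Definition single a c : idem_mod := IdemMod (single_subproof a c).

Lemma singleE a c c' :
  idem_val (single a c) c' = if c' == c then a * e c else 0.
Proof. by rewrite ffunE. Qed.

Lemma idem_mod_inj x y : (forall c, idem_val x c = idem_val y c) -> x = y.
Proof. by move=> h; apply/val_inj/ffunP. Qed.

Lemma idem_valP a x y c :
  idem_val (a *: x + y) c = a * (idem_val x c : A) + idem_val y c.
Proof. by rewrite /= !ffunE. Qed.

Lemma single_linear c : linear (fun a : A^o => single a c).
Proof.
move=> b a a'; apply: idem_mod_inj => c'; rewrite idem_valP !singleE.
by case: eqP => _; rewrite ?mulr0 ?addr0 // mulrDl mulrA.
Qed.

Lemma scale_single b a c : b *: single a c = single (b * a) c.
Proof. exact: esym (linearZZ (mklin (single_linear c)) b a). Qed.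

Lemma single_eq0 a c : a * e c = 0 -> single a c = 0.
Proof. by move=> h; apply: idem_mod_inj => c'; rewrite singleE h /= ffunE if_same. Qed.

Lemma single_sum x : x = \sum_c single (idem_val x c) c.
Proof.
apply: idem_mod_inj => c.
have h : linear (fun x : idem_mod => idem_val x c : A^o).
  by move=> a y z; rewrite idem_valP.
have E := linear_sum (mklin h) (index_enum C) xpredT (fun c' => single (idem_val x c') c').
rewrite [RHS]E (bigD1 c) //= singleE eqxx idem_modP big1 ?addr0 // => c' ne.
by rewrite singleE eq_sym (negbTE ne).
Qed.

Section Maps.
Variables (M : lmodType A) (z : C -> M).

Definition idem_map_fun x : M := \sum_c (idem_val x c : A) *: z c.

Lemma idem_map_linear : linear idem_map_fun.
Proof.
move=> a x y; rewrite /idem_map_fun scaler_sumr -big_split /=.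
by apply: eq_bigr => c _; rewrite idem_valP scalerDl scalerA.
Qed.

Definition idem_map : {linear idem_mod -> M} := mklin idem_map_linear.

Lemma idem_mapE x : idem_map x = \sum_c (idem_val x c : A) *: z c.
Proof. by []. Qed.

Lemma idem_map_single a c : idem_map (single a c) = (a * e c) *: z c.
Proof.
rewrite /= /idem_map_fun (bigD1 c) //= singleE eqxx big1 ?addr0 // => c' ne.
by rewrite singleE (negbTE ne) scale0r.
Qed.

End Maps.

Lemma idem_map_values (M : lmodType A) (f : {linear idem_mod -> M}) x :
  f x = idem_map (fun c => f (single 1 c)) x.
Proof.
rewrite {1}[x]single_sum linear_sum; apply: eq_bigr => c _.
by rewrite -linearZZ scale_single mulr1.
Qed.

(** Lifting the images of the generators suffices: the lifts need not be fixed by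
    the idempotents, because the coefficients of x already are. *)
Lemma idem_mod_projective : projective idem_mod.
Proof.
move=> M N p f surj_p; have [m mE] := choice (fun c => surj_p (f (single 1 c))).
exists (idem_map m) => x; rewrite linear_sum [RHS]idem_map_values.
by apply: eq_bigr => c _; rewrite linearZZ mE.
Qed.

End IdempotentProjective.

(** * Chains of relations and algebras with a path basis *)

Section Chains.
Variables (Q : quiver) (tip2 : rel (arrow Q)).

(** A list of arrows read as a path ending at v; the endpoint v is needed only for
    the empty list. *)
Definition start (v : vertex Q) (s : seq (arrow Q)) : vertex Q :=
  if s is a :: _ then src a else v.

Definition first_relation (a : arrow Q) (s : seq (arrow Q)) : bool :=
  if s is b :: _ then tip2 a b else true.

Fixpoint is_chain (v : vertex Q) (s : seq (arrow Q)) : bool :=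
  if s is a :: s' then
    [&& tgt a == start v s', is_chain v s' & first_relation a s']
  else true.

Definition chain (v : vertex Q) (n : nat) : Type :=
  {c : n.-tuple (arrow Q) | is_chain v c}.

HB.instance Definition _ v n := Finite.on (chain v n).

Lemma chain_walk v s :
  is_chain v s -> walk (start v s) s /\ walk_end (start v s) s = v.
Proof.
elim: s => [|a s IHs] //= /and3P[/eqP ha /IHs[hw he] _].
by rewrite eqxx ha /=; split=> //; rewrite -[RHS]he /walk_end /= ha.
Qed.

Definition chain_start v n (c : chain v n) : vertex Q := start v (sval c).

Definition chain_path v n (c : chain v n) : qpath Q :=
  exist _ (chain_start c, val (sval c)) (proj1 (chain_walk (svalP c))).

Lemma psrc_chain v n (c : chain v n) : psrc (chain_path c) = chain_start c.
Proof. by []. Qed.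

Lemma plen_chain v n (c : chain v n) : plen (chain_path c) = n.
Proof. exact: size_tuple. Qed.

Lemma chain_path_inj v n : injective (@chain_path v n).
Proof. by move=> c c' /(congr1 (@parrows Q)) /= h; do 2 apply: val_inj. Qed.

Definition chain_head v n (c : chain v n.+1) : arrow Q := thead (sval c).

Lemma chain_tail_subproof v n (c : chain v n.+1) : is_chain v (behead_tuple (sval c)).
Proof.
by case: c => c /=; rewrite (tuple_eta c) /= => /and3P[].
Qed.

Definition chain_tail v n (c : chain v n.+1) : chain v n :=
  exist _ (behead_tuple (sval c)) (chain_tail_subproof c).

Lemma chain_headP v n (c : chain v n.+1) :
  tgt (chain_head c) = chain_start (chain_tail c).
Proof.
case: c => c; case/tupleP: c => a s hc.
by have /and3P[/eqP ha _ _] := hc; rewrite /chain_head /= theadE.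
Qed.

Lemma chain_path_cons v n (c : chain v n.+1) :
  chain_path c = pcat (apath (chain_head c)) (chain_path (chain_tail c)).
Proof.
have e : pend (apath (chain_head c)) = psrc (chain_path (chain_tail c)).
  exact: chain_headP.
apply: qpathP; rewrite ?psrc_pcat ?parrows_pcat //.
  by case: c e => c; case/tupleP: c => a s hc _; rewrite /chain_head /= theadE.
by case: c e => c; case/tupleP: c => a s hc _; rewrite /chain_head /= theadE.
Qed.

Lemma chain_start_cons v n (c : chain v n.+1) :
  chain_start c = src (chain_head c).
Proof. by case: c => c; case/tupleP: c => a s hc; rewrite /chain_head /= theadE. Qed.

Lemma chain_cons v n (a : arrow Q) (c : chain v n) :
  tgt a = chain_start c -> first_relation a (sval c) ->
  exists c' : chain v n.+1, chain_head c' = a /\ chain_tail c' = c.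
Proof.
move=> ha hr; have h : is_chain v [tuple of a :: sval c].
  by rewrite /= ha eqxx hr (svalP c).
exists (exist _ [tuple of a :: sval c] h); split.
  by rewrite /chain_head /= theadE.
by do 2 apply: val_inj.
Qed.

Lemma chain0P v (c : chain v 0) : chain_path c = vpath v.
Proof. by apply: qpathP; rewrite // /chain_path /chain_start /parrows /psrc /= tuple0. Qed.

End Chains.

(** The algebra A has the classes [beta p] of the paths free of tip2 as a basis, and
    the relations reduce each product of two arrows related by tip2 to smaller
    parallel paths.  Reduction is required to respect length and ends, whereas
    independence is required with respect to all smaller paths.  The conditions
    are invariant under reversing all paths. *)
Record pbw (K : fieldType) (A : algType K) (Q : quiver) (succ : rel (qpath Q))
    (tip2 : rel (arrow Q)) (beta : qpath Q -> A) (eps : vertex Q -> character A) :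
  Prop := Pbw {
  pbw_irr : irreflexive succ;
  pbw_trans : transitive succ;
  pbw_total : forall p q, p != q -> succ p q || succ q p;
  pbw_wf : well_founded (fun p q => succ q p);
  pbw_catr : forall p q r, pend p = psrc r -> pend q = psrc r -> succ p q ->
    succ (pcat p r) (pcat q r);
  pbw_catl : forall p q r, pend r = psrc p -> pend r = psrc q -> succ p q ->
    succ (pcat r p) (pcat r q);
  pbw_mul : forall p q, pend p = psrc q -> beta p * beta q = beta (pcat p q);
  pbw_mul0 : forall p q, pend p != psrc q -> beta p * beta q = 0;
  pbw_one : \sum_v beta (vpath v) = 1;
  pbw_span : forall a : A^o, Kspan (fun x : A^o => exists p, x = beta p) a;
  pbw_rel : forall t a b, parrows t = [:: a; b] -> tip2 a b ->
    Kspan (fun x : A^o => exists q, [/\ succ t q, parallel t q & x = beta q]) (beta t);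
  pbw_free : forall p, sorted (fun a b => ~~ tip2 a b) (parrows p) ->
    ~ Kspan (fun x : A^o => exists2 q, succ p q & x = beta q) (beta p);
  pbw_eps : forall v p, eps v (beta p) = (p == vpath v)%:R }.

(** * The Anick resolution *)

Section AnickResolution.
Variables (K : fieldType) (A : algType K) (Q : quiver) (succ : rel (qpath Q)).
Variables (tip2 : rel (arrow Q)) (beta : qpath Q -> A) (eps : vertex Q -> character A).
Hypothesis H : pbw succ tip2 beta eps.

(** The order on which differentials are triangular: smaller, with the same length
    and the same ends. *)
Definition lower (u u' : qpath Q) : Prop := succ u u' /\ parallel u u'.

Lemma lower_trans u v w : lower u v -> lower v w -> lower u w.
Proof.
move=> [s1 p1] [s2 p2]; split; last exact: parallel_trans p1 p2.
exact: (pbw_trans H) s1 s2.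
Qed.

Lemma lower_wf : well_founded (fun u u' => lower u' u).
Proof.
move=> u; elim/(well_founded_ind (pbw_wf H)): u => u IH.
by constructor=> v [/IH].
Qed.

Lemma lower_tri u v w : lower u v -> lower u w -> [\/ v = w, lower v w | lower w v].
Proof.
move=> [_ pv] [_ pw]; have [->|ne] := eqVneq v w; first by constructor 1.
have vw : parallel v w := parallel_trans (parallel_sym pv) pw.
case/orP: (pbw_total H ne) => s; [constructor 2 | constructor 3]; split=> //.
exact: parallel_sym.
Qed.

Lemma succ_tri u v w : succ u v -> succ u w ->
  [\/ v = w, is_true (succ v w) | is_true (succ w v)].
Proof.
move=> _ _; have [->|ne] := eqVneq v w; first by constructor 1.
by case/orP: (pbw_total H ne); [constructor 2 | constructor 3].
Qed.

Lemma lower_catl r p q : pend r = psrc p -> lower p q -> lower (pcat r p) (pcat r q).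
Proof.
move=> h [s pq]; split; last exact: parallel_catl.
by apply: (pbw_catl H) => //; case: pq => ->.
Qed.

Lemma lower_catr r p q : pend p = psrc r -> lower p q -> lower (pcat p r) (pcat q r).
Proof.
move=> h [s pq]; split; last exact: parallel_catr.
by apply: (pbw_catr H) => //; case: pq => _ ->.
Qed.

Lemma succ_catrI p q r : pend p = psrc r -> pend q = psrc r ->
  succ (pcat p r) (pcat q r) -> succ p q.
Proof.
move=> hp hq s; have [e|ne] := eqVneq p q; first by rewrite e (pbw_irr H) in s.
case/orP: (pbw_total H ne) => // s'.
have := pbw_trans H s (pbw_catr H hq hp s'); by rewrite (pbw_irr H).
Qed.

Definition tfree (p : qpath Q) : bool := sorted (fun a b => ~~ tip2 a b) (parrows p).

(** A path through a relation reduces to smaller parallel paths. *)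
Lemma nontfree_low p : ~~ tfree p ->
  Kspan (fun x : A^o => exists2 q, lower p q & x = beta q) (beta p).
Proof.
move=> hp.
have [s1 [a [b [s2 [e rel]]]]] : exists s1 a b s2,
    parrows p = s1 ++ [:: a; b] ++ s2 /\ tip2 a b.
  move: hp; rewrite /tfree; move: (parrows p); elim=> [|a s IHs] //=.
  case: s IHs => [|b s] //= IHs; rewrite negb_and negbK.
  case/orP => [ab|/IHs[s1 [c [d [s2 [-> cd]]]]]]; first by exists [::], a, b, s.
  by exists (a :: s1), c, d, s2.
have [p1 [q [e1 -> _ eq]]] := path_cat e.
have [p2 [p3 [e2 qE ep2 _]]] := path_cat eq.
have e1' : pend p1 = psrc p2 by rewrite e1 qE psrc_pcat.
rewrite qE; have e3 : pend p1 = psrc (pcat p2 p3) by rewrite -qE.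
rewrite -(pbw_mul H e3) -(pbw_mul H e2).
apply: (@Kspan_map _ _ A^o A^o (fun x : A => beta p1 * (x * beta p3))
  (fun x => exists q, [/\ succ p2 q, parallel p2 q & x = beta q])).
- move=> k x y; rewrite mulrDl mulrDr; congr (_ + _).
  by rewrite /GRing.scale /= !mulr_algl -scalerAl -scalerAr.
- move=> _ [r [sr pr ->]]; apply: Kspan_incl.
  have [es ee el] := pr.
  exists (pcat p1 (pcat r p3)); last by rewrite !(pbw_mul H) ?psrc_pcat ?ee ?es.
  by apply: lower_catl => //; apply: lower_catr.
- exact: (pbw_rel H) ep2 rel.
Qed.

Lemma beta_idem v : beta (vpath v) * beta (vpath v) = beta (vpath v).
Proof. by rewrite (pbw_mul H) // pcat_vl. Qed.

Lemma beta_vr p v : beta p * beta (vpath v) = if pend p == v then beta p else 0.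
Proof.
case: eqP => [e|/eqP ne]; last exact: (pbw_mul0 H).
by rewrite (pbw_mul H) // pcat_vr.
Qed.

Variable v : vertex Q.

Definition chain_idem n (c : chain tip2 v n) : A := beta (vpath (chain_start c)).

Lemma chain_idem_idem n (c : chain tip2 v n) :
  chain_idem c * chain_idem c = chain_idem c.
Proof. exact: beta_idem. Qed.

(** The sum of A e_(s(c)) over the chains c of length n ending at v. *)
Definition anick n : lmodType A := idem_mod (@chain_idem n).

(** The element p of the summand A e_(s(c)); it is placed at the path p c. *)
Definition word n (p : qpath Q) (c : chain tip2 v n) : anick n :=
  single (@chain_idem_idem n) (beta p) c.

Definition weight n (p : qpath Q) (c : chain tip2 v n) : qpath Q :=
  pcat p (chain_path c).

Definition words n (u : qpath Q) (x : anick n) : Prop :=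
  exists p c, [/\ pend p = chain_start c, u = weight p c & x = word p c].

(** A path determines its last n arrows, hence both p and c. *)
Lemma words_uniq n u (x y : anick n) : words u x -> words u y -> x = y.
Proof.
move=> [p [c [hp -> ->]]] [q [d [hq E ->]]].
have [|e1 e2] := pcatI (q := chain_path c) (q' := chain_path d) hp hq _ E.
  by rewrite !plen_chain.
by rewrite e1 (chain_path_inj e2).
Qed.

Lemma word0 n p (c : chain tip2 v n) : pend p != chain_start c -> word p c = 0.
Proof. by move=> h; apply: single_eq0; apply: (pbw_mul0 H). Qed.

Lemma scale_word n q p (c : chain tip2 v n) : pend q = psrc p ->
  beta q *: word p c = word (pcat q p) c.
Proof. by move=> h; rewrite /word scale_single (pbw_mul H). Qed.

Lemma anick_span n (x : anick n) : Kspan (fun y => exists u, words u y) x.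
Proof.
rewrite [x](single_sum (@chain_idem_idem n)).
apply: (big_ind (Kspan _)) => [|y z|c _]; [exact: Kspan0 | exact: KspanD |].
have := pbw_span H (idem_val x c).
apply: (@Kspan_map _ _ A^o (anick n) (fun a => single (@chain_idem_idem n) a c)).
  move=> k a b; exact: (single_linear (@chain_idem_idem n) c).
move=> _ [p ->]; have [e|ne] := eqVneq (pend p) (chain_start c).
  by apply: Kspan_incl; exists (weight p c), p, c.
by rewrite -/(word p c) word0 //; apply: Kspan0.
Qed.

Lemma below_scale n q u (x : anick n) : pend q = psrc u ->
  below lower (@words n) u x -> below lower (@words n) (pcat q u) (beta q *: x).
Proof.
move=> h; apply: Kspan_map => [k y z|y [u' lu [p [c [hp e ->]]]]].
  by rewrite scalerDr !scalerA mulr_algl mulr_algr.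
have hq : pend q = psrc p.
  by rewrite h; case: lu => _ [<- _ _]; rewrite e psrc_pcat.
apply: Kspan_incl; exists (pcat q u'); first exact: lower_catl.
exists (pcat q p), c; split; first by rewrite pend_pcat.
  by rewrite e /weight pcatA.
by rewrite scale_word.
Qed.

Lemma word_low n p (c : chain tip2 v n) : pend p = chain_start c -> ~~ tfree p ->
  below lower (@words n) (weight p c) (word p c).
Proof.
move=> hp /nontfree_low.
apply: (@Kspan_map _ _ A^o (anick n) (fun a => single (@chain_idem_idem n) a c)).
  move=> k a b; exact: (single_linear (@chain_idem_idem n) c).
move=> _ [q lq ->]; apply: Kspan_incl; have [_ [es ee el]] := lq.
exists (weight q c); first exact: lower_catr.
by exists q, c; split=> //; rewrite ee.
Qed.

Lemma word_free n p (c : chain tip2 v n) : pend p = chain_start c -> tfree p ->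
  ~ below succ (@words n) (weight p c) (word p c).
Proof.
move=> hp fp hb; apply: (pbw_free H fp).
have -> : beta p = idem_val (word p c) c.
  by rewrite singleE eqxx beta_vr hp eqxx.
move: hb; apply: (@Kspan_map _ _ (anick n) A^o (fun x => idem_val x c)).
  by move=> k x y; rewrite idem_valP.
move=> _ [u su [q [d [hq e ->]]]]; rewrite singleE.
case: eqP => [cd|_]; last exact: Kspan0.
rewrite /chain_idem beta_vr hq eqxx; apply: Kspan_incl; exists q => //.
rewrite e /weight cd in su *; apply: succ_catrI su; rewrite ?psrc_chain //.
by rewrite -cd.
Qed.

Lemma chain_rel n (c : chain tip2 v n.+2) :
  tip2 (chain_head c) (chain_head (chain_tail c)).
Proof.
case: c => c; case/tupleP: c => a c; case/tupleP: c => b s hc.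
have /and3P[_ _] := hc; rewrite /chain_head /= theadE.
by rewrite [thead _](_ : _ = b).
Qed.

Lemma apath_meets n (c : chain tip2 v n.+1) :
  pend (apath (chain_head c)) = chain_start (chain_tail c).
Proof. exact: chain_headP. Qed.

Lemma weight_shift n p (c : chain tip2 v n.+1) : pend p = chain_start c ->
  weight p c = weight (pcat p (apath (chain_head c))) (chain_tail c).
Proof.
move=> hp; rewrite /weight chain_path_cons pcatA ?apath_meets //.
by rewrite hp chain_start_cons.
Qed.

Lemma pend_shift n p (c : chain tip2 v n.+1) : pend p = chain_start c ->
  pend (pcat p (apath (chain_head c))) = chain_start (chain_tail c).
Proof. by move=> hp; rewrite pend_pcat ?apath_meets // hp chain_start_cons. Qed.

(** The image of the generator of c = a c' has leading term (a, c'). *)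
Definition lead n (z : chain tip2 v n.+1 -> anick n) : Prop := forall c,
  below lower (@words n) (chain_path c)
    (z c - word (apath (chain_head c)) (chain_tail c)).

Definition diff n (z : chain tip2 v n.+1 -> anick n) : {linear anick n.+1 -> anick n} :=
  @idem_map _ _ _ (@chain_idem n.+1) _ z.

Section LeadingTerms.
Variables (n : nat) (z : chain tip2 v n.+1 -> anick n).
Hypothesis lead_z : lead z.

Lemma diff_word p c : pend p = chain_start c ->
  below lower (@words n) (weight p c)
    (diff z (word p c) - word (pcat p (apath (chain_head c))) (chain_tail c)).
Proof.
move=> hp; rewrite idem_map_single /chain_idem beta_vr hp eqxx.
rewrite -scale_word; last by rewrite hp chain_start_cons.
by rewrite -scalerBr; apply: below_scale.
Qed.

Lemma diff_atmost u x : words u x -> atmost lower (@words n) u (diff z x).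
Proof.
move=> [p [c [hp -> ->]]].
rewrite -[diff z _](subrK (word (pcat p (apath (chain_head c))) (chain_tail c))).
apply: KspanD; first exact/below_atmost/diff_word.
apply: Kspan_incl; exists (weight p c); first by left.
exists (pcat p (apath (chain_head c))), (chain_tail c).
by split; [exact: pend_shift | exact: weight_shift |].
Qed.

End LeadingTerms.

Section Step.
Variables (n : nat) (z : chain tip2 v n.+1 -> anick n).
Variables (z' : chain tip2 v n.+2 -> anick n.+1).
Hypotheses (lead_z : lead z) (lead_z' : lead z').
Hypothesis zz' : forall c, diff z (z' c) = 0.

Lemma diff_diff x : diff z (diff z' x) = 0.
Proof.
rewrite [diff z' x]idem_mapE linear_sum big1 // => c _.
by rewrite linearZZ zz' scaler0.
Qed.

(** For (p, a c'): if p contains a relation the word is redundant; if p a is free of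
    relations, so is the leading term (p a, c') of its image; otherwise p = p' a'
    with a' a a relation, and the word is the leading term of the image of
    (p', a' a c'). *)
Lemma step_trichotomy u (y : anick n.+1) : words u y ->
  [\/ below lower (@words n.+1) u y,
      exists2 x, words u x & below lower (@words n.+1) u (diff z' x - y) |
      exists w, [/\ words u w, below lower (@words n) u (diff z y - w) &
                    ~ below succ (@words n) u w]].
Proof.
move=> [p [c [hp uE ->]]]; rewrite uE.
have [fp|nfp] := boolP (tfree p); last by constructor 1; apply: word_low.
set a := chain_head c.
have ha : pend p = src a by rewrite hp chain_start_cons.
have [fpa|nfpa] := boolP (tfree (pcat p (apath a))).
  constructor 3; exists (word (pcat p (apath a)) (chain_tail c)); split.
  - exists (pcat p (apath a)), (chain_tail c).
    by split; [exact: pend_shift | exact: weight_shift |].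
  - exact: diff_word.
  - by rewrite weight_shift //; apply: word_free => //; exact: pend_shift.
constructor 2; have [p0|[p' [a' [hp' pE]]]] := path_rcons p.
  by move: nfpa; rewrite /tfree parrows_pcat // p0.
have rel : tip2 a' a.
  move: nfpa fp; rewrite /tfree parrows_pcat // pE parrows_pcat //.
  rewrite [parrows (apath _)]/= [parrows (apath a)]/= -catA /=.
  case: (parrows p') => [|b s] /=; first by rewrite andbT negbK.
  rewrite !cat_path /= => h /andP[h1 /andP[h2 _]]; move: h.
  by rewrite h1 h2 /= andbT negbK.
have [||c' [hc' tc']] := @chain_cons _ tip2 v _ a' c.
- by rewrite -hp pE pend_pcat.
- move: rel; rewrite /a; case: (c) => d; case/tupleP: d => b s hd.
  by rewrite /chain_head /= theadE.
have hpc : pend p' = chain_start c' by rewrite chain_start_cons hc'.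
have wE : weight p c = weight p' c' by rewrite [RHS]weight_shift // hc' tc' -pE.
exists (word p' c'); first by exists p', c'.
by have := diff_word lead_z' hpc; rewrite hc' tc' -pE wE.
Qed.

(** Needed for two orders: [lower], to construct the next differential with control
    of length and ends, and [succ], in which any element is bounded. *)
Lemma step_exact R u y : (forall u u', lower u u' -> R u u') ->
  (forall u u', R u u' -> succ u u') -> well_founded (fun u u' => R u' u) ->
  (forall u v w, R u v -> R v w -> R u w) ->
  (forall u v w, R u v -> R u w -> [\/ v = w, R v w | R w v]) ->
  atmost R (@words n.+1) u y -> diff z y = 0 ->
  exists2 x, atmost R (@words n.+2) u x & diff z' x = y.
Proof.
move=> lR Rs Rwf Rtr Rtri.
apply: (exact_atmost (gZ := @words n) Rwf Rtr Rtri diff_diff).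
- by move=> u' x x'; apply: words_uniq.
- move=> u' x /(diff_atmost lead_z); apply: Kspan_mono => t [u'' hu gt].
  by exists u'' => //; case: hu; [left | right; apply: lR].
- move=> u' x /step_trichotomy[h|[x' gx h]|[w [gw h nw]]].
  + by constructor 1; apply: below_mono h => t; apply: lR.
  + by constructor 2; exists x' => //; apply: below_mono h => t; apply: lR.
  + constructor 3; exists w; split=> //; first by apply: below_mono h => t; apply: lR.
    by move=> b; apply: nw; apply: below_mono b => t; apply: Rs.
Qed.

End Step.

(** Exactness at the source of z, phrased without the preceding differential: a
    bounded boundary is the boundary of an element with the same bound. *)
Definition strict n (z : chain tip2 v n.+1 -> anick n) : Prop := forall u x,
  below lower (@words n) u (diff z x) ->
  exists2 x', below lower (@words n.+1) u x' & diff z x' = diff z x.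

Lemma below_of_atmost (M N : lmodType A) (gM : qpath Q -> M -> Prop)
    (gN : qpath Q -> N -> Prop) (d : {linear M -> N}) (C : N -> Prop) :
  (forall u y, atmost lower gN u y -> C y -> exists2 x, atmost lower gM u x & d x = y) ->
  forall u y, below lower gN u y -> C y -> exists2 x, below lower gM u x & d x = y.
Proof.
move=> h u y /(below_bounded lower_trans lower_tri)[->|[u' l ay]] Cy.
  by exists 0; rewrite ?linear0 //; apply: Kspan0.
by have [x ax dx] := h _ _ ay Cy; exists x => //; apply: (atmost_lt lower_trans l).
Qed.

Lemma strict_step n (z : chain tip2 v n.+1 -> anick n) (z' : chain tip2 v n.+2 -> anick n.+1) :
  lead z -> lead z' -> (forall c, diff z (z' c) = 0) -> strict z'.
Proof.
move=> lz lz' zz' u x hx; apply: below_of_atmost hx (diff_diff zz' x) => t y.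
exact: (@step_exact _ _ _ lz lz' zz' lower t y (fun _ _ h => h)
  (fun _ _ h => proj1 h) lower_wf lower_trans lower_tri).
Qed.

(** For c = a a' c'' the word (a, a' c'') has image with leading term (a a', c''),
    which is redundant as a a' is a relation; so the image is bounded strictly by
    c, and strictness removes it by a correction below c. *)
Lemma next_differential n (z : chain tip2 v n.+1 -> anick n) : lead z -> strict z ->
  exists z' : chain tip2 v n.+2 -> anick n.+1, lead z' /\ forall c, diff z (z' c) = 0.
Proof.
move=> lz sz.
have step c : exists y : anick n.+1,
    below lower (@words n.+1) (chain_path c)
      (y - word (apath (chain_head c)) (chain_tail c)) /\ diff z y = 0.
  set w := word _ _; have hw := apath_meets c.
  have wE : weight (apath (chain_head c)) (chain_tail c) = chain_path c.
    by rewrite /weight -chain_path_cons.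
  have [|x bx dx] := sz (chain_path c) w.
    have := diff_word lz hw; rewrite wE => b1.
    pose w2 := word (pcat (apath (chain_head c)) (apath (chain_head (chain_tail c))))
      (chain_tail (chain_tail c)).
    rewrite -[diff z w](subrK w2); apply: KspanD => //.
    rewrite -wE weight_shift //; apply: word_low; first exact: pend_shift.
    rewrite /tfree parrows_pcat ?hw ?chain_start_cons //=.
    by rewrite andbT negbK chain_rel.
  exists (w - x); split; last by rewrite linearB dx subrr.
  by rewrite addrAC subrr add0r; apply: KspanN.
have [z' z'P] := choice step.
by exists z'; split=> c; have [] := z'P c.
Qed.

Section Base.
Variables (S : lmodType A) (cS : affords (eps v) S).

Definition top : S := sval (cid (coordinate_surj cS 1)).

Lemma coordinate_top : coordinate cS top = 1.
Proof. exact: svalP (cid (coordinate_surj cS 1)). Qed.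

Definition augmentation : {linear anick 0 -> S} :=
  @idem_map _ _ _ (@chain_idem 0) _ (fun _ => top).

Lemma chain_start0 (c : chain tip2 v 0) : chain_start c = v.
Proof. by case: c => c hc; rewrite /chain_start /= tuple0. Qed.

Lemma weight0 p (c : chain tip2 v 0) : pend p = v -> weight p c = p.
Proof. by move=> h; rewrite /weight chain0P pcat_vr. Qed.

Lemma augmentation_word p (c : chain tip2 v 0) : pend p = v ->
  coordinate cS (augmentation (word p c)) = (p == vpath v)%:R.
Proof.
move=> hp; rewrite idem_map_single /chain_idem chain_start0 beta_vr hp eqxx.
by rewrite coordinateZ coordinate_top mulr1 (pbw_eps H).
Qed.

Lemma augmentation_nontrivial p (c : chain tip2 v 0) : pend p = v ->
  parrows p <> [::] -> augmentation (word p c) = 0.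
Proof.
move=> hp np; apply: (@coordinate_inj _ _ _ _ cS).
rewrite coordinate0 augmentation_word //; case: eqP => // e.
by case: np; rewrite e.
Qed.

Definition base (c : chain tip2 v 1) : anick 0 :=
  word (apath (chain_head c)) (chain_tail c).

Lemma lead_base : lead base.
Proof. by move=> c; rewrite subrr; apply: Kspan0. Qed.

Lemma augmentation_base x : augmentation (diff base x) = 0.
Proof.
rewrite [diff base x]idem_mapE linear_sum big1 // => c _.
rewrite linearZZ augmentation_nontrivial ?scaler0 //.
by rewrite apath_meets chain_start0.
Qed.

(** The augmentation sends the word of the vertex v to a basis vector of S, which is
    placed at the vertex v. *)
Definition top_word (u : qpath Q) (s : S) : Prop := u = vpath v /\ coordinate cS s = 1.

(** Words other than the vertex v end in an arrow, so they are images of words of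
    degree 1; no relation enters. *)
Lemma base_exact R u y : (forall u u', lower u u' -> R u u') ->
  (forall u u', R u u' -> succ u u') -> well_founded (fun u u' => R u' u) ->
  (forall u v w, R u v -> R v w -> R u w) ->
  (forall u v w, R u v -> R u w -> [\/ v = w, R v w | R w v]) ->
  atmost R (@words 0) u y -> augmentation y = 0 ->
  exists2 x, atmost R (@words 1) u x & diff base x = y.
Proof.
move=> lR Rs Rwf Rtr Rtri.
have top_nonlow s : coordinate cS s = 1 -> ~ below R top_word (vpath v) s.
  move=> s1 hb; have : s = 0.
    elim: hb => // k x y' [u' Ru [ue _]]; move: (Rs _ _ Ru).
    by rewrite ue (pbw_irr H).
  by move=> s0; move: s1; rewrite s0 coordinate0 => /esym/eqP; rewrite oner_eq0.
apply: (exact_atmost (gZ := top_word) Rwf Rtr Rtri augmentation_base).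
- by move=> u' x x'; apply: words_uniq.
- move=> u' x [p [c [hp uE ->]]]; rewrite chain_start0 in hp.
  have [e|ne] := eqVneq p (vpath v); last first.
    have -> : augmentation (word p c) = 0; last exact: Kspan0.
    apply: (@coordinate_inj _ _ _ _ cS).
    by rewrite coordinate0 augmentation_word // (negbTE ne).
  apply: Kspan_incl; exists (vpath v).
    by left; rewrite uE weight0.
  by split=> //; rewrite augmentation_word // e eqxx.
- move=> u' x [p [c [hp uE ->]]]; have hv := hp; rewrite chain_start0 in hv.
  rewrite uE weight0 //; have [p0|[p' [a [hp' pE]]]] := path_rcons p.
    have pv : p = vpath v by rewrite (path_nil p0) -hv (path_nil p0).
    constructor 3; exists (augmentation (word p c)).
    have h1 : coordinate cS (augmentation (word p c)) = 1.
      by rewrite augmentation_word // pv eqxx.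
    split; [by split | by rewrite subrr; apply: Kspan0 |].
    by rewrite [X in below _ _ X]pv; apply: top_nonlow.
  have ha : tgt a = chain_start c by rewrite -hp pE pend_pcat.
  have [|c' [hc' tc']] := chain_cons (tip2 := tip2) ha.
    by case: (c) => d hd; rewrite /= tuple0.
  constructor 2; exists (word p' c').
    exists p', c'; rewrite weight_shift chain_start_cons hc' //.
    by split=> //; rewrite tc' -pE weight0.
  rewrite idem_map_single /chain_idem chain_start_cons hc' beta_vr hp' eqxx.
  by rewrite /base hc' tc' scale_word // -pE subrr; apply: Kspan0.
Qed.

Lemma strict_base : strict base.
Proof.
move=> u x hx; apply: below_of_atmost hx (augmentation_base x) => t y.
exact: (@base_exact lower t y (fun _ _ h => h) (fun _ _ h => proj1 h)
  lower_wf lower_trans lower_tri).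
Qed.

(** The image of each generator is chosen degree by degree. *)
Lemma differentials : exists z : forall n, chain tip2 v n.+1 -> anick n,
  [/\ z 0 = base, forall n, lead (z n) & forall n c, diff (z n) (z n.+1 c) = 0].
Proof.
have [|n s [ls ss]|z [z0 hz]] := @dependent_choice
    (fun n => chain tip2 v n.+1 -> anick n) (fun n z => lead z /\ strict z)
    (fun n z z' => forall c, diff z (z' c) = 0) base.
- by split; [exact: lead_base | exact: strict_base].
- have [z' [lz' zz']] := next_differential ls ss.
  by exists z'; split=> //; split=> //; apply: strict_step zz'.
by exists z; split=> // n; have [[]] := hz n.
Qed.

Lemma anick_bounded n (y : anick n) :
  y = 0 \/ exists u, atmost succ (@words n) u y.
Proof.
elim: (anick_span y) => [|k x y' [u wx] _ IH]; first by left.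
have ax : atmost succ (@words n) u (k%:A *: x).
  by apply/KspanZ/Kspan_incl; exists u => //; left.
right; case: IH => [->|[u' ay]]; first by exists u; rewrite addr0.
have [e|ne] := eqVneq u u'; first by exists u; apply: KspanD => //; rewrite e.
have up w w' t : succ w w' -> atmost succ (@words n) w' t -> atmost succ (@words n) w t.
  move=> s at'; apply: below_atmost; apply: atmost_lt s at' => w1 w2 w3.
  exact: (pbw_trans H).
case/orP: (pbw_total H ne) => s; [exists u | exists u'].
  by apply: KspanD => //; apply: up s ay.
by apply: KspanD => //; apply: up s ax.
Qed.

Definition boundary n : chain tip2 v n.+1 -> anick n := sval (cid differentials) n.

Lemma boundaryP : [/\ @boundary 0 = base, forall n, lead (@boundary n) &
  forall n c, diff (@boundary n) (@boundary n.+1 c) = 0].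
Proof. exact: svalP (cid differentials). Qed.

Lemma augmentation_surj s : exists x, augmentation x = s.
Proof.
pose c0 : chain tip2 v 0 := exist (fun c : 0.-tuple _ => is_chain tip2 v c) [tuple] isT.
exists ((coordinate cS s)%:A *: word (vpath v) c0).
apply: (@coordinate_inj _ _ _ _ cS); rewrite linearZZ coordinateZ charZ char1 mulr1.
by rewrite augmentation_word // eqxx mulr1.
Qed.

Lemma augmentation_exact x :
  augmentation x = 0 <-> exists y, diff (@boundary 0) y = x.
Proof.
have [-> _ _] := boundaryP; split=> [dx|[y <-]]; last exact: augmentation_base.
have [->|[u ax]] := anick_bounded x; first by exists 0; rewrite linear0.
have [y _ dy] := @base_exact succ u x (fun _ _ h => proj1 h) (fun _ _ h => h)
  (pbw_wf H) (fun _ _ _ => @pbw_trans _ _ _ _ _ _ _ H _ _ _) succ_tri ax dx.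
by exists y.
Qed.

Lemma anick_exact n x :
  diff (@boundary n) x = 0 <-> exists y, diff (@boundary n.+1) y = x.
Proof.
have [_ lz zz] := boundaryP; split=> [dx|[y <-]]; last exact: (diff_diff (zz n)).
have [->|[u ax]] := anick_bounded x; first by exists 0; rewrite linear0.
have [y _ dy] := @step_exact _ _ _ (lz n) (lz n.+1) (zz n) succ u x
  (fun _ _ h => proj1 h) (fun _ _ h => h)
  (pbw_wf H) (fun _ _ _ => @pbw_trans _ _ _ _ _ _ _ H _ _ _) succ_tri ax dx.
by exists y.
Qed.

Definition anick_resolution : proj_resolution S :=
  @ProjResolution _ _ S anick (fun n => diff (@boundary n)) augmentation
    (fun n => idem_mod_projective (@chain_idem_idem n))
    augmentation_surj augmentation_exact anick_exact.

Lemma word_single n p (c : chain tip2 v n) :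
  word p c = beta p *: single (@chain_idem_idem n) 1 c.
Proof. by rewrite scale_single mulr1. Qed.

(** The image of a generator of degree n + 1 is homogeneous of length n + 1, so it is a
    combination of words (b, c') with b an arrow; arrows act as 0 on S'. *)
Lemma anick_minimal w (S' : lmodType A) : affords (eps w) S' ->
  minimal_for S' anick_resolution.
Proof.
move=> cS' n f x.
have fword p (c : chain tip2 v n) : pend p = chain_start c -> plen p = 1 -> f (word p c) = 0.
  move=> hp lp; apply: (@coordinate_inj _ _ _ _ cS').
  rewrite coordinate0 word_single linearZZ coordinateZ (pbw_eps H).
  by case: eqP lp => [->|_ _]; rewrite ?mul0r.
have fb c : f (@boundary n c) = 0.
  have [_ lz _] := boundaryP.
  rewrite -[@boundary n c](subrK (word (apath (chain_head c)) (chain_tail c))).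
  rewrite linearD fword ?apath_meets // addr0.
  elim: (lz n c) => [|k y y' [u [_ [_ _ pl]] [p [d [hp uE ->]]]] _ IH].
    by rewrite linear0.
  rewrite linearP IH addr0 fword ?scaler0 //.
  move: pl; rewrite uE plen_pcat // !plen_chain => /eqP.
  by rewrite -(add1n n) eqn_add2r => /eqP.
rewrite [pr_d _ _ x]idem_mapE linear_sum big1 // => c _.
by rewrite linearZZ fb scaler0.
Qed.

Lemma anick_trivial n : (forall c : seq (arrow Q), size c = n -> ~~ is_chain tip2 v c) ->
  forall x : pr_mod anick_resolution n, x = 0.
Proof.
move=> h x; apply: idem_mod_inj => c; have := h _ (size_tuple (sval c)).
by rewrite (svalP c).
Qed.

Definition chain_from (w : vertex Q) n : Type := {c : chain tip2 v n | chain_start c == w}.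

HB.instance Definition _ w n := Finite.on (chain_from w n).

(** A homomorphism is given by its values on the generators, and the generator of c
    goes to e_(s(c)) S', which is 0 unless s(c) = w. *)
Lemma anick_Hom w (S' : lmodType A) n : affords (eps w) S' ->
  exists phi : Defs.Hom (pr_mod anick_resolution n) S' -> {ffun chain_from w n -> K^o},
    linear phi /\ bijective phi.
Proof.
move=> cS'; pose gen c := single (@chain_idem_idem n) 1 c.
pose phi (f : Defs.Hom (pr_mod anick_resolution n) S') : {ffun chain_from w n -> K^o} :=
  [ffun c => coordinate cS' (happ f (gen (sval c)))].
have phi_lin : linear phi.
  move=> k f g; apply/ffunP => c; rewrite !ffunE happD happZ coordinateD coordinateZ.
  by rewrite charZ char1 mulr1.
exists phi; split=> //.
have genE c : chain_idem c *: gen c = gen c.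
  rewrite scale_single mulr1; apply: idem_mod_inj => d.
  by rewrite !singleE chain_idem_idem mul1r.
have off (f : Defs.Hom (pr_mod anick_resolution n) S') c :
    chain_start c != w -> happ f (gen c) = 0.
  move=> ne; apply: (@coordinate_inj _ _ _ _ cS'); rewrite coordinate0 -genE linearZZ.
  rewrite coordinateZ (pbw_eps H); case: eqP => [|_]; last by rewrite mul0r.
  by move=> E; have e : chain_start c = w := congr1 (@psrc Q) E; rewrite e eqxx in ne.
have phi_inj : injective phi.
  move=> f g E; apply: happ_inj => x.
  rewrite [LHS](idem_map_values (@chain_idem_idem n)).
  rewrite [RHS](idem_map_values (@chain_idem_idem n)) !idem_mapE.
  apply: eq_bigr => c _; congr (_ *: _).
  have [e|ne] := boolP (chain_start c == w); last by rewrite !off.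
  apply: (@coordinate_inj _ _ _ _ cS').
  by have := congr1 (fun h : {ffun chain_from w n -> K^o} => h (exist _ c e)) E;
    rewrite !ffunE.
have phi_surj h : exists f, phi f = h.
  pose val c : K := if insub c is Some d then h (d : chain_from w n) else 0.
  have vals c := coordinate_surj cS' (val c).
  have [s sE] := choice vals.
  exists (@idem_map _ _ _ (@chain_idem n) _ s : Defs.Hom _ _); apply/ffunP => c.
  rewrite ffunE /= [X in coordinate _ X]idem_map_single mul1r coordinateZ sE /val.
  rewrite insubT ?(svalP c) // => e; rewrite (pbw_eps H) (eqP e) eqxx mul1r.
  by congr (h _); apply: val_inj.
have [psi psiE] := choice phi_surj.
by exists psi => // f; apply: phi_inj; rewrite psiE.
Qed.

End Base.
End AnickResolution.

(** * The converse algebra and the opposite quiver *)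

Section ConverseAlgebra.
Variables (K : fieldType) (A : algType K).

(** A new name for the converse ring, on which K acts as on A. *)
Definition converse_alg : Type := A^c.
HB.instance Definition _ := GRing.NzRing.on converse_alg.

Definition converse_scale (k : K) (x : converse_alg) : converse_alg := k *: (x : A).

Let scaleA a b x : converse_scale a (converse_scale b x) = converse_scale (a * b) x.
Proof. exact: scalerA. Qed.
Let scale1 : left_id 1 converse_scale.
Proof. exact: scale1r. Qed.
Let scaleDr : right_distributive converse_scale +%R.
Proof. by move=> k x y; exact: scalerDr. Qed.
Let scaleDl x : {morph converse_scale^~ x : a b / a + b}.
Proof. by move=> k l; exact: scalerDl. Qed.
HB.instance Definition _ := GRing.Zmodule_isLmodule.Build K converse_alg
  scaleA scale1 scaleDr scaleDl.

Let scaleAl k (x y : converse_alg) : k *: (x * y) = (k *: x) * y.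
Proof. exact: (@scalerAr K A). Qed.
HB.instance Definition _ := GRing.Lmodule_isLalgebra.Build K converse_alg scaleAl.
Let scaleAr k (x y : converse_alg) : k *: (x * y) = x * (k *: y).
Proof. exact: (@scalerAl K A). Qed.
HB.instance Definition _ := GRing.Lalgebra_isAlgebra.Build K converse_alg scaleAr.

Definition to_converse : antihom converse_alg A :=
  @Antihom K converse_alg A (fun x => x) (fun _ _ => erefl) (fun _ _ => erefl)
    (fun _ _ => erefl) erefl.
Definition of_converse : antihom A converse_alg :=
  @Antihom K A converse_alg (fun x => x) (fun _ _ => erefl) (fun _ _ => erefl)
    (fun _ _ => erefl) erefl.

Lemma converse_charM (e : character A) (x y : converse_alg) :
  e (x * y) = e x * e y.
Proof. by rewrite mulrC -charM. Qed.

Definition converse_char (e : character A) : character converse_alg :=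
  @Character K converse_alg e (@charD _ _ e) (@charZ _ _ e) (converse_charM e)
    (@char1 _ _ e).

Lemma Kspan_converse (S S' : A -> Prop) (x : A) : (forall y, S y -> S' y) ->
  @Kspan K A A^o S x -> @Kspan K converse_alg (converse_alg^o) S' x.
Proof.
move=> h; elim=> [|k y z Sy _ IH]; first exact: Kspan0.
suff -> : k%:A *: y + z = (k%:A : converse_alg) *: (y : converse_alg^o) + z.
  by apply: KspanC => //; apply: h.
congr (_ + _); rewrite /GRing.scale /= mulr_algl.
exact: esym (@mulr_algl K converse_alg k y).
Qed.

End ConverseAlgebra.

Section CharacterModule.
Variables (K : fieldType) (A : algType K) (e : character A).

(** The field K, tagged with the character that determines its module structure. *)
Definition char_mod (_ : character A) : Type := K.
Local Notation S := (char_mod e).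
HB.instance Definition _ := GRing.Zmodule.on S.

Definition char_scale (a : A) (s : S) : S := e a * (s : K).

Let scaleA a b x : char_scale a (char_scale b x) = char_scale (a * b) x.
Proof. by rewrite /char_scale charM mulrA. Qed.
Let scale1 : left_id 1 char_scale.
Proof. by move=> x; rewrite /char_scale char1 mul1r. Qed.
Let scaleDr : right_distributive char_scale +%R.
Proof. by move=> k x y; exact: mulrDr. Qed.
Let scaleDl x : {morph char_scale^~ x : a b / a + b}.
Proof. by move=> k l; rewrite /char_scale charD; exact: mulrDl. Qed.
HB.instance Definition _ := GRing.Zmodule_isLmodule.Build A S
  scaleA scale1 scaleDr scaleDl.

Definition char_mod_affords : affords e S :=
  @Affords K A e S (fun x => x) (fun _ _ => erefl) (fun _ _ => erefl)
    (fun _ _ h => h) (fun k => ex_intro _ k erefl).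

End CharacterModule.

Section OppositeQuiver.
Variable Q : quiver.

Definition opp_quiver : quiver :=
  @Quiver (vertex Q) (arrow Q) (@tgt Q) (@src Q) (quiver_nonempty Q).

Lemma walk_rev (v : vertex Q) (s : seq (arrow Q)) :
  @walk opp_quiver v s -> @walk Q (@walk_end opp_quiver v s) (rev s) /\
  @walk_end Q (@walk_end opp_quiver v s) (rev s) = v.
Proof.
elim: s v => [|a s IHs] v //= /andP[/eqP <- /IHs[hw he]].
rewrite rev_cons -cats1 walk_cat walk_end_cat.
rewrite (_ : @walk_end opp_quiver _ (a :: s) = @walk_end opp_quiver (src a) s) //.
by rewrite hw he /= eqxx.
Qed.

Definition rev_path (p : qpath opp_quiver) : qpath Q :=
  exist (fun p : vertex Q * seq (arrow Q) => @walk Q p.1 p.2)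
    (@pend opp_quiver p, rev (parrows p)) (proj1 (walk_rev (valP p))).

Lemma psrc_rev p : psrc (rev_path p) = pend p. Proof. by []. Qed.
Lemma parrows_rev p : parrows (rev_path p) = rev (parrows p). Proof. by []. Qed.
Lemma pend_rev p : pend (rev_path p) = psrc p.
Proof. exact: proj2 (walk_rev (valP p)). Qed.
Lemma plen_rev p : plen (rev_path p) = plen p.
Proof. exact: size_rev. Qed.

Lemma rev_path_inj : injective rev_path.
Proof.
move=> p q E; apply: qpathP; first by rewrite -!pend_rev E.
by apply: (can_inj revK); rewrite -!parrows_rev E.
Qed.

Lemma rev_vpath v : rev_path (@vpath opp_quiver v) = @vpath Q v.
Proof. exact: qpathP. Qed.

Lemma rev_pcat p q : pend p = psrc q ->
  rev_path (pcat p q) = pcat (rev_path q) (rev_path p).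
Proof.
move=> h; have h' : pend (rev_path q) = psrc (rev_path p) by rewrite pend_rev.
apply: qpathP; rewrite ?(psrc_pcat h') ?psrc_rev ?pend_pcat //.
by rewrite (parrows_pcat h') !parrows_rev parrows_pcat // rev_cat.
Qed.

End OppositeQuiver.

Lemma rev_path_surj (Q : quiver) (p : qpath Q) : exists q, rev_path q = p.
Proof.
have h : @walk (opp_quiver Q) (pend p) (rev (parrows p)) /\
    @walk_end (opp_quiver Q) (pend p) (rev (parrows p)) = psrc p.
  case: Q p => V E s t h p.
  exact: (@walk_rev (opp_quiver (Quiver s t h)) (psrc p) (parrows p) (valP p)).
exists (exist (fun p : vertex (opp_quiver Q) * seq (arrow (opp_quiver Q)) =>
                 @walk (opp_quiver Q) p.1 p.2)
         (pend p, rev (parrows p)) (proj1 h)).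
by apply: qpathP; [exact: (proj2 h) | rewrite parrows_rev /parrows /= revK].
Qed.

Lemma is_chain_rcons (Q : quiver) (tip2 : rel (arrow Q)) (a : arrow Q) (s : seq (arrow Q)) :
  is_chain tip2 (src a) s -> (s <> [::] -> tip2 (last a s) a) ->
  is_chain tip2 (tgt a) (rcons s a) /\ start (tgt a) (rcons s a) = start (src a) s.
Proof.
elim: s => [|b s IHs]; first by rewrite /= eqxx.
move=> /= /and3P[hb hs hf] hl; split=> //.
have [|h1 h2] := IHs hs.
  by case: (s) hl => [|c r] //= hl _; apply: hl.
rewrite h2 hb h1; case: (s) hl hf => [|c r] //= hl _; exact: hl.
Qed.

(** Chains ending at v in the opposite quiver are the reversals of chains starting at
    v. *)
Lemma rev_chain (Q : quiver) (tip2 : rel (arrow Q)) (v : vertex Q) (s : seq (arrow Q)) :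
  @is_chain (opp_quiver Q) (fun a b => tip2 b a) v s ->
  @is_chain Q tip2 (@start (opp_quiver Q) v s) (rev s) /\
  @start Q (@start (opp_quiver Q) v s) (rev s) = v.
Proof.
elim: s => [|a s IHs] //= /and3P[/eqP ha /IHs[h1 h2] h3].
have ea : @src Q a = @start (opp_quiver Q) v s := ha.
have [||c1 c2] := @is_chain_rcons Q tip2 a (rev s).
- by rewrite ea.
- by case: (s) h3 => [|b r] //= h _; rewrite rev_cons last_rcons.
by rewrite rev_cons; split; [exact: c1 | rewrite [LHS]c2 ea].
Qed.

Section OppositePbw.
Variables (K : fieldType) (A : algType K) (Q : quiver) (succ : rel (qpath Q)).
Variables (tip2 : rel (arrow Q)) (beta : qpath Q -> A) (eps : vertex Q -> character A).
Hypothesis H : pbw succ tip2 beta eps.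

Lemma Kspan_of_converse (S S' : A -> Prop) (x : A) : (forall y, S y -> S' y) ->
  @Kspan K (converse_alg A) (converse_alg A)^o S x -> @Kspan K A A^o S' x.
Proof.
move=> h; elim=> [|k y z Sy _ IH]; first exact: Kspan0.
suff -> : (k%:A : converse_alg A) *: (y : (converse_alg A)^o) + z = k%:A *: (y : A^o) + z.
  by apply: KspanC => //; apply: h.
congr (_ + _); apply: esym; rewrite /GRing.scale /= mulr_algl.
exact: esym (@mulr_algl K (converse_alg A) k y).
Qed.

Lemma opp_pbw : @pbw K (converse_alg A) (opp_quiver Q)
  (fun p q => succ (rev_path p) (rev_path q)) (fun a b => tip2 b a)
  (fun p => beta (rev_path p)) (fun v => converse_char (eps v)).
Proof.
split.
- by move=> p; apply: (pbw_irr H).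
- by move=> q p r; apply: (pbw_trans H).
- by move=> p q ne; apply: (pbw_total H); apply: contra_neq ne => /rev_path_inj.
- move=> p; move: {2}(rev_path p) (erefl (rev_path p)) => u.
  elim/(well_founded_ind (pbw_wf H)): u p => u IH p pu.
  by constructor=> q; rewrite pu => /IH; apply.
- move=> p q r hp hq s; rewrite !rev_pcat //.
  by apply: (pbw_catl H) => //; rewrite pend_rev.
- move=> p q r hp hq s; rewrite !rev_pcat //.
  by apply: (pbw_catr H) => //; rewrite pend_rev.
- move=> p q h; rewrite rev_pcat //; apply: (pbw_mul H).
  by rewrite pend_rev.
- move=> p q h; apply: (pbw_mul0 H).
  by rewrite pend_rev eq_sym.
- rewrite -[RHS](pbw_one H); apply: eq_bigr => v _; congr beta; exact: rev_vpath.
- move=> a; apply: Kspan_converse (pbw_span H a) => _ [p ->].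
  by have [q <-] := rev_path_surj p; exists q.
- move=> t a b ht rel; have := @pbw_rel _ _ _ _ _ _ _ H (rev_path t) b a _ rel.
  rewrite parrows_rev ht => /(_ erefl); apply: Kspan_converse => _ [q' [s pq ->]].
  have [q qE] := rev_path_surj q'; exists q; rewrite qE; split=> //.
  by case: pq; rewrite -qE !pend_rev !psrc_rev !plen_rev => ? ? ?; split.
- move=> p hp hs; apply: (pbw_free H (p := rev_path p)).
    by rewrite parrows_rev rev_sorted.
  by apply: Kspan_of_converse hs => _ [q s ->]; exists (rev_path q).
- move=> v p; rewrite [LHS](pbw_eps H); congr (_ *+ (nat_of_bool _)).
  by rewrite -rev_vpath; apply/eqP/eqP => [/rev_path_inj|->].
Qed.

End OppositePbw.

(** * Invariants read off from chains *)

Section Consequences.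
Variables (K : fieldType) (A : algType K) (Q : quiver) (succ : rel (qpath Q)).
Variables (tip2 : rel (arrow Q)) (beta : qpath Q -> A) (eps : vertex Q -> character A).
Hypothesis H : pbw succ tip2 beta eps.
Variables (S : vertex Q -> lmodType A) (cS : forall v, affords (eps v) (S v)).

Lemma pbw_Ext n v w : exists phi : Ext n (S v) (S w) -> {ffun chain_from tip2 v w n -> K^o},
  linear phi /\ bijective phi.
Proof.
have [f [f_lin f_bij]] := minimal_Ext (free_resolution (S v)) n
  (anick_minimal (H := H) (cS := cS v) (cS w)).
have [g [g_lin g_bij]] := anick_Hom H (cS v) n (cS w).
exists (g \o f); split; last exact: bij_comp.
by move=> k x y /=; rewrite f_lin g_lin.
Qed.

(** A chain from w to v gives a nonzero cochain with values in S_w. *)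
Lemma chain_hom_nonzero v s : is_chain tip2 v s ->
  exists f : {linear pr_mod (anick_resolution H (cS v)) (size s) -> S (start v s)},
    ~ forall x, f x = 0.
Proof.
move=> hs; pose w := start v s.
pose c : chain tip2 v (size s) :=
  exist (fun c : (size s).-tuple _ => is_chain tip2 v c) (in_tuple s) hs.
have cw : chain_start c == w by [].
pose d : chain_from tip2 v w (size s) := exist _ c cw.
have [g [g_lin [h gh hg]]] := anick_Hom H (cS v) (size s) (cS w).
exists (h [ffun _ => 1]) => h0.
have e : h [ffun _ => 1] = 0 by apply: happ_inj.
have g0 : g 0 = 0.
  have := g_lin 1 0 0; rewrite !scale1r addr0 => /esym/eqP.
  by rewrite -subr_eq0 addrK => /eqP.
have /(congr1 (fun f : {ffun _ -> K^o} => f d)) := hg [ffun _ => 1].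
by rewrite e g0 !ffunE => /esym/eqP; rewrite oner_eq0.
Qed.

Lemma pbw_proj_dim v n :
  (exists P : proj_resolution (S v), forall i, (n < i)%N -> forall x : pr_mod P i, x = 0) <->
  (forall s, (n < size s)%N -> ~~ is_chain tip2 v s).
Proof.
split=> [[P hP] s lt_n|h].
  apply/negP => hs; have [f []] := chain_hom_nonzero hs.
  apply: (projective_bound (R := P)); last exact: hP.
  exact: anick_minimal.
exists (anick_resolution H (cS v)) => i lt_n.
by apply: anick_trivial => c cE; apply: h; rewrite cE.
Qed.

(** Chains starting at v become chains ending at v in the opposite quiver; the
    resolution of the simple module there dualizes to an injective resolution. *)
Lemma pbw_inj_dim v n :
  (exists E : inj_resolution (S v), forall i, (n < i)%N -> forall x : ir_mod E i, x = 0) <->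
  (forall w s, (n < size s)%N -> is_chain tip2 w s -> start w s <> v).
Proof.
split=> [[E hE] w s lt_n hs ev|h].
  have [f []] := chain_hom_nonzero hs; move: f; rewrite ev => f x.
  by apply: injective_bound hE _ f lt_n x; apply: anick_minimal.
have H' := opp_pbw H.
pose cS' := char_mod_affords (converse_char (eps v)).
pose P := anick_resolution H' (v := v) cS'.
have e'E b : eps v b = converse_char (eps v) (to_converse A b) by [].
exists (dual_resolution (s := to_converse A) (t := of_converse A)
          (fun _ => erefl) (fun _ => erefl) e'E cS' (cS v) P).
move=> i lt_n phi; apply: functional_inj => x.
rewrite (_ : x = 0) ?functional0 //; move: x.
apply: (anick_trivial (H := H') (cS := cS')) => s sE; apply/negP => /rev_chain[hs ev].
by apply: h hs ev; rewrite size_rev sE.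
Qed.

End Consequences.

Section Bases.
Variables (K : fieldType) (I : finType).

Lemma lincomb_sum (V : lmodType K) (b : I -> V) (c : {malg K[I]}) :
  lincomb b c = \sum_(i : I) c@_i *: b i.
Proof.
rewrite /lincomb [RHS](bigID (fun i => i \in msupp c)) /= [X in _ + X]big1 ?addr0.
  rewrite -big_filter -[in RHS]big_filter; apply: perm_big.
  apply: uniq_perm; rewrite ?filter_uniq ?fset_uniq ?index_enum_uniq //.
  by move=> i; rewrite !mem_filter mem_index_enum andbT.
by move=> i /mcoeff_outdom ->; rewrite scale0r.
Qed.

Lemma ffun_is_basis (V : lmodType K) (phi : V -> {ffun I -> K^o}) :
  linear phi -> bijective phi -> exists b : I -> V, is_basis b.
Proof.
move=> phi_lin [psi phiK psiK].
pose b i : V := psi [ffun j => (i == j)%:R : K^o]; exists b.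
have E c : phi (lincomb b c) = [ffun i => c@_i].
  apply/ffunP => i; rewrite lincomb_sum.
  have phiZ a x : phi (a *: x) = a *: phi x := linearZZ (mklin phi_lin) a x.
  have -> : phi (\sum_i c@_i *: b i) = \sum_i phi (c@_i *: b i).
    exact: (linear_sum (mklin phi_lin)).
  rewrite sum_ffunE (bigD1 i) //= big1 ?addr0 => [|j ne].
    by rewrite phiZ !ffunE /= psiK ffunE eqxx; exact: mulr1.
  by rewrite phiZ !ffunE /= psiK ffunE (negbTE ne); exact: mulr0.
pose inv x : {malg K[I]} := \sum_i << phi x i *g i >>.
have invE x i : (inv x)@_i = phi x i.
  rewrite raddf_sum /= (bigD1 i) //= mcoeffU eqxx big1 ?addr0 // => j ne.
  by rewrite mcoeffU (negbTE ne).
exists inv => [c|x].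
  by apply/malgP => i; rewrite invE E ffunE.
by apply: (can_inj phiK); rewrite E; apply/ffunP => i; rewrite ffunE invE.
Qed.
End Bases.

(** * Coefficients in the path algebra *)

Section PathAlgebraCoefficients.
Variables (K : fieldType) (Q : quiver).
Implicit Types (x y : pathalg K Q) (p q r : qpath Q).
Local Notation elt := (@path_elt K Q).

Lemma pmulE p q : pend p = psrc q -> pmul K p q = elt (pcat p q).
Proof. by rewrite /pmul => /pcompE ->. Qed.

Lemma pmul0 p q : pend p != psrc q -> pmul K p q = 0.
Proof. by rewrite /pmul => /pcompNone ->. Qed.

Lemma path_eltMl p y : elt p * y = \sum_(r <- msupp y) y@_r *: pmul K p r.
Proof.
rewrite {1}[y]pathalgE mulr_sumr; apply: eq_bigr => r _.
by rewrite -scalerAr path_eltM.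
Qed.

Lemma path_eltMr p y : y * elt p = \sum_(r <- msupp y) y@_r *: pmul K r p.
Proof.
rewrite {1}[y]pathalgE mulr_suml; apply: eq_bigr => r _.
by rewrite -scalerAl path_eltM.
Qed.

Lemma msupp_sum (I : eqType) (s : seq I) (F : I -> pathalg K Q) q :
  q \in msupp (\sum_(i <- s) F i) -> exists2 i, i \in s & q \in msupp (F i).
Proof.
move=> hq; apply: contrapT => h; move: hq; rewrite -mcoeff_neq0 (raddf_sum (mcoeff q)) /=.
rewrite big_seq big1 ?eqxx // => i hi; apply: mcoeff_outdom; apply/negP => hq.
by apply: h; exists i.
Qed.

Lemma msupp_mul x y q : q \in msupp (x * y) ->
  exists p r, [/\ p \in msupp x, r \in msupp y, pend p = psrc r & q = pcat p r].
Proof.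
rewrite {1}[x]pathalgE mulr_suml => /msupp_sum[p hp].
rewrite -scalerAl => /(fsubsetP (msuppZ_le _ _)); rewrite path_eltMl.
move=> /msupp_sum[r hr] /(fsubsetP (msuppZ_le _ _)).
have [e|ne] := eqVneq (pend p) (psrc r); last by rewrite pmul0 // msupp0.
rewrite pmulE // msupp_path_elt inE => /eqP ->.
by exists p, r.
Qed.

Lemma mcoeff_sum (I : Type) (s : seq I) (F : I -> pathalg K Q) q :
  (\sum_(i <- s) F i)@_q = \sum_(i <- s) (F i)@_q.
Proof. exact: (raddf_sum (mcoeff q)). Qed.

Lemma mcoeff_expand y q : y@_q = \sum_(r <- msupp y) y@_r * (r == q)%:R.
Proof.
rewrite {1}[y]pathalgE mcoeff_sum; apply: eq_bigr => r _.
by rewrite [LHS]mcoeffZ mcoeff_path_elt.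
Qed.

Lemma mcoeff_vl v y q : (elt (vpath v) * y)@_q = (v == psrc q)%:R * y@_q.
Proof.
rewrite path_eltMl mcoeff_sum [in RHS]mcoeff_expand mulr_sumr.
apply: eq_bigr => r _; rewrite [LHS]mcoeffZ pmul_vl mulrCA; congr (_ * _).
have [->|ne] := eqVneq r q.
  by rewrite mulr1; case: ifP => _; rewrite ?mcoeff0 ?mcoeff_path_elt ?eqxx.
by rewrite mulr0; case: ifP => _; rewrite ?mcoeff0 ?mcoeff_path_elt ?(negbTE ne).
Qed.

Lemma mcoeff_vr v y q : (y * elt (vpath v))@_q = (v == pend q)%:R * y@_q.
Proof.
rewrite path_eltMr mcoeff_sum [in RHS]mcoeff_expand mulr_sumr.
apply: eq_bigr => r _; rewrite [LHS]mcoeffZ pmul_vr mulrCA; congr (_ * _).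
have [->|ne] := eqVneq r q.
  by rewrite mulr1; case: ifP => _; rewrite ?mcoeff0 ?mcoeff_path_elt ?eqxx.
by rewrite mulr0; case: ifP => _; rewrite ?mcoeff0 ?mcoeff_path_elt ?(negbTE ne).
Qed.

Definition contains (S : qpath Q -> Prop) q : Prop :=
  exists r s1 s2, S r /\ parrows q = s1 ++ parrows r ++ s2.

(** Elements whose paths all contain a member of S form an ideal. *)
Lemma ideal_gen_contains (X : pathalg K Q -> Prop) (S : qpath Q -> Prop) x :
  (forall y, X y -> exists2 r, S r & y = elt r) ->
  ideal_gen X x -> forall q, q \in msupp x -> contains S q.
Proof.
move=> hX; apply: (@ideal_gen_min K Q X (fun x => forall q, q \in msupp x -> contains S q)).
  split=> [q|y z hy hz q|y z hz q|y z hy q].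
  - by rewrite msupp0.
  - by move=> /(fsubsetP (msuppD_le _ _)); rewrite inE => /orP[/hy|/hz].
  - move=> /msupp_mul[p [r [_ /hz[t [s1 [s2 [St e]]]] h ->]]].
    exists t, (parrows p ++ s1), s2; split=> //.
    by rewrite parrows_pcat // e catA.
  - move=> /msupp_mul[p [r [/hy[t [s1 [s2 [St e]]]] _ h ->]]].
    exists t, s1, (s2 ++ parrows r); split=> //.
    by rewrite parrows_pcat // e -!catA.
move=> y /hX[r Sr ->] q; rewrite msupp_path_elt inE => /eqP ->.
by exists r, [::], [::]; rewrite cats0.
Qed.

End PathAlgebraCoefficients.

(** * Path bases of quotients of the path algebra *)

Section QuotientPbw.
Variables (K : fieldType) (Q : quiver) (succ : rel (qpath Q)).
Hypothesis succ_adm : length_admissible succ.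
Variables (T : {set path2 Q}) (I : relation_ideal K Q).
Local Notation A := (quotalg I).
Local Notation elt := (@path_elt K Q).

Definition related : rel (arrow Q) := fun a b => [exists t in T, sval t == (a, b)].

Definition class (p : qpath Q) : A := qpi I (elt p).

Lemma admissible_wf : well_founded (fun p q => succ q p).
Proof.
move=> p; apply: contrapT => np.
have [q [nq hq]] := la_least succ_adm (ex_intro (fun p => ~ Acc (fun p q => succ q p) p) p np).
apply: nq; constructor => r s; apply: contrapT => nr.
have [e|s'] := hq _ nr; first by rewrite e (la_irr succ_adm) in s.
by have := la_trans succ_adm s s'; rewrite (la_irr succ_adm).
Qed.

Definition vertex_coef (v : vertex Q) (a : A) : K := (qrepr a)@_(vpath v).

Lemma vertex_coefE v x : vertex_coef v (qpi I x) = x@_(vpath v).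
Proof.
by have := @simple_scaleE K Q I v x (1 : K); rewrite mulr1 => <-; rewrite /simple_scale mulr1.
Qed.

Lemma vertex_coefD v a b : vertex_coef v (a + b) = vertex_coef v a + vertex_coef v b.
Proof. by rewrite -[a]qreprK -[b]qreprK -qpiD !vertex_coefE mcoeffD. Qed.
Lemma vertex_coefZ v k a : vertex_coef v (k *: a) = k * vertex_coef v a.
Proof. by rewrite -[a]qreprK -qpiZ !vertex_coefE mcoeffZ. Qed.
Lemma vertex_coefM v a b : vertex_coef v (a * b) = vertex_coef v a * vertex_coef v b.
Proof. by rewrite -[a]qreprK -[b]qreprK -qpiM !vertex_coefE mcoeff_vpathM. Qed.
Lemma vertex_coef1 v : vertex_coef v 1 = 1.
Proof. by rewrite [LHS]vertex_coefE mcoeff_pa_one. Qed.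

Definition vertex_char v : character A :=
  Character (vertex_coefD v) (vertex_coefZ v) (vertex_coefM v) (vertex_coef1 v).

Definition simple_affords v : affords (vertex_char v) (S_ I v) :=
  @Affords K A (vertex_char v) (S_ I v) (fun x => x) (fun _ _ => erefl)
    (fun _ _ => erefl) (fun _ _ h => h) (fun k => ex_intro _ k erefl).

Lemma qpi_sum (J : Type) (s : seq J) (P : pred J) (F : J -> pathalg K Q) :
  qpi I (\sum_(i <- s | P i) F i) = \sum_(i <- s | P i) qpi I (F i).
Proof. by apply: (big_morph (qpi I)) => [x y|]; [exact: qpiD | exact: qpi0]. Qed.

Lemma quot_scaleE k (a : A) : k *: a = k%:A *: (a : A^o).
Proof. by rewrite [RHS]/GRing.scale /= mulr_algl. Qed.

Lemma class_span (S : A -> Prop) x : (forall p, p \in msupp x -> S (class p)) ->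
  @Kspan K A A^o S (qpi I x).
Proof.
move=> h; rewrite [x]pathalgE qpi_sum big_seq.
apply: (big_ind (@Kspan K A A^o S)) => [|y z|p hp]; [exact: Kspan0 | exact: KspanD |].
by rewrite qpiZ quot_scaleE; apply/KspanZ/Kspan_incl/h.
Qed.

Lemma span_class (S : qpath Q -> Prop) (a : A) :
  @Kspan K A A^o (fun y => exists2 p, S p & y = class p) a ->
  exists2 x, a = qpi I x & forall p, p \in msupp x -> S p.
Proof.
elim=> [|k y z [p Sp ->] _ [x -> hx]].
  by exists 0; rewrite ?qpi0 // => p; rewrite msupp0.
exists (k *: elt p + x); first by rewrite qpiD qpiZ quot_scaleE.
move=> q /(fsubsetP (msuppD_le _ _)); rewrite inE => /orP[|/hx//].
by move=> /(fsubsetP (msuppZ_le _ _)); rewrite msupp_path_elt inE => /eqP ->.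
Qed.

Lemma parrows_of2 (t : path2 Q) : parrows (path_of2 t) = [:: (sval t).1; (sval t).2].
Proof. by []. Qed.

Lemma related_path p a b : parrows p = [:: a; b] -> related a b ->
  exists2 t, t \in T & p = path_of2 t.
Proof.
move=> e /existsP[t /andP[tT /eqP te]]; exists t => //; apply: qpathP.
  have : walk (psrc p) (parrows p) := valP p.
  by rewrite e /= => /andP[/eqP <- _]; rewrite /psrc /= te.
by rewrite e parrows_of2 te.
Qed.

Hypothesis rel_low : forall t, t \in T ->
  Kspan (fun x : A^o => exists q,
    [/\ succ (path_of2 t) q, parallel (path_of2 t) q & x = class q]) (class (path_of2 t)).
Hypothesis tip_related : forall x p, I x -> x != 0 -> is_tip succ x p ->
  ~~ sorted (fun a b => ~~ related a b) (parrows p).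

(** If the class of p were a combination of smaller ones, the difference would be an
    element of I with tip p; so independence of the paths free of relations is the
    assertion that they are not tips of I. *)
Lemma quot_pbw : pbw succ related class vertex_char.
Proof.
split.
- exact: la_irr succ_adm.
- exact: la_trans succ_adm.
- exact: la_total succ_adm.
- exact: admissible_wf.
- by move=> p q r hp hq s; apply: (la_mulr succ_adm) s _ _; apply: pcompE.
- by move=> p q r hp hq s; apply: (la_mull succ_adm) s _ _; apply: pcompE.
- by move=> p q h; rewrite /class -qpiM path_eltM pmulE.
- by move=> p q h; rewrite /class -qpiM path_eltM pmul0 // qpi0.
- by rewrite -qpi_sum.
- by move=> a; rewrite -[a]qreprK; apply: class_span => p _; exists p.
- by move=> t a b e /(related_path e)[t' tT ->]; apply: rel_low.
- move=> p fp /span_class[y ey hy].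
  have Iz : I (elt p - y) by apply/qpi_eq.
  have py : y@_p = 0.
    by apply: mcoeff_outdom; apply/negP => /hy; rewrite (la_irr succ_adm).
  have zp : (elt p - y)@_p = 1 by rewrite mcoeffB mcoeff_path_elt eqxx py subr0.
  apply/negP: fp; apply: (tip_related Iz (p := p)).
    by apply/eqP => z0; move: zp; rewrite z0 mcoeff0 => /esym/eqP; rewrite oner_eq0.
  split; first by rewrite -mcoeff_neq0 zp oner_eq0.
  move=> q /(fsubsetP (msuppB_le _ _)); rewrite inE msupp_path_elt inE.
  by case/orP=> [/eqP ->|/hy]; [left | right].
- by move=> v p; rewrite [LHS]vertex_coefE mcoeff_path_elt.
Qed.

End QuotientPbw.

(** * Monomial and strong Koszul relations *)

Section Relations.
Variables (K : fieldType) (Q : quiver) (succ : rel (qpath Q)).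
Hypothesis succ_adm : length_admissible succ.
Variables (T : {set path2 Q}).
Local Notation elt := (@path_elt K Q).

Lemma path_of2_inj : injective (@path_of2 Q).
Proof.
move=> s t /(congr1 (@parrows Q)); rewrite !parrows_of2 => -[e1 e2].
by apply: val_inj; rewrite /= [LHS]surjective_pairing [RHS]surjective_pairing e1 e2.
Qed.

Lemma path_of2_surj (p : qpath Q) : plen p = 2 -> exists t, p = path_of2 t.
Proof.
move=> lp; have hw : walk (psrc p) (parrows p) := valP p.
move: lp hw; rewrite /plen; case ep: (parrows p) => [|a [|b [|]]] // _.
move=> /= /and3P[/eqP sa sb _].
pose t : path2 Q := exist (fun ab : arrow Q * arrow Q => tgt ab.1 == src ab.2) (a, b)
  (etrans (eq_sym _ _) sb).
by exists t; apply: qpathP; rewrite ?parrows_of2 // -sa.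
Qed.

Lemma contains_related (S : qpath Q -> Prop) (p : qpath Q) :
  (forall r, S r -> exists2 t, t \in T & r = path_of2 t) -> contains S p ->
  ~~ sorted (fun a b => ~~ related T a b) (parrows p).
Proof.
move=> hS [r [s1 [s2 [/hS[t tT ->] ->]]]]; rewrite parrows_of2.
apply/negP => /cat_sorted2[_] /= /andP[/negP h _]; apply: h.
by apply/existsP; exists t; rewrite tT -surjective_pairing eqxx.
Qed.

Lemma elt_neq0 p : elt p != 0.
Proof.
apply/eqP => e; have := mcoeff_path_elt K p p.
by rewrite e mcoeff0 eqxx => /eqP; rewrite eq_sym oner_eq0.
Qed.

Lemma is_tip_elt p : is_tip succ (elt p) p.
Proof.
by split=> [|q]; rewrite msupp_path_elt inE // => /eqP; left.
Qed.

(** The relation of t is t = 0. *)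
Lemma monomial_pbw :
  pbw succ (related T) (class (T_ideal K T)) (@vertex_char K Q (T_ideal K T)).
Proof.
apply: (quot_pbw succ_adm) => [t tT|x p Ix _ [px _]].
  have -> : class (T_ideal K T) (path_of2 t) = 0; last exact: Kspan0.
  rewrite -(qpi0 (T_ideal K T)); apply/qpi_eq; rewrite subr0.
  by apply: ideal_gen_incl; exists t.
apply: (contains_related (S := fun r => exists2 t, t \in T & r = path_of2 t)) => //.
apply: ideal_gen_contains Ix p px => _ [t tT ->].
by exists (path_of2 t) => //; exists t.
Qed.

Variable X : affine_space K succ T.
Hypothesis X_in : GrAlg X.

Lemma N2_notin n : n \in Defs.N2 K succ T -> n \notin T.
Proof.
rewrite inE => /asboolP nt; apply/negP => nT; apply: nt.
exists (elt (path_of2 n)); split; [|exact: elt_neq0 |exact: is_tip_elt].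
by apply: ideal_gen_incl; exists n.
Qed.

Lemma coordP (i : Defs.coord K succ T) :
  [/\ (sval i).1 \in T, (sval i).2 \notin T,
      succ (path_of2 (sval i).1) (path_of2 (sval i).2) &
      parallel (path_of2 (sval i).1) (path_of2 (sval i).2)].
Proof.
case: i => -[t n] /= /andP[tT]; rewrite inE => /andP[/N2_notin nT /and3P[s /eqP es /eqP ee]].
by split.
Qed.

(** The coefficient of n after rewriting each t of T by its tail, the sum of the
    x_(t,n) n. *)
Definition reduction (n : path2 Q) (x : pathalg K Q) : K :=
  x@_(path_of2 n) +
  \sum_(i : Defs.coord K succ T | (sval i).2 == n) X i * x@_(path_of2 (sval i).1).

(** The ideal of the elements whose terms of length at most 2 vanish after rewriting:
    longer terms are not constrained, so multiplying by an arrow stays inside. *)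
Definition reduces_to0 (x : pathalg K Q) : Prop :=
  (forall q, (plen q <= 1)%N -> x@_q = 0) /\ (forall n, n \notin T -> reduction n x = 0).

Lemma reduces_to0_long x : (forall q, (plen q <= 2)%N -> x@_q = 0) -> reduces_to0 x.
Proof.
move=> h; split=> [q hq|n _]; first by apply: h; apply: leq_trans hq _.
by rewrite /reduction h // add0r big1 // => i _; rewrite h ?mulr0.
Qed.

Lemma reduces_to0D x y : reduces_to0 x -> reduces_to0 y -> reduces_to0 (x + y).
Proof.
move=> [hx1 hx2] [hy1 hy2]; split=> [q hq|n nT].
  by rewrite mcoeffD hx1 ?hy1 ?addr0.
rewrite -[RHS](addr0 0) -{1}(hx2 n nT) -(hy2 n nT) /reduction mcoeffD addrACA.
by congr (_ + _); rewrite -big_split; apply: eq_bigr => i _; rewrite mcoeffD mulrDr.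
Qed.

Lemma reduces_to0Z k x : reduces_to0 x -> reduces_to0 (k *: x).
Proof.
move=> [hx1 hx2]; split=> [q hq|n nT]; first by rewrite [LHS]mcoeffZ hx1 ?mulr0.
rewrite -[RHS](mulr0 k) -(hx2 n nT) /reduction mulrDr [in LHS]mcoeffZ; congr (_ + _).
by rewrite mulr_sumr; apply: eq_bigr => i _; rewrite [in LHS]mcoeffZ mulrCA.
Qed.

(** Multiplication by a vertex selects the terms with a given end, and the tail of t is
    parallel to t. *)
Lemma reduces_to0_vertex (f : qpath Q -> bool) x y :
  (forall p q, parallel p q -> f p = f q) -> (forall q, y@_q = (f q)%:R * x@_q) ->
  reduces_to0 x -> reduces_to0 y.
Proof.
move=> hf hy [hx1 hx2]; split=> [q hq|n nT]; first by rewrite hy hx1 ?mulr0.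
rewrite -[RHS](mulr0 (f (path_of2 n))%:R) -(hx2 n nT) /reduction mulrDr hy; congr (_ + _).
rewrite mulr_sumr; apply: eq_bigr => i /eqP iE; rewrite hy mulrCA.
by have [_ _ _ /hf->] := coordP i; rewrite iE.
Qed.

Lemma reduces_to0_ideal : is_ideal reduces_to0.
Proof.
have h0 : reduces_to0 0 by apply: reduces_to0_long => q _; rewrite mcoeff0.
split=> // [|x y hy|x y hx]; first exact: reduces_to0D.
- rewrite [x]pathalgE mulr_suml; apply: (big_ind reduces_to0) => // [|p _].
    exact: reduces_to0D.
  rewrite -scalerAl; apply: reduces_to0Z; case/boolP: (plen p == 0) => [p0|p0].
    rewrite (path_nil (size0nil (eqP p0))).
    apply: (reduces_to0_vertex (f := fun q => psrc p == psrc q)) hy.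
      by move=> q r [-> _ _].
    by move=> q; rewrite mcoeff_vl.
  apply: reduces_to0_long => q hq; apply: mcoeff_outdom; apply/negP => /msupp_mul.
  rewrite msupp_path_elt => -[p' [r [/fset1P -> hr e qE]]].
  move: hr; rewrite -mcoeff_neq0 (proj1 hy) ?eqxx //.
  move: hq p0; rewrite qE plen_pcat //; case: (plen p) => // m.
  by rewrite addSn ltnS => /(leq_trans (leq_addl _ _)).
- rewrite [y]pathalgE mulr_sumr; apply: (big_ind reduces_to0) => // [|p _].
    exact: reduces_to0D.
  rewrite -scalerAr; apply: reduces_to0Z; case/boolP: (plen p == 0) => [p0|p0].
    rewrite (path_nil (size0nil (eqP p0))).
    apply: (reduces_to0_vertex (f := fun q => psrc p == pend q)) hx.
      by move=> q r [_ -> _].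
    by move=> q; rewrite mcoeff_vr.
  apply: reduces_to0_long => q hq; apply: mcoeff_outdom; apply/negP => /msupp_mul.
  rewrite msupp_path_elt => -[r [p' [hr /fset1P -> e qE]]].
  move: hr; rewrite -mcoeff_neq0 (proj1 hx) ?eqxx //.
  move: hq p0; rewrite qE plen_pcat // addnC; case: (plen p) => // m.
  by rewrite addSn ltnS => /(leq_trans (leq_addl _ _)).
Qed.

Lemma gen_at_coef t q : (gen_at X t)@_q =
  (path_of2 t == q)%:R -
  \sum_(i : Defs.coord K succ T | (sval i).1 == t) X i * (path_of2 (sval i).2 == q)%:R.
Proof.
rewrite /gen_at mcoeffB mcoeff_path_elt (raddf_sum (mcoeff q)); congr (_ - _).
by apply: eq_bigr => i _; rewrite [LHS]mcoeffZ mcoeff_path_elt.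
Qed.

Lemma gens_reduce_to0 x : ideal_gen (gens X) x -> reduces_to0 x.
Proof.
apply: ideal_gen_min; first exact: reduces_to0_ideal.
move=> _ [t tT ->]; split=> [q hq|n nT].
  have ne (s : path2 Q) : (path_of2 s == q) = false.
    by apply/eqP => e; rewrite -e in hq.
  by rewrite gen_at_coef ne big1 ?subrr // => i _; rewrite ne mulr0.
rewrite /reduction gen_at_coef (inj_eq path_of2_inj).
have -> : (t == n) = false by apply/negP => /eqP e; rewrite -e tT in nT.
rewrite sub0r big_mkcond [X in _ + X]big_mkcond /= addrC; apply/eqP; rewrite subr_eq0.
apply/eqP; apply: eq_bigr => i _; have [iT iN _ _] := coordP i.
rewrite (inj_eq path_of2_inj) gen_at_coef big1 ?subr0 => [|j _]; last first.
  have [_ jN _ _] := coordP j; rewrite (inj_eq path_of2_inj).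
  by case: eqP => [e|]; rewrite ?mulr0 //; rewrite e iT in jN.
rewrite (inj_eq path_of2_inj) [in RHS]eq_sym.
by case: eqP => _; case: eqP => _; rewrite ?mulr0.
Qed.

(** If n is not in T, its coefficient in g is cancelled by some t of T in the support of
    g with n in the tail of t, so t is larger than n and n is not the tip. *)
Lemma tip_in_T g n : ideal_gen (gens X) g -> is_tip succ g (path_of2 n) -> n \in T.
Proof.
move=> /gens_reduce_to0[_ h] [ng gmax]; apply: contraT => nT.
have := h n nT; rewrite /reduction big1 => [|i /eqP iE].
  by rewrite addr0 => /eqP; move: ng; rewrite -mcoeff_neq0 => /negbTE ->.
apply/eqP; rewrite mulf_eq0; apply/orP; right; rewrite mcoeff_eq0; apply/negP => /gmax.
have [_ _ s _] := coordP i; rewrite iE in s.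
case=> [e|s']; first by rewrite e (la_irr succ_adm) in s.
by have := la_trans succ_adm s s'; rewrite (la_irr succ_adm).
Qed.

(** The tips of I are generated by the tips of a quadratic Groebner basis, which lie in
    T by [tip_in_T]. *)
Lemma strong_Koszul_pbw :
  pbw succ (related T) (class (gens_ideal X)) (@vertex_char K Q (gens_ideal X)).
Proof.
apply: (quot_pbw succ_adm) => [t tT|x p Ix nx tx].
  have -> : class (gens_ideal X) (path_of2 t) = qpi (gens_ideal X)
      (\sum_(i : Defs.coord K succ T | (sval i).1 == t) X i *: elt (path_of2 (sval i).2)).
    by apply/qpi_eq; apply: ideal_gen_incl; exists t.
  rewrite qpi_sum; apply: (big_ind (@Kspan _ _ _ _)) => [|y z|i /eqP iE].
  - exact: Kspan0.
  - exact: KspanD.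
  rewrite qpiZ quot_scaleE; apply/KspanZ/Kspan_incl.
  by have [_ _ s pq] := coordP i; exists (path_of2 (sval i).2); rewrite -iE.
(* The path p lies in the ideal of the tips of G, so it contains one of them. *)
have [G [[_ GI _ tipG] quadG]] := X_in.
have Gp : ideal_gen (path_elts (K:=K) (tips succ G)) (elt p).
  by apply/tipG; apply: ideal_gen_incl; exists p; split=> //; exists x.
apply: (contains_related (S := tips succ G)).
  move=> r [g [Gg _ tg]]; have [t rE] := path_of2_surj (quadG g Gg r (proj1 tg)).
  by exists t => //; apply: tip_in_T (GI g Gg) _; rewrite -rE.
apply: (ideal_gen_contains _ Gp); last by rewrite msupp_path_elt inE.
by move=> y [r [Sr ->]]; exists r.
Qed.

End Relations.

Lemma least_ext (P R : nat -> Prop) : (forall n, P n <-> R n) -> least P = least R.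
Proof. by move=> h; congr least; apply/funext => n; apply/propext. Qed.

Theorem theorem4p6 (K : fieldType) (Q : quiver) (succ : rel (qpath Q))
  (succ_adm : length_admissible succ) (T : {set path2 Q})
  (X : affine_space K succ T) (X_in : GrAlg X) (v w : vertex Q) :
  let I := gens_ideal X in
  let I' := T_ideal K T in
  [/\ forall n : nat,
        same_dim (Ext n (S_ I v) (S_ I w)) (Ext n (S_ I' v) (S_ I' w)),
      proj_dim (S_ I v) = proj_dim (S_ I' v) &
      inj_dim (S_ I v) = inj_dim (S_ I' v)].
Proof.
move=> I I'.
have H := strong_Koszul_pbw succ_adm X_in.
have H' := monomial_pbw K succ_adm T.
split=> [n||].
- have [f [f_lin f_bij]] := pbw_Ext H (@simple_affords K Q I) n v w.
  have [g [g_lin g_bij]] := pbw_Ext H' (@simple_affords K Q I') n v w.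
  have [b b_basis] := ffun_is_basis f_lin f_bij.
  have [c c_basis] := ffun_is_basis g_lin g_bij.
  by exists (chain_from (related T) v w n), b, c.
- apply: least_ext => n; rewrite (pbw_proj_dim H (@simple_affords K Q I)).
  by rewrite (pbw_proj_dim H' (@simple_affords K Q I')).
- apply: least_ext => n; rewrite (pbw_inj_dim H (@simple_affords K Q I)).
  by rewrite (pbw_inj_dim H' (@simple_affords K Q I')).
Qed.
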